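(* Let $\mathfrak{P}$ be the class of permutations, i.e. of finite sets equipped with two total orders $<$ and $\prec$. There exist thirty-seven $\mathbf{Z}$-valued measures $\mu_1,\dots,\mu_{37}$ on $\mathfrak{P}$, and together they define a ring isomorphism $$\Theta(\mathfrak{P}) \to \mathbf{Z}^{37},\qquad [i]\mapsto (\mu_1(i),\dots,\mu_{37}(i)),$$ where $\Theta(\mathfrak{P})$ is the ring carrying the universal measure on $\mathfrak{P}$. Explicitly, write $\mu(X,x)$ for the value of $\mu$ on the inclusion $X\setminus\{x\}\to X$, and write a marked permutation $(X,x)$ as a word with a dot over the marked element. The thirty-seven measures are determined by their values on the ten marked permutations $$\dot 1,\quad \dot 1 2,\quad 1\dot 2,\quad 2\dot 1,\quad \dot 2 1,\quad 13\dot 2,\quad 1\dot 3 2,\quad \dot 2 3 1,\quad 2\dot 3 1,\quad 21\dot 3 54,$$ and the value vectors, in this order, are: 1: $(0,0,0,-1,0,-1,0,0,0,0)$; 2: $(0,0,0,0,-1,-1,0,0,0,0)$; 3: $(0,0,0,-1,0,0,-1,0,0,0)$; 4: $(0,0,0,0,-1,0,-1,0,0,0)$; 5: $(0,-1,0,0,0,0,0,-1,0,0)$; 6: $(0,0,-1,0,0,0,0,-1,0,0)$; 7: $(0,-1,0,0,0,0,0,0,-1,0)$; 8: $(0,0,-1,0,0,0,0,0,-1,0)$; 9: $(0,-1,0,0,0,0,0,0,0,-1)$; 10: $(0,0,-1,0,0,0,0,0,0,-1)$; 11: $(0,0,0,-1,0,0,0,0,0,-1)$; 12: $(0,0,0,0,-1,0,0,0,0,-1)$;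 13: $(0,0,0,-1,0,-1,-1,0,0,1)$; 14: $(0,0,0,0,-1,-1,-1,0,0,1)$; 15: $(0,-1,0,0,0,0,0,-1,-1,1)$; 16: $(0,0,-1,0,0,0,0,-1,-1,1)$; 17: $(0,1,0,-1,-1,-1,-1,0,0,1)$; 18: $(0,0,1,-1,-1,-1,-1,0,0,1)$; 19: $(0,-1,-1,1,0,0,0,-1,-1,1)$; 20: $(0,-1,-1,0,1,0,0,-1,-1,1)$; 21: $(1,0,0,0,0,-1,0,0,0,0)$; 22: $(1,0,0,0,0,0,-1,0,0,0)$; 23: $(1,0,0,0,0,0,0,-1,0,0)$; 24: $(1,0,0,0,0,0,0,0,-1,0)$; 25: $(1,0,0,0,0,0,0,0,0,-1)$; 26: $(1,0,0,0,0,-1,-1,0,0,1)$; 27: $(1,0,0,0,0,0,0,-1,-1,1)$; 28: $(-1,-1,-1,0,0,0,0,-1,0,0)$; 29: $(-1,-1,-1,0,0,0,0,0,-1,0)$; 30: $(-1,-1,-1,0,0,0,0,0,0,-1)$; 31: $(-1,-1,-1,0,0,0,0,-1,-1,1)$; 32: $(-1,0,0,-1,-1,-1,0,0,0,0)$; 33: $(-1,0,0,-1,-1,0,-1,0,0,0)$; 34: $(-1,0,0,-1,-1,0,0,0,0,-1)$; 35: $(-1,0,0,-1,-1,-1,-1,0,0,1)$; 36: $(1,1,1,-1,-1,-1,-1,0,0,1)$; 37: $(1,-1,-1,1,1,0,0,-1,-1,1)$.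
   Context: A permutation is a finite (possibly empty) set equipped with two total orders $<$ and $\prec$. An embedding of permutations is an injective map that preserves both orders. A permutation is denoted by a sequence of distinct numbers: $<$ is the usual order on numbers, and $\prec$ is the order of appearance in the sequence. For instance $3142$ is the permutation on $\{1,2,3,4\}$ with $1<2<3<4$ and $3\prec 1\prec 4\prec 2$. A marked permutation is a pair $(X,x)$ with $X$ a permutation and $x\in X$. Given embeddings $i\colon Y\to X$ and $j\colon Y\to Y'$ of permutations, an amalgamation is a permutation $X'$ with embeddings $i'\colon Y'\to X'$ and $j'\colon X\to X'$ such that $i'\circ j=j'\circ i$ and $i',j'$ are jointly surjective. Amalgamations are considered up to isomorphism, meaning isomorphisms of $X'$ compatible with $i'$ and $j'$. There are finitely many of them. A measure on $\mathfrak{P}$ valued in a commutative ring $k$ is a rule $\mu$ assigning to each embedding $i\colon Y\to X$ of permutations a value $\mu(i)\in k$ such that: (a) $\mu(i)=1$ if $i$ is an isomorphism; (b) $\mu(j\circ i)=\mu(j)\mu(i)$ whenever the composition is defined; (c) if $i\colon Y\to X$ and $j\colon Y\to Y'$ are embeddings and $(X'_\alpha,i'_\alpha,j'_\alpha)$, $1\le\alpha\le n$, are all the amalgamations up to isomorphism, then $\mu(i)=\sum_{\alpha=1}^n\mu(i'_\alpha)$. The ring $\Theta(\mathfrak{P})$ is the quotient of the polynomial ring over $\mathbf{Z}$ in formal symbols $[i]$, one for each embedding $i$ of permutations, by the ideal generated by the relations corresponding to (a), (b), (c), with $[i]$ in place of $\mu(i)$. Thus $k$-valued measures on $\mathfrak{P}$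 correspond bijectively to ring homomorphisms $\Theta(\mathfrak{P})\to k$. *)

(* Defs.v *)
From HB Require Import structures.
From mathcomp Require Import all_boot all_order all_algebra.
From mathcomp Require Import boolp classical_sets functions cardinality.
From mathcomp Require Import monalg.

Set Implicit Arguments.
Unset Strict Implicit.
Unset Printing Implicit Defensive.

Import GRing.Theory.

Local Open Scope ring_scope.

(* The carrier is in [Set] so that permutations, embeddings and polynomials
   in the embeddings are small enough to carry MathComp structures; a
   [finType] carrier gives a universe inconsistency. *)
Record permutation := Permutation {
  perm_sort :> Set;
  plt : rel perm_sort;
  pprec : rel perm_sort;
  perm_finite : finite_set [set: perm_sort];
  plt_irr : irreflexive plt;
  plt_trans : transitive plt;
  plt_total : forall x y, x <> y -> plt x y || plt y x;
  pprec_irr : irreflexive pprec;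
  pprec_trans : transitive pprec;
  pprec_total : forall x y, x <> y -> pprec x y || pprec y x }.

Record embedding (Y X : permutation) := Embedding {
  emb_fun :> Y -> X;
  emb_inj : injective emb_fun;
  emb_lt : {homo emb_fun : x y / plt x y};
  emb_prec : {homo emb_fun : x y / pprec x y} }.

Definition emb_comp (Z Y X : permutation) (j : embedding Y X)
    (i : embedding Z Y) : embedding Z X :=
  @Embedding Z X (j \o i) (inj_comp (@emb_inj _ _ j) (@emb_inj _ _ i))
    (fun x y h => @emb_lt _ _ j _ _ (@emb_lt _ _ i x y h))
    (fun x y h => @emb_prec _ _ j _ _ (@emb_prec _ _ i x y h)).

Definition emb_iso (Y X : permutation) (i : embedding Y X) : Prop :=
  exists j : embedding X Y, cancel i j /\ cancel j i.

Record amalgamation (Y X Y' : permutation)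
    (i : embedding Y X) (j : embedding Y Y') := Amalgamation {
  amalg_perm :> permutation;
  amalg_i : embedding Y' amalg_perm;
  amalg_j : embedding X amalg_perm;
  amalg_comm : forall y, amalg_i (j y) = amalg_j (i y);
  amalg_surj : forall z : amalg_perm,
    (exists y', amalg_i y' = z) \/ (exists x, amalg_j x = z) }.

Definition amalg_iso (Y X Y' : permutation) (i : embedding Y X)
    (j : embedding Y Y') (A B : amalgamation i j) : Prop :=
  exists f : embedding A B,
    [/\ emb_iso f, forall y', f (amalg_i A y') = amalg_i B y'
      & forall x, f (amalg_j A x) = amalg_j B x].

(* [A] lists each isomorphism class of amalgamations exactly once. *)
Definition all_amalgamations (Y X Y' : permutation) (i : embedding Y X)
    (j : embedding Y Y') (n : nat) (A : 'I_n -> amalgamation i j) : Prop :=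
  forall B : amalgamation i j, exists! a : 'I_n, amalg_iso B (A a).

(* Commutative rings are [comPzRingType]s: the zero ring is allowed. *)
Definition is_measure (k : comPzRingType)
    (mu : forall Y X : permutation, embedding Y X -> k) : Prop :=
  [/\ forall (Y X : permutation) (i : embedding Y X),
        emb_iso i -> mu Y X i = 1,
      forall (Z Y X : permutation) (j : embedding Y X) (i : embedding Z Y),
        mu Z X (emb_comp j i) = mu Y X j * mu Z Y i
    & forall (Y X Y' : permutation) (i : embedding Y X) (j : embedding Y Y')
        (n : nat) (A : 'I_n -> amalgamation i j),
        all_amalgamations A ->
        mu Y X i = \sum_(a < n) mu Y' (A a) (amalg_i (A a))].

Definition gen_ideal (R : comNzRingType) (S : R -> Prop) : pred R :=
  fun p => `[< exists s : seq (R * R),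
    (forall q, q \in s -> S q.2) /\ p = \sum_(q <- s) q.1 * q.2 >].

Section GenIdealQuotient.
Variables (R : comNzRingType) (S : R -> Prop).

Lemma gen_idealMl a p : p \in gen_ideal S -> a * p \in gen_ideal S.
Proof.
move=> /asboolP[s [sS ->]]; apply/asboolP.
exists [seq (a * q.1, q.2) | q <- s]; split.
  by move=> _ /mapP[q qs ->] /=; exact: (sS _ qs).
by rewrite big_map mulr_sumr; apply: eq_bigr => q _; rewrite mulrA.
Qed.

Lemma gen_ideal_zmod : zmod_closed (gen_ideal S).
Proof.
split=> [|x y xS /(gen_idealMl (-1)) yS].
  by apply/asboolP; exists [::]; rewrite big_nil.
rewrite -mulN1r; move: xS yS => /asboolP[s [sS ->]] /asboolP[t [tS ->]].
apply/asboolP; exists (s ++ t); split; last by rewrite big_cat.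
by move=> q; rewrite mem_cat => /orP[/sS|/tS].
Qed.

HB.instance Definition _ :=
  GRing.isZmodClosed.Build R (gen_ideal S) gen_ideal_zmod.

Let I : zmodClosed R := GRing.ZmodClosed.clone R (gen_ideal S) _.

(* The library's ring structure on [{ideal_quot I}] requires [1 \notin I],
   which is not known in advance here; hence the direct construction. *)
Definition gen_quot : Type := {ideal_quot I}.

HB.instance Definition _ := GRing.Zmodule.on gen_quot.

Definition gen_pi : R -> gen_quot := \pi_({ideal_quot I})%qT.

Let gen_rep (x : gen_quot) : R := generic_quotient.repr x.

Let gen_repK x : gen_pi (gen_rep x) = x.
Proof. exact: generic_quotient.reprK. Qed.

Lemma gen_piP x y : gen_pi x = gen_pi y <-> x - y \in gen_ideal S.
Proof.
rewrite [x - y \in _](Quotient.idealrBE I).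
by split=> [|] /eqP.
Qed.

Lemma gen_piD : {morph gen_pi : x y / x + y}.
Proof. by move=> x y; exact: (raddfD \pi_({ideal_quot I})%qT). Qed.

Definition gen_one : gen_quot := gen_pi 1.
Definition gen_mul (x y : gen_quot) : gen_quot :=
  gen_pi (gen_rep x * gen_rep y).

Lemma gen_piM x y : gen_pi (x * y) = gen_mul (gen_pi x) (gen_pi y).
Proof.
apply/gen_piP; set x' := gen_rep _; set y' := gen_rep _.
have hx : x - x' \in gen_ideal S by apply/gen_piP; rewrite gen_repK.
have hy : y - y' \in gen_ideal S by apply/gen_piP; rewrite gen_repK.
have -> : x * y - x' * y' = y * (x - x') + x' * (y - y').
  by rewrite !mulrBr [y * x]mulrC [y * x']mulrC addrA subrK.
by apply: rpredD; exact: gen_idealMl.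
Qed.

Let gen_mulA : associative gen_mul.
Proof.
move=> x y z; rewrite -[x]gen_repK -[y]gen_repK -[z]gen_repK.
by rewrite -!gen_piM mulrA.
Qed.

Let gen_mulC : commutative gen_mul.
Proof.
by move=> x y; rewrite -[x]gen_repK -[y]gen_repK -!gen_piM mulrC.
Qed.

Let gen_mul1 : left_id gen_one gen_mul.
Proof. by move=> x; rewrite -[x]gen_repK -gen_piM mul1r. Qed.

Let gen_mulD : left_distributive gen_mul +%R.
Proof.
move=> x y z; rewrite -[x]gen_repK -[y]gen_repK -[z]gen_repK.
by rewrite -gen_piD -!gen_piM mulrDl gen_piD.
Qed.

HB.instance Definition _ := GRing.Zmodule_isComPzRing.Build gen_quot
  gen_mulA gen_mulC gen_mul1 gen_mulD.

End GenIdealQuotient.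

Record symbol := Symbol {
  sym_dom : permutation;
  sym_cod : permutation;
  sym_emb : embedding sym_dom sym_cod }.

HB.instance Definition _ := gen_eqMixin symbol.
HB.instance Definition _ := gen_choiceMixin symbol.

(* The polynomial ring over the integers in the symbols [i]. *)
Definition symbol_poly : comNzRingType := {malg int[{cmonom symbol}]}.

Definition var (Y X : permutation) (i : embedding Y X) : symbol_poly :=
  << ucm (Symbol i) >>.

Inductive theta_relation : symbol_poly -> Prop :=
| ThetaIso (Y X : permutation) (i : embedding Y X) :
    emb_iso i -> theta_relation (var i - 1)
| ThetaComp (Z Y X : permutation) (j : embedding Y X) (i : embedding Z Y) :
    theta_relation (var (emb_comp j i) - var j * var i)
| ThetaAmalg (Y X Y' : permutation) (i : embedding Y X) (j : embedding Y Y')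
    (n : nat) (A : 'I_n -> amalgamation i j) :
    all_amalgamations A ->
    theta_relation (var i - \sum_(a < n) var (amalg_i (A a))).

Definition Theta : comPzRingType := gen_quot theta_relation.

Definition theta_class (Y X : permutation) (i : embedding Y X) : Theta :=
  gen_pi theta_relation (var i).

Section Deletion.
Variables (X : permutation) (x : X).

Definition del_sort : Set := {y : X | y <> x}.

Lemma del_val_inj : injective (fun u : del_sort => sval u).
Proof. by move=> [u hu] [v hv] /= uv; apply: eq_exist. Qed.

Lemma del_finite : finite_set [set: del_sort].
Proof.
rewrite -(preimage_setT (fun u : del_sort => sval u)).
by apply: finite_preimage (perm_finite X) => u v _ _; exact: del_val_inj.
Qed.

Definition del : permutation.
Proof.
refine (@Permutation del_sort (fun u v => plt (sval u) (sval v))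
  (fun u v => pprec (sval u) (sval v)) del_finite _ _ _ _ _ _).
- by move=> u; exact: plt_irr.
- by move=> u v w; exact: plt_trans.
- by move=> u v uv; apply: plt_total => /del_val_inj.
- by move=> u; exact: pprec_irr.
- by move=> u v w; exact: pprec_trans.
- by move=> u v uv; apply: pprec_total => /del_val_inj.
Defined.

Definition del_incl : embedding del X :=
  @Embedding del X (fun u => sval u) del_val_inj
    (fun _ _ h => h) (fun _ _ h => h).

End Deletion.

Record marked := Marked { marked_perm : permutation; mark : marked_perm }.

Definition mu_marked (k : comPzRingType)
    (mu : forall Y X : permutation, embedding Y X -> k) (m : marked) : k :=
  mu (del (mark m)) (marked_perm m) (del_incl (mark m)).

Section Word.
Variable w : seq nat.

Definition word_sort : Set := {n : nat | n \in w}.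

Lemma word_val_inj : injective (fun u : word_sort => sval u).
Proof. by move=> [u hu] [v hv] /= uv; apply: eq_exist. Qed.

Lemma word_finite : finite_set [set: word_sort].
Proof.
rewrite (_ : [set: word_sort] =
  (fun u : word_sort => sval u) @^-1` [set` w])%classic.
  by apply: finite_preimage (finite_seq w) => u v _ _; exact: word_val_inj.
by apply/seteqP; split=> // u _; exact: (svalP u).
Qed.

(* Intended for words of distinct numbers. *)
Definition word : permutation.
Proof.
refine (@Permutation word_sort (fun u v => (sval u < sval v)%N)
  (fun u v => (index (sval u) w < index (sval v) w)%N) word_finite
  _ _ _ _ _ _).
- by move=> u; exact: ltnn.
- by move=> u v t; exact: ltn_trans.
- by move=> u v uv; rewrite -neq_ltn; apply/eqP => /word_val_inj.
- by move=> u; exact: ltnn.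
- by move=> u v t; exact: ltn_trans.
- move=> u v uv; rewrite -neq_ltn; apply/eqP => h; apply/uv/word_val_inj.
  by rewrite /= -(nth_index 0%N (svalP u)) h (nth_index 0%N (svalP v)).
Defined.

End Word.

Lemma dotted_mem (u v : seq nat) (x : nat) : x \in u ++ x :: v.
Proof. by rewrite mem_cat inE eqxx orbT. Qed.

(* The word [u x v] with a dot over [x]. *)
Definition dotted (u : seq nat) (x : nat) (v : seq nat) : marked :=
  @Marked (word (u ++ x :: v)) (exist _ x (dotted_mem u v x)).

Definition ten_marked : seq marked :=
  [:: dotted [::] 1 [::];
      dotted [::] 1 [:: 2%N];
      dotted [:: 1%N] 2 [::];
      dotted [:: 2%N] 1 [::];
      dotted [::] 2 [:: 1%N];
      dotted [:: 1%N; 3%N] 2 [::];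
      dotted [:: 1%N] 3 [:: 2%N];
      dotted [::] 2 [:: 3%N; 1%N];
      dotted [:: 2%N] 3 [:: 1%N];
      dotted [:: 2%N; 1%N] 3 [:: 5%N; 4%N]].

Definition value_table : seq (seq int) :=
  [::
    [:: 0; 0; 0; -1; 0; -1; 0; 0; 0; 0];
    [:: 0; 0; 0; 0; -1; -1; 0; 0; 0; 0];
    [:: 0; 0; 0; -1; 0; 0; -1; 0; 0; 0];
    [:: 0; 0; 0; 0; -1; 0; -1; 0; 0; 0];
    [:: 0; -1; 0; 0; 0; 0; 0; -1; 0; 0];
    [:: 0; 0; -1; 0; 0; 0; 0; -1; 0; 0];
    [:: 0; -1; 0; 0; 0; 0; 0; 0; -1; 0];
    [:: 0; 0; -1; 0; 0; 0; 0; 0; -1; 0];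
    [:: 0; -1; 0; 0; 0; 0; 0; 0; 0; -1];
    [:: 0; 0; -1; 0; 0; 0; 0; 0; 0; -1];
    [:: 0; 0; 0; -1; 0; 0; 0; 0; 0; -1];
    [:: 0; 0; 0; 0; -1; 0; 0; 0; 0; -1];
    [:: 0; 0; 0; -1; 0; -1; -1; 0; 0; 1];
    [:: 0; 0; 0; 0; -1; -1; -1; 0; 0; 1];
    [:: 0; -1; 0; 0; 0; 0; 0; -1; -1; 1];
    [:: 0; 0; -1; 0; 0; 0; 0; -1; -1; 1];
    [:: 0; 1; 0; -1; -1; -1; -1; 0; 0; 1];
    [:: 0; 0; 1; -1; -1; -1; -1; 0; 0; 1];
    [:: 0; -1; -1; 1; 0; 0; 0; -1; -1; 1];
    [:: 0; -1; -1; 0; 1; 0; 0; -1; -1; 1];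
    [:: 1; 0; 0; 0; 0; -1; 0; 0; 0; 0];
    [:: 1; 0; 0; 0; 0; 0; -1; 0; 0; 0];
    [:: 1; 0; 0; 0; 0; 0; 0; -1; 0; 0];
    [:: 1; 0; 0; 0; 0; 0; 0; 0; -1; 0];
    [:: 1; 0; 0; 0; 0; 0; 0; 0; 0; -1];
    [:: 1; 0; 0; 0; 0; -1; -1; 0; 0; 1];
    [:: 1; 0; 0; 0; 0; 0; 0; -1; -1; 1];
    [:: -1; -1; -1; 0; 0; 0; 0; -1; 0; 0];
    [:: -1; -1; -1; 0; 0; 0; 0; 0; -1; 0];
    [:: -1; -1; -1; 0; 0; 0; 0; 0; 0; -1];
    [:: -1; -1; -1; 0; 0; 0; 0; -1; -1; 1];
    [:: -1; 0; 0; -1; -1; -1; 0; 0; 0; 0];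
    [:: -1; 0; 0; -1; -1; 0; -1; 0; 0; 0];
    [:: -1; 0; 0; -1; -1; 0; 0; 0; 0; -1];
    [:: -1; 0; 0; -1; -1; -1; -1; 0; 0; 1];
    [:: 1; 1; 1; -1; -1; -1; -1; 0; 0; 1];
    [:: 1; -1; -1; 1; 1; 0; 0; -1; -1; 1]].

Definition values (a : 'I_37) : seq int := nth [::] value_table a.

(* Main.v *)
(* A measure is determined by its values F x s on the inclusions of s into
   s + {x}, where s is a finite set of points of the plane in general position.
   In terms of F the axioms say that F x s depends only on the relative position
   of the points, that F x s * F y (s + {x}) is symmetric in x and y, and that
   F x s is the sum of the values F p (s + {z}) over the positions p of x relative
   to a further point z. The last relation forces F x s to depend only on the
   points bounding the cell of x, and the linear equations between the finitely
   many resulting values express all of them through eight of them and 1. The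
   universal combination is a sum of contributions of the four corners of the
   cell and satisfies the splitting relations identically; the symmetry becomes a
   system of quadratic equations in eight unknowns, which is checked at the 37
   rows of the table. In the ring Theta, some of these equations have the form
   T (T + 1) = 0 or T (T - 1) = 0 after substitution, and splitting along them
   writes 1 as a sum of elements c_a on which every class acts as multiplication
   by its value under mu_a; these elements identify Theta with Z^37. *)
From HB Require Import structures.
From Pilot Require Import Defs.
From mathcomp Require Import all_boot all_order all_algebra.
From mathcomp Require Import boolp classical_sets functions cardinality.
From mathcomp Require Import finmap monalg zify.

Set Implicit Arguments.
Unset Strict Implicit.
Unset Printing Implicit Defensive.

Import GRing.Theory.

Local Open Scope ring_scope.

(** Every embedding is composed of isomorphisms and one-point extensions, and amalgamations compose.
    So axiom (c) only has to be checked for two one-point extensions, where an amalgamation is a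
    relative position of two points. The splitting relations concern one cell with at most four
    bounding points and one further point, and can be enumerated. The swap relations concern two
    cells with up to six bounding points in all. To keep their enumeration small, configurations are
    replaced by images under non-strictly monotone maps that merge points which neither cell
    distinguishes. Of the ten tabulated values, those on .1 and 1.32 are integral combinations of
    the other eight and 1. Unknowns are eliminated only where their coefficient is 1 or -1, so the
    argument works over every commutative ring; this matters in [Theta], where no integer is known
    in advance to be cancellable. The elements c_a are treated as simultaneous eigenvectors instead
    of idempotents: the rows are distinct and Z is a domain, which makes mu_b vanish on c_a for b
    different from a. *)

HB.instance Definition _ (X : permutation) := gen_eqMixin (Defs.perm_sort X).
HB.instance Definition _ (X : permutation) := gen_choiceMixin (Defs.perm_sort X).

(** * Permutations as sets of points *)

Lemma emb_eq (Y X : permutation) (i j : embedding Y X) : i =1 j -> i = j.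
Proof.
case: i j => [f fi fl fp] [g gi gl gp] /= fg.
have e : f = g by apply/funext.
case: g / e gi gl gp {fg} => gi gl gp.
by congr Embedding; apply: Prop_irrelevance.
Qed.

Section OrderPreservingMaps.
Variables (Y X : permutation) (f : Y -> X).
Hypothesis flt : {homo f : x y / plt x y}.
Hypothesis fprec : {homo f : x y / pprec x y}.

Lemma homo_inj : injective f.
Proof.
move=> x y fxy; apply: contrapT => /plt_total/orP[] /flt; rewrite fxy;
  by rewrite plt_irr.
Qed.

Definition emb_of_homo : embedding Y X := Embedding homo_inj flt fprec.

End OrderPreservingMaps.

Lemma emb_plt (Y X : permutation) (i : embedding Y X) (x y : Y) :
  plt (i x) (i y) = plt x y.
Proof.
apply/idP/idP => [h|/emb_lt//]; apply: contraPT h => nxy.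
have [->|/plt_total/orP[xy|yx]] := EM (x = y); first by rewrite plt_irr.
  by rewrite xy in nxy.
move=> /plt_trans/(_ (emb_lt i yx)); by rewrite plt_irr.
Qed.

Lemma emb_pprec (Y X : permutation) (i : embedding Y X) (x y : Y) :
  pprec (i x) (i y) = pprec x y.
Proof.
apply/idP/idP => [h|/emb_prec//]; apply: contraPT h => nxy.
have [->|/pprec_total/orP[xy|yx]] := EM (x = y); first by rewrite pprec_irr.
  by rewrite xy in nxy.
move=> /pprec_trans/(_ (emb_prec i yx)); by rewrite pprec_irr.
Qed.

Lemma emb_iso_surj (Y X : permutation) (i : embedding Y X) :
  emb_iso i <-> forall x, exists y, i y = x.
Proof.
split=> [[j [_ ji]] x|/choice[g gK]]; first by exists (j x).
have glt : {homo g : x y / plt x y} by move=> x y; rewrite -(emb_plt i) !gK.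
have gpr : {homo g : x y / pprec x y} by move=> x y; rewrite -(emb_pprec i) !gK.
exists (emb_of_homo glt gpr); split=> x //=; apply: (@emb_inj _ _ i).
by rewrite gK.
Qed.

Lemma finite_enum (X : permutation) : exists s : seq X, forall x, x \in s.
Proof.
have /finite_seqP[s Xs] := perm_finite X.
exists s => x; have : [set: X]%classic x by [].
by rewrite Xs.
Qed.

Definition enum_perm (X : permutation) : seq X := sval (cid (finite_enum X)).

Lemma mem_enum_perm (X : permutation) (x : X) : x \in enum_perm X.
Proof. exact: (svalP (cid (finite_enum X)) x). Qed.

Notation pt := (nat * nat)%type.

Definition gen (s : seq pt) : Prop :=
  {in s &, injective fst} /\ {in s &, injective snd}.

Lemma gen_sub (s t : seq pt) : {subset s <= t} -> gen t -> gen s.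
Proof. by move=> st [g1 g2]; split=> x y /st xt /st yt; [exact: g1|exact: g2]. Qed.

(** Ties are broken by the other coordinate so that every list of points carries a permutation; in
    general position no tie occurs. *)
Definition ltx (p q : pt) : bool :=
  (p.1 < q.1)%N || (p.1 == q.1) && (p.2 < q.2)%N.
Definition lty (p q : pt) : bool :=
  (p.2 < q.2)%N || (p.2 == q.2) && (p.1 < q.1)%N.

Lemma ltx_gen (s : seq pt) (p q : pt) :
  gen s -> p \in s -> q \in s -> ltx p q = (p.1 < q.1)%N.
Proof.
move=> [g _] ps qs; rewrite /ltx; case: eqP => [/(g _ _ ps qs) ->|_];
  by rewrite ?ltnn ?orbF.
Qed.

Lemma lty_gen (s : seq pt) (p q : pt) :
  gen s -> p \in s -> q \in s -> lty p q = (p.2 < q.2)%N.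
Proof.
move=> [_ g] ps qs; rewrite /lty; case: eqP => [/(g _ _ ps qs) ->|_];
  by rewrite ?ltnn ?orbF.
Qed.

Section PointPermutation.
Variable s : seq pt.

Definition pp_sort : Set := {p : pt | p \in s}.

Lemma pp_val_inj : injective (fun u : pp_sort => sval u).
Proof. by move=> [u hu] [v hv] /= uv; apply: eq_exist. Qed.

Lemma pp_finite : finite_set [set: pp_sort].
Proof.
rewrite (_ : [set: pp_sort] =
  (fun u : pp_sort => sval u) @^-1` [set` s])%classic.
  by apply: finite_preimage (finite_seq s) => u v _ _; exact: pp_val_inj.
by apply/seteqP; split=> // u _; exact: (svalP u).
Qed.

Definition pp : permutation.
Proof.
refine (@Permutation pp_sort (fun u v => ltx (sval u) (sval v))
  (fun u v => lty (sval u) (sval v)) pp_finite _ _ _ _ _ _).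
- by move=> u; rewrite /ltx !ltnn andbF.
- by move=> [[b b'] ?] [[a a'] ?] [[c c'] ?]; rewrite /ltx /=; lia.
- move=> [[a a'] ?] [[b b'] ?] ab; have : (a, a') != (b, b').
    by apply/eqP => e; apply/ab/pp_val_inj.
  by rewrite xpair_eqE /ltx /=; lia.
- by move=> u; rewrite /lty !ltnn andbF.
- by move=> [[b b'] ?] [[a a'] ?] [[c c'] ?]; rewrite /lty /=; lia.
- move=> [[a a'] ?] [[b b'] ?] ab; have : (a, a') != (b, b').
    by apply/eqP => e; apply/ab/pp_val_inj.
  by rewrite xpair_eqE /lty /=; lia.
Defined.

End PointPermutation.

Definition ppt (s : seq pt) (p : pt) (h : p \in s) : pp s := exist _ p h.

Definition incl (s t : seq pt) (st : {subset s <= t}) : embedding (pp s) (pp t) :=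
  @emb_of_homo (pp s) (pp t) (fun u => ppt (st _ (svalP u)))
    (fun _ _ h => h) (fun _ _ h => h).

Record coordinates (X : permutation) := Coordinates {
  coord :> X -> pt;
  coord_lt : forall x y, ((coord x).1 < (coord y).1)%N = plt x y;
  coord_prec : forall x y, ((coord x).2 < (coord y).2)%N = pprec x y }.

Lemma coord_inj1 X (f : coordinates X) x y : (f x).1 = (f y).1 -> x = y.
Proof.
move=> e; apply: contrapT => /plt_total; by rewrite -!(coord_lt f) e ltnn.
Qed.

Lemma coord_inj2 X (f : coordinates X) x y : (f x).2 = (f y).2 -> x = y.
Proof.
move=> e; apply: contrapT => /pprec_total; by rewrite -!(coord_prec f) e ltnn.
Qed.

Lemma coord_gen X (f : coordinates X) (s : seq X) : gen (map f s).
Proof.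
split=> _ _ /mapP[x _ ->] /mapP[y _ ->] => [/coord_inj1|/coord_inj2] -> //.
Qed.

(** Positivity makes [(c z).-1] a genuine position below [c z]. *)
Definition even_pt (p : pt) : bool :=
  [&& ~~ odd p.1, ~~ odd p.2, (0 < p.1)%N & (0 < p.2)%N].

(** The coordinates are the ranks for the two orders, sent by n to 2 n + 2. *)
Lemma coord_exists (X : permutation) :
  exists f : coordinates X, forall x, even_pt (f x).
Proof.
have strict (T : eqType) (r : rel T) (e : seq T) : transitive r -> irreflexive r ->
    (forall x y, x <> y -> r x y || r y x) -> (forall x, x \in e) ->
    forall x y, (count (r^~ x) e < count (r^~ y) e)%N = r x y.
  move=> rT rI rE eT.
  have lt x y : r x y -> (count (r^~ x) e < count (r^~ y) e)%N.
    move=> xy; have := count_predUI (r^~ x) [pred z | r z y & ~~ r z x] e.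
    rewrite (@eq_count _ _ (r^~ y)); last first.
      move=> z /=; case zx: (r z x) => /=; first by rewrite (rT _ _ _ zx xy).
      by rewrite andbT.
    rewrite [X in (_ + X)%N](@eq_count _ _ pred0) => [|z]; last first.
      by rewrite /= andbCA andbN andbF.
    rewrite count_pred0 addn0 => ->; rewrite -addn1 leq_add2l -has_count.
    by apply/hasP; exists x => //=; rewrite xy rI.
  move=> x y; apply/idP/idP => [h|/lt//]; apply: contraTT h => nxy.
  rewrite -leqNgt; have [->//|/rE/orP[|/lt/ltnW//]] := EM (x = y).
  by rewrite (negbTE nxy).
pose cx (x : X) := count (fun z => plt z x) (enum_perm X).
pose cy (x : X) := count (fun z => pprec z x) (enum_perm X).
have hx x y : ((cx x).*2.+2 < (cx y).*2.+2)%N = plt x y.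
  rewrite !ltnS ltn_double; apply: strict;
    [exact: plt_trans|exact: plt_irr|exact: plt_total|exact: mem_enum_perm].
have hy x y : ((cy x).*2.+2 < (cy y).*2.+2)%N = pprec x y.
  rewrite !ltnS ltn_double; apply: strict;
    [exact: pprec_trans|exact: pprec_irr|exact: pprec_total|exact: mem_enum_perm].
exists (@Coordinates X (fun x => ((cx x).*2.+2, (cy x).*2.+2)) hx hy) => x.
by rewrite /even_pt /= !negbK !odd_double.
Qed.

Lemma sub_cons (x : pt) (s : seq pt) : {subset s <= x :: s}.
Proof. exact: mem_behead (x :: s). Qed.

Definition incl1 (x : pt) (s : seq pt) : embedding (pp s) (pp (x :: s)) :=
  incl (@sub_cons x s).

Lemma lt_pair (m n : nat) :
  (m < n)%N -> (((m < n)%N = true) * ((n < m)%N = false))%type.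
Proof. by move=> h; split=> //; apply/negbTE; rewrite -leqNgt ltnW. Qed.

(** * Amalgamations of two one-point extensions *)

Section Candidates.

Definition separated (c : pt -> nat) (s : seq pt) (x z : pt) : bool :=
  has (fun p => (c x < c p < c z) || (c z < c p < c x))%N s.

(** A point of [s] between [x] and [z] forces their order in every amalgamation. Otherwise all three
    outcomes are open, and the odd numbers next to the even [c z] realise two of them without
    passing a point of [s]. *)
Definition slots (c : pt -> nat) (s : seq pt) (x z : pt) : seq nat :=
  if separated c s x z then [:: c x] else [:: (c z).-1; c z; (c z).+1].

(* The possible positions, relative to [z :: s], of a point lying in the same
   cell as [x] relative to [s]; the point [z] itself is one of them when [z]
   lies in that cell. *)
Definition cand (s : seq pt) (x z : pt) : seq pt :=
  [seq p <- [seq (a, b) | a <- slots fst s x z, b <- slots snd s x z]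
     | (p.1 == z.1) == (p.2 == z.2)].

(** If [x] and [z] are not separated, each point of [s] lies on the same side of both, and by parity
    also on the same side of the two numbers next to [c z]. *)
Lemma slots_side (c : pt -> nat) (s : seq pt) (x z p : pt) (a : nat) :
  {in x :: z :: s &, injective c} -> all (fun q => ~~ odd (c q)) (z :: s) ->
  x \notin z :: s -> z \notin s -> a \in slots c s x z -> p \in s ->
  ((a < c p)%N = (c x < c p)%N) * ((c p < a)%N = (c p < c x)%N).
Proof.
move=> inj /= /andP[oz /allP os] xzs zs aS ps.
have xp : c x <> c p.
  move=> /inj e; move: xzs; rewrite e ?inE ?eqxx ?ps ?orbT //.
have zp : c z <> c p.
  move=> /inj e; move: zs; rewrite e ?inE ?eqxx ?ps ?orbT //.
move: aS; rewrite /slots; case: ifPn => [_|/hasPn/(_ p ps)].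
  by rewrite inE => /eqP ->.
have := os p ps; rewrite !inE /= => op n aS; split; move: op n aS; lia.
Qed.

Lemma slots_uniq c s x z : (0 < c z)%N -> uniq (slots c s x z).
Proof. by rewrite /slots; case: ifP => //= _; rewrite !inE /=; lia. Qed.

Lemma slots_eq c s x z a b : a \in slots c s x z -> b \in slots c s x z ->
  (a < c z)%N = (b < c z)%N -> (c z < a)%N = (c z < b)%N -> a = b.
Proof.
rewrite /slots; case: ifP => _; first by rewrite !inE => /eqP -> /eqP ->.
by rewrite !inE /=; lia.
Qed.

Lemma mem_cand s x z p : (p \in cand s x z) =
  [&& p.1 \in slots fst s x z, p.2 \in slots snd s x z &
     (p.1 == z.1) == (p.2 == z.2)].
Proof.
rewrite mem_filter andbC andbA; congr andb.
by case: p => a b /=; apply/allpairsP/andP => [[[u v] [? ? [-> ->]]]|[? ?]] //;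
  exists (a, b).
Qed.

Variables (s : seq pt) (x z : pt).
Hypothesis gxzs : gen (x :: z :: s).
Hypothesis evs : all even_pt (z :: s).
Hypothesis xzs : x \notin z :: s.
Hypothesis zs : z \notin s.

Let ev1 : all (fun q : pt => ~~ odd q.1) (z :: s).
Proof. by apply: sub_all evs => q /and4P[]. Qed.

Let ev2 : all (fun q : pt => ~~ odd q.2) (z :: s).
Proof. by apply: sub_all evs => q /and4P[]. Qed.

Lemma cand_side (p q : pt) : p \in cand s x z -> q \in s ->
  [/\ (p.1 < q.1)%N = (x.1 < q.1)%N, (q.1 < p.1)%N = (q.1 < x.1)%N,
      (p.2 < q.2)%N = (x.2 < q.2)%N & (q.2 < p.2)%N = (q.2 < x.2)%N].
Proof.
rewrite mem_cand => /and3P[p1 p2 _] qs.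
have h1 := slots_side (proj1 gxzs) ev1 xzs zs p1 qs.
have h2 := slots_side (proj2 gxzs) ev2 xzs zs p2 qs.
by rewrite !h1 !h2.
Qed.

Lemma cand_gen (p : pt) : p \in cand s x z -> gen (p :: z :: s).
Proof.
move=> pc.
have [g1 g2] : gen (z :: s) by apply: gen_sub gxzs => q; rewrite !inE => ->; rewrite orbT.
have n (q : pt) : q \in s -> p.1 <> q.1 /\ p.2 <> q.2.
  move=> qs; have [h1 h2 h3 h4] := cand_side pc qs.
  have xq : x <> q by move=> e; case/negP: xzs; rewrite e inE qs orbT.
  have qi : q \in x :: z :: s by rewrite !inE qs !orbT.
  have xi : x \in x :: z :: s by rewrite inE eqxx.
  split=> e; apply: xq.
    apply: (proj1 gxzs _ _ xi qi); move: h1 h2; rewrite e ltnn.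
    by case: (ltngtP x.1 q.1).
  apply: (proj2 gxzs _ _ xi qi); move: h3 h4; rewrite e ltnn.
  by case: (ltngtP x.2 q.2).
have pz1 : p.1 = z.1 -> p = z.
  move=> e; move: pc; rewrite mem_cand => /and3P[_ _].
  by rewrite e eqxx eq_sym eqb_id => /eqP; case: (p) (z) e => ? ? [? ?] /= -> ->.
have pz2 : p.2 = z.2 -> p = z.
  move=> e; move: pc; rewrite mem_cand => /and3P[_ _].
  by rewrite e eqxx eqb_id => /eqP; case: (p) (z) e => ? ? [? ?] /= -> ->.
split=> u v; rewrite [u \in p :: _]in_cons [v \in p :: _]in_cons
    => /orP[/eqP->|ui] /orP[/eqP->|vi] //.
- by move: vi; rewrite inE => /orP[/eqP->|/n[]//] /pz1.
- by move: ui; rewrite inE => /orP[/eqP->|/n[h _] /esym//] /esym/pz1.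
- by move=> e; apply: g1.
- by move: vi; rewrite inE => /orP[/eqP->|/n[]//] /pz2.
- by move: ui; rewrite inE => /orP[/eqP->|/n[_ h] /esym//] /esym/pz2.
- by move=> e; apply: g2.
Qed.

Let i := incl1 x s.
Let j := incl1 z s.

Section CandAmalgamation.
Variables (x' : pt) (x'c : x' \in cand s x z).

Let g (p : pt) : pt := if p \in s then p else x'.

Let g_mem (u : pp (x :: s)) : g (sval u) \in x' :: z :: s.
Proof. by rewrite /g; case: ifP => us; rewrite !inE ?eqxx // us !orbT. Qed.

Let g_map (p q : pt) : p \in x :: s -> q \in x :: s ->
  (ltx p q -> ltx (g p) (g q)) /\ (lty p q -> lty (g p) (g q)).
Proof.
move=> pi qi.
have gen1 : gen (x :: s).
  by apply: gen_sub gxzs => r; rewrite !inE => /orP[->//|->]; rewrite !orbT.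
have gm r : r \in x :: s -> g r \in x' :: z :: s.
  by move=> ri; apply: (g_mem (ppt ri)).
have gc := cand_gen x'c; have [gp gq] := (gm _ pi, gm _ qi).
rewrite (ltx_gen gen1 pi qi) (lty_gen gen1 pi qi).
rewrite (ltx_gen gc gp gq) (lty_gen gc gp gq).
have xs : x \notin s by apply: contra xzs => h; rewrite inE h orbT.
rewrite /g; move: pi qi; rewrite !inE => /orP[/eqP->|ps] /orP[/eqP->|qs];
  rewrite ?(negbTE xs) ?ps ?qs ?ltnn //.
  by have [-> _ -> _] := cand_side x'c qs.
by have [_ -> _ ->] := cand_side x'c ps.
Qed.

Definition cand_emb : embedding (pp (x :: s)) (pp (x' :: z :: s)) :=
  @emb_of_homo (pp (x :: s)) (pp (x' :: z :: s)) (fun u => ppt (g_mem u))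
    (fun u v => (g_map (svalP u) (svalP v)).1)
    (fun u v => (g_map (svalP u) (svalP v)).2).

Definition cand_amalg : amalgamation i j.
Proof.
refine (@Amalgamation _ _ _ i j (pp (x' :: z :: s))
  (incl1 x' (z :: s)) cand_emb _ _).
- by move=> [p ps]; apply: pp_val_inj; rewrite /= /g ps.
- move=> [p pi]; case: (boolP (p \in z :: s)) => ps.
    by left; exists (ppt ps); apply: pp_val_inj.
  right; exists (ppt (mem_head x s)); apply: pp_val_inj; rewrite /= /g.
  have /negbTE -> : x \notin s by apply: contra xzs => h; rewrite inE h orbT.
  by move: (pi); rewrite in_cons (negbTE ps) orbF => /eqP.
Defined.

End CandAmalgamation.

(** An amalgamation is determined by the comparisons of the images of [x] and [z] in the two orders;
    the slots with the same comparisons give the candidate. *)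
Lemma cand_amalg_iso (B : amalgamation i j) :
  exists x' (x'c : x' \in cand s x z), amalg_iso B (cand_amalg x'c).
Proof.
have xi : x \in x :: s by rewrite inE eqxx.
have zi : z \in z :: s by rewrite inE eqxx.
pose bx := amalg_j B (ppt xi); pose bz := amalg_i B (ppt zi).
have mx p : p \in s -> p \in x :: s by move=> ps; rewrite inE ps orbT.
have mz p : p \in s -> p \in z :: s by move=> ps; rewrite inE ps orbT.
have com p (ps : p \in s) : amalg_i B (ppt (mz p ps)) = amalg_j B (ppt (mx p ps)).
  have := amalg_comm B (ppt ps); rewrite (_ : j _ = ppt (mz p ps)).
    by move=> ->; congr (amalg_j B _); apply: pp_val_inj.
  by apply: pp_val_inj.
have gx : gen (x :: s).
  by apply: gen_sub gxzs => r; rewrite !inE => /orP[->//|->]; rewrite !orbT.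
have gz : gen (z :: s).
  by apply: gen_sub gxzs => r; rewrite !inE => ->; rewrite !orbT.
have pick (c : pt -> nat) (r : rel B) : transitive r -> irreflexive r ->
    (forall u v, u <> v -> r u v || r v u) ->
    (forall p (ps : p \in s), r bx (amalg_j B (ppt (mx p ps))) = (c x < c p)%N) ->
    (forall p (ps : p \in s), r (amalg_j B (ppt (mx p ps))) bx = (c p < c x)%N) ->
    (forall p (ps : p \in s), r bz (amalg_i B (ppt (mz p ps))) = (c z < c p)%N) ->
    (forall p (ps : p \in s), r (amalg_i B (ppt (mz p ps))) bz = (c p < c z)%N) ->
    (0 < c z)%N ->
    exists2 a, a \in slots c s x z &
      (((a < c z)%N = r bx bz) * ((c z < a)%N = r bz bx))%type.
  move=> rT rI rE x1 x2 z1 z2 z0.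
  have asym u v : r u v -> r v u = false.
    by move=> uv; apply/negP => /(rT _ _ _ uv); rewrite rI.
  rewrite /slots; case: ifP => [/hasP[p ps /orP sep]|_].
    (* The image of the separating point forces the comparison in [B] by transitivity. *)
    exists (c x); rewrite ?inE ?eqxx //.
    case: sep => /andP[].
      rewrite -(x1 _ ps) -(z2 _ ps) com => h1 h2; have h := rT _ _ _ h1 h2.
      rewrite h (asym _ _ h); apply: lt_pair.
      by move: h1 h2; rewrite x1 -com z2; apply: ltn_trans.
    rewrite -(z1 _ ps) -(x2 _ ps) com => h1 h2; have h := rT _ _ _ h1 h2.
    rewrite h (asym _ _ h).
    have /lt_pair[-> ->] // : (c z < c x)%N.
    by move: h1 h2; rewrite x2 -com z1; apply: ltn_trans.
  have [->|/rE/orP[h|h]] := EM (bx = bz).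
  - by exists (c z); rewrite ?inE ?eqxx ?orbT // rI ltnn.
  - exists (c z).-1; first by rewrite ?inE ?eqxx.
    by rewrite h (asym _ _ h); apply: lt_pair; rewrite prednK.
  - exists (c z).+1; first by rewrite ?inE ?eqxx ?orbT.
    have /lt_pair[-> ->] : (c z < (c z).+1)%N by [].
    by rewrite h (asym _ _ h).
have /and4P[_ _ z10 z20] : even_pt z by case/andP: evs.
have [a aS [a1 a2]] : exists2 a, a \in slots fst s x z &
    (((a < z.1)%N = plt bx bz) * ((z.1 < a)%N = plt bz bx))%type.
  apply: (pick fst (@plt B) (@plt_trans B) (@plt_irr B) (@plt_total B)) => // p ps;
    rewrite /bx /bz emb_plt.
  - exact: (ltx_gen gx xi (mx p ps)).
  - exact: (ltx_gen gx (mx p ps) xi).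
  - exact: (ltx_gen gz zi (mz p ps)).
  - exact: (ltx_gen gz (mz p ps) zi).
have [b bS [b1 b2]] : exists2 b, b \in slots snd s x z &
    (((b < z.2)%N = pprec bx bz) * ((z.2 < b)%N = pprec bz bx))%type.
  apply: (pick snd (@pprec B) (@pprec_trans B) (@pprec_irr B) (@pprec_total B)) => // p ps;
    rewrite /bx /bz emb_pprec.
  - exact: (lty_gen gx xi (mx p ps)).
  - exact: (lty_gen gx (mx p ps) xi).
  - exact: (lty_gen gz zi (mz p ps)).
  - exact: (lty_gen gz (mz p ps) zi).
have xc : (a, b) \in cand s x z.
  have eqE m n : (m == n) = ~~ (m < n)%N && ~~ (n < m)%N by case: ltngtP.
  rewrite mem_cand aS bS [_ == z.1]eqE [_ == z.2]eqE [(a, b).1]/= [(a, b).2]/=.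
  rewrite a1 a2 b1 b2.
  have [->|ne] := EM (bx = bz); first by rewrite plt_irr pprec_irr.
  by have /orP[->|->] := plt_total ne; have /orP[->|->] := pprec_total ne;
    rewrite ?andbF.
exists (a, b), xc.
pose C := cand_amalg xc.
(* Points of [z :: s] go where [B] puts them, and a point left over goes to the image of [x]. If the
   candidate is [z] itself, nothing is left over, and [bx = bz] makes the map compatible with
   [amalg_j]. *)
pose h (u : C) : B := match pselect (sval u \in z :: s) with
  | left t => amalg_i B (ppt t) | right _ => bx end.
have hi y : h (amalg_i C y) = amalg_i B y.
  rewrite /h; case: pselect => [t|[]]; last exact: (svalP y).
  by congr (amalg_i B _); apply: pp_val_inj.
have hx' (ux : (a, b) \notin z :: s) (ui : (a, b) \in (a, b) :: z :: s) :
    h (ppt ui) = bx.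
  by rewrite /h; case: pselect => //= t; rewrite t in ux.
have xs : x \notin s by apply: contra xzs => t; rewrite inE t orbT.
have hj y : h (amalg_j C y) = amalg_j B y.
  case: y => p pi; have [ps|ps] := boolP (p \in s).
    have -> : exist _ p pi = ppt (mx p ps) by apply: pp_val_inj.
    by rewrite -com -hi; congr h; apply: pp_val_inj; rewrite /= ps.
  have px : p = x by move: (pi); rewrite inE (negbTE ps) orbF => /eqP.
  have -> : exist _ p pi = ppt xi by apply: pp_val_inj.
  have [xz|xz] := boolP ((a, b) \in z :: s).
    have xz' : (a, b) = z.
      move: xz; rewrite inE => /orP[/eqP//|xz]; exfalso.
      have [] := cand_side xc xz; rewrite !ltnn => /esym n1 /esym n2 _ _.
      have e : x = (a, b).
        apply: (proj1 gxzs); rewrite ?inE ?xz ?eqxx ?orbT //.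
        by move: n1 n2; case: ltngtP.
      by rewrite e xz in xs.
    have bxz : bx = bz.
      apply: contrapT => /plt_total; rewrite -a1 -a2 /= -xz' /=.
      by rewrite ltnn.
    rewrite -[RHS]/bx bxz /bz -hi; congr h; apply: pp_val_inj.
    by rewrite /= (negbTE xs).
  have -> : amalg_j C (ppt xi) = ppt (mem_head (a, b) (z :: s)).
    by apply: pp_val_inj; rewrite /= (negbTE xs).
  by rewrite hx'.
have gC := cand_gen xc.
have jz (y : pp (z :: s)) : y = ppt zi \/
    exists y', amalg_i C y = amalg_j C y' /\ amalg_i B y = amalg_j B y'.
  case: y => p pi; have [ps|ps] := boolP (p \in s); [right|left].
    exists (ppt (mx p ps)); have -> : exist _ p pi = ppt (mz p ps) by apply: pp_val_inj.
    by rewrite com; split=> //; apply: pp_val_inj; rewrite /= ps.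
  by apply: pp_val_inj => /=; move: (pi); rewrite inE (negbTE ps) orbF => /eqP.
have jx (y : pp (x :: s)) : y = ppt xi \/
    exists y', amalg_j C y = amalg_i C y' /\ amalg_j B y = amalg_i B y'.
  case: y => p pi; have [ps|ps] := boolP (p \in s); [right|left].
    exists (ppt (mz p ps)); have -> : exist _ p pi = ppt (mx p ps) by apply: pp_val_inj.
    by rewrite com; split=> //; apply: pp_val_inj; rewrite /= ps.
  by apply: pp_val_inj => /=; move: (pi); rewrite inE (negbTE ps) orbF => /eqP.
have vx : sval (amalg_j C (ppt xi)) = (a, b) by rewrite /= (negbTE xs).
have gm (u : C) : sval u \in (a, b) :: z :: s := svalP u.
have hlt : {homo h : u v / plt u v}.
  move=> u v.
  have [[yu <-]|[yu <-]] := amalg_surj u; have [[yv <-]|[yv <-]] := amalg_surj v;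
    rewrite ?hi ?hj ?emb_plt //.
  - have [->|[y [-> ->]]] := jz yu; last by rewrite !emb_plt.
    have [->|[y [-> ->]]] := jx yv; last by rewrite !emb_plt.
    by rewrite -[plt (amalg_i B _) _]a2 [plt _ _](ltx_gen gC (gm _) (gm _)) vx.
  - have [->|[y [-> ->]]] := jz yv; last by rewrite !emb_plt.
    have [->|[y [-> ->]]] := jx yu; last by rewrite !emb_plt.
    by rewrite -[plt (amalg_j B _) _]a1 [plt _ _](ltx_gen gC (gm _) (gm _)) vx.
have hprec : {homo h : u v / pprec u v}.
  move=> u v.
  have [[yu <-]|[yu <-]] := amalg_surj u; have [[yv <-]|[yv <-]] := amalg_surj v;
    rewrite ?hi ?hj ?emb_pprec //.
  - have [->|[y [-> ->]]] := jz yu; last by rewrite !emb_pprec.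
    have [->|[y [-> ->]]] := jx yv; last by rewrite !emb_pprec.
    by rewrite -[pprec (amalg_i B _) _]b2 [pprec _ _](lty_gen gC (gm _) (gm _)) vx.
  - have [->|[y [-> ->]]] := jz yv; last by rewrite !emb_pprec.
    have [->|[y [-> ->]]] := jx yu; last by rewrite !emb_pprec.
    by rewrite -[pprec (amalg_j B _) _]b1 [pprec _ _](lty_gen gC (gm _) (gm _)) vx.
have [f [fK Kf]] : emb_iso (emb_of_homo hlt hprec).
  apply/emb_iso_surj => w.
  have [[y <-]|[y <-]] := amalg_surj w.
    by exists (amalg_i C y); apply: hi.
  by exists (amalg_j C y); apply: hj.
exists f; split; first by exists (emb_of_homo hlt hprec).
  by move=> y; rewrite -hi; apply: fK.
by move=> y; rewrite -hj; apply: fK.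
Qed.

(** No candidate is listed twice up to isomorphism: an isomorphism of amalgamations preserves the
    comparisons between the images of [x] and [z], and these determine the slots. *)
Lemma cand_all_amalgamations :
  exists A : 'I_(size (cand s x z)) -> amalgamation i j,
    all_amalgamations A /\
    forall a : 'I_(size (cand s x z)), exists x'c : nth z (cand s x z) a \in cand s x z,
      A a = cand_amalg x'c.
Proof.
exists (fun a => cand_amalg (mem_nth z (ltn_ord a))); split; last first.
  by move=> a; exists (mem_nth z (ltn_ord a)).
have /and4P[_ _ z10 z20] : even_pt z by case/andP: evs.
have uc : uniq (cand s x z).
  apply/filter_uniq/allpairs_uniq => [||[? ?] [? ?] _ _ //];
    exact: slots_uniq.
have inj p q (pc : p \in cand s x z) (qc : q \in cand s x z) B :
    amalg_iso B (cand_amalg pc) -> amalg_iso B (cand_amalg qc) -> p = q.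
  have side r (rc : r \in cand s x z) : amalg_iso B (cand_amalg rc) ->
      let bx := amalg_j B (ppt (mem_head x s)) in
      let bz := amalg_i B (ppt (mem_head z s)) in
      [/\ plt bx bz = (r.1 < z.1)%N, plt bz bx = (z.1 < r.1)%N,
         pprec bx bz = (r.2 < z.2)%N & pprec bz bx = (z.2 < r.2)%N].
    move=> [f [_ fi fj]] bx bz.
    have xs : x \notin s by apply: contra xzs => t; rewrite inE t orbT.
    have ez : sval (f bz) = z by rewrite fi.
    have ex : sval (f bx) = r by rewrite fj /= (negbTE xs).
    have gC := cand_gen rc.
    have gm (u : pp (r :: z :: s)) : sval u \in r :: z :: s := svalP u.
    rewrite -!(emb_plt f) -!(emb_pprec f).
    split; rewrite ?[plt _ _](ltx_gen gC (gm _) (gm _)) ?[pprec _ _](lty_gen gC (gm _) (gm _));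
    by rewrite ?ex ?ez.
  move=> /side[p1 p2 p3 p4] /side[q1 q2 q3 q4].
  move: (pc) (qc); rewrite !mem_cand => /and3P[u1 u2 _] /and3P[v1 v2 _].
  have e1 : p.1 = q.1 by apply: (slots_eq u1 v1); rewrite -?p1 -?q1 -?p2 -?q2.
  have e2 : p.2 = q.2 by apply: (slots_eq u2 v2); rewrite -?p3 -?q3 -?p4 -?q4.
  by case: (p) (q) e1 e2 => ? ? [? ?] /= -> ->.
move=> B; have [p [pc pB]] := cand_amalg_iso B.
have pi : (index p (cand s x z) < size (cand s x z))%N by rewrite index_mem.
exists (Ordinal pi); split=> [|a aB].
  have tr q (qc : q \in cand s x z) : q = p -> amalg_iso B (cand_amalg qc).
    by move=> e; subst q; rewrite (bool_irrelevance qc pc).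
  by apply: tr; rewrite /= nth_index.
by apply: val_inj; rewrite /= (inj _ _ _ _ _ pB aB) index_uniq.
Qed.

End Candidates.

(** * Measures and one-point extensions *)

Definition increasing_on (s : seq pt) (phi : pt -> pt) : Prop :=
  forall p q, p \in s -> q \in s ->
    (((phi p).1 < (phi q).1)%N = (p.1 < q.1)%N) *
    (((phi p).2 < (phi q).2)%N = (p.2 < q.2)%N).

(** [cell_mem] extends the function to points already present, so that points may be added
    repeatedly. [cell_split] asks for even coordinates because [cand] uses odd ones; doubling,
    permitted by [cell_map], always achieves this. *)
Record cell_function (k : comPzRingType) (F : pt -> seq pt -> k) : Prop := CellFunction {
  cell_mem : forall x s, x \in s -> F x s = 1;
  cell_set : forall x s s', gen (x :: s) -> s =i s' -> F x s = F x s';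
  cell_map : forall x s phi, gen (x :: s) -> increasing_on (x :: s) phi ->
    F (phi x) (map phi s) = F x s;
  cell_swap : forall x y s, gen (x :: y :: s) ->
    F x s * F y (x :: s) = F y s * F x (y :: s);
  cell_split : forall x z s, gen (x :: z :: s) -> all even_pt (z :: s) ->
    x \notin z :: s -> z \notin s ->
    F x s = \sum_(p <- cand s x z) F p (z :: s) }.

Lemma pp_map (s t : seq pt) (phi : pt -> pt) : gen s -> increasing_on s phi ->
  t =i map phi s ->
  exists u : embedding (pp s) (pp t), emb_iso u /\ forall y, sval (u y) = phi (sval y).
Proof.
move=> gs inc ts.
have m (y : pp s) : phi (sval y) \in t by rewrite ts map_f // (svalP y).
pose h (y : pp s) : pp t := ppt (m y).
have hlt : {homo h : y z / plt y z}.
  move=> [p ps] [q qs]; rewrite [plt _ _](ltx_gen gs ps qs) => pq.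
  by rewrite /= /ltx (inc _ _ ps qs) pq.
have hprec : {homo h : y z / pprec y z}.
  move=> [p ps] [q qs]; rewrite [pprec _ _](lty_gen gs ps qs) => pq.
  by rewrite /= /lty (inc _ _ ps qs) pq.
exists (emb_of_homo hlt hprec); split=> //.
apply/emb_iso_surj => -[q qt].
have /mapP[p ps qp] : q \in map phi s by rewrite -ts.
by exists (ppt ps); apply: pp_val_inj; rewrite /= qp.
Qed.

(** For a cell function, points already present contribute 1, so [t] may repeat points and contain
    those of [s]. *)
Fixpoint chain (k : comPzRingType) (F : pt -> seq pt -> k) (s t : seq pt) : k :=
  if t is x :: t' then F x s * chain F (x :: s) t' else 1.

Section CellOfMeasure.
Variables (k : comPzRingType).
Variable nu : forall Y X : permutation, embedding Y X -> k.
Hypothesis mnu : is_measure nu.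

Lemma measure_iso (Y X : permutation) (i : embedding Y X) : emb_iso i -> nu i = 1.
Proof. by case: mnu => + _ _; apply. Qed.

Lemma measure_comp (Z Y X : permutation) (j : embedding Y X) (i : embedding Z Y) :
  nu (emb_comp j i) = nu j * nu i.
Proof. by case: mnu. Qed.

Lemma measure_square (Y X Y' X' : permutation) (i : embedding Y X)
    (i' : embedding Y' X') (u : embedding Y Y') (v : embedding X X') :
  emb_iso u -> emb_iso v -> (forall y, v (i y) = i' (u y)) -> nu i = nu i'.
Proof.
move=> ui vi c; have e : emb_comp v i = emb_comp i' u by apply: emb_eq.
have := congr1 (@nu _ _) e; rewrite !measure_comp (measure_iso ui) (measure_iso vi).
by rewrite mul1r mulr1.
Qed.

Definition cell_of (x : pt) (s : seq pt) : k := nu (incl1 x s).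

Lemma incl_map (s t s' t' : seq pt) (st : {subset s <= t}) (st' : {subset s' <= t'})
    (phi : pt -> pt) : gen t -> increasing_on t phi ->
  s' =i map phi s -> t' =i map phi t -> nu (incl st) = nu (incl st').
Proof.
move=> gt inc ss' tt'.
have incs : increasing_on s phi by move=> p q /st pt' /st qt; apply: inc.
have [u [ui uE]] := pp_map (gen_sub st gt) incs ss'.
have [v [vi vE]] := pp_map gt inc tt'.
by apply: (measure_square ui vi) => y; apply: pp_val_inj; rewrite vE /= uE.
Qed.

Lemma incl_eq (s t s' t' : seq pt) (st : {subset s <= t}) (st' : {subset s' <= t'}) :
  gen t -> s =i s' -> t =i t' -> nu (incl st) = nu (incl st').
Proof.
move=> gt ss' tt'; apply: (@incl_map _ _ _ _ _ _ id) => //.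
- by move=> p; rewrite map_id ss'.
- by move=> p; rewrite map_id tt'.
Qed.

Lemma incl_comp (s t u : seq pt) (st : {subset s <= t}) (tu : {subset t <= u})
    (su : {subset s <= u}) : nu (incl su) = nu (incl tu) * nu (incl st).
Proof.
by rewrite -measure_comp; congr nu; apply: emb_eq => y; apply: pp_val_inj.
Qed.

Lemma cell_ofP : cell_function cell_of.
Proof.
split.
- move=> x s xs; apply: measure_iso; apply/emb_iso_surj => -[p pi].
  have ps : p \in s by move: pi; rewrite inE => /orP[/eqP->|].
  by exists (ppt ps); apply: pp_val_inj.
- move=> x s s' g ss'; apply: incl_eq => // p; by rewrite !inE ss'.
- by move=> x s phi g inc; symmetry; apply: incl_map inc _ _.
- move=> x y s g.
  have su : {subset s <= x :: y :: s} by move=> p ps; rewrite !inE ps !orbT.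
  have su' : {subset s <= y :: x :: s} by move=> p ps; rewrite !inE ps !orbT.
  rewrite mulrC -(incl_comp _ _ su') [RHS]mulrC -(incl_comp _ _ su).
  symmetry; apply: incl_eq => // p; by rewrite !inE orbCA.
- move=> x z s g ev xzs zs.
  have [A [allA AE]] := cand_all_amalgamations g ev xzs zs.
  case: mnu => _ _ /(_ _ _ _ _ _ _ _ allA) h.
  rewrite /cell_of h (big_nth z) big_mkord; apply: eq_bigr => a _.
  by have [x'c ->] := AE a.
Qed.

Lemma incl_chain (s t u : seq pt) (su : {subset s <= u}) : gen u ->
  u =i s ++ t -> nu (incl su) = chain cell_of s t.
Proof.
elim: t s su => [|x t IH] s su g us /=.
  apply: measure_iso; apply/emb_iso_surj => -[p pu].
  have ps : p \in s by move: pu; rewrite us cats0.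
  by exists (ppt ps); apply: pp_val_inj.
have xsu : {subset x :: s <= u}.
  by move=> p; rewrite us !(inE, mem_cat) => /orP[->|->]; rewrite ?orbT.
rewrite (incl_comp (@sub_cons x s) xsu) mulrC; congr (_ * _); apply: IH => // p.
by rewrite us !(inE, mem_cat) orbCA orbA.
Qed.

Lemma coord_iso (X : permutation) (f : coordinates X) (e : seq X) (t : seq pt) :
  (forall x, x \in e) -> t =i map f e ->
  exists v : embedding X (pp t), emb_iso v /\ forall x, sval (v x) = f x.
Proof.
move=> eX te.
have m x : f x \in t by rewrite te map_f.
pose h x : pp t := ppt (m x).
have hlt : {homo h : y z / plt y z}.
  by move=> x y; rewrite -(coord_lt f) => xy; rewrite /= /ltx xy.
have hprec : {homo h : y z / pprec y z}.
  by move=> x y; rewrite -(coord_prec f) => xy; rewrite /= /lty xy.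
exists (emb_of_homo hlt hprec); split=> //.
apply/emb_iso_surj => -[q qt].
have /mapP[x _ qx] : q \in map f e by rewrite -te.
by exists x; apply: pp_val_inj.
Qed.

(** This is why one-point values determine a measure: the embedding is transported to an inclusion
    of point sets, which is filled in one point at a time. *)
Lemma measure_chain (Y X : permutation) (i : embedding Y X) (f : coordinates X)
    (s t : seq pt) :
  s =i map (f \o i) (enum_perm Y) -> t =i map f (enum_perm X) ->
  nu i = chain cell_of s t.
Proof.
move=> sE tE.
have fi_lt x y : ((f (i x)).1 < (f (i y)).1)%N = plt x y.
  by rewrite coord_lt emb_plt.
have fi_prec x y : ((f (i x)).2 < (f (i y)).2)%N = pprec x y.
  by rewrite coord_prec emb_pprec.
pose fi : coordinates Y := Coordinates fi_lt fi_prec.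
have st : {subset s <= t}.
  by move=> p; rewrite sE tE => /mapP[y _ ->]; apply/map_f/mem_enum_perm.
have [u [ui uE]] := @coord_iso Y fi _ _ (@mem_enum_perm Y) sE.
have [v [vi vE]] := @coord_iso X f _ _ (@mem_enum_perm X) tE.
rewrite -(@incl_chain _ _ t st).
- apply: (measure_square ui vi) => y; apply: pp_val_inj; by rewrite vE /= uE.
- by apply: gen_sub (coord_gen f (enum_perm X)) => p; rewrite tE.
- move=> p; rewrite mem_cat; apply/idP/orP => [->|[/st|]//]; by right.
Qed.

End CellOfMeasure.

(** * Isomorphism and composition of amalgamations *)

Section AmalgIso.
Variables (Y X Y' : permutation) (i : embedding Y X) (j : embedding Y Y').

Lemma amalg_isoP (A B : amalgamation i j) (f : A -> B) :
  {homo f : x y / plt x y} -> {homo f : x y / pprec x y} ->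
  (forall y, f (amalg_i A y) = amalg_i B y) ->
  (forall x, f (amalg_j A x) = amalg_j B x) -> amalg_iso A B.
Proof.
move=> fl fp fi fj; exists (emb_of_homo fl fp); split=> //.
apply/emb_iso_surj => z; have [[y <-]|[x <-]] := amalg_surj z.
  by exists (amalg_i A y); apply: fi.
by exists (amalg_j A x); apply: fj.
Qed.

Lemma amalg_iso_sym (A B : amalgamation i j) : amalg_iso A B -> amalg_iso B A.
Proof.
move=> [f [[g [fK gK]] fi fj]]; exists g; split; first by exists f.
  by move=> y; rewrite -fi fK.
by move=> x; rewrite -fj fK.
Qed.

Lemma amalg_iso_trans (B A C : amalgamation i j) :
  amalg_iso A B -> amalg_iso B C -> amalg_iso A C.
Proof.
move=> [f [_ fi fj]] [g [_ gi gj]].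
apply: (@amalg_isoP A C (emb_comp g f)); [exact: emb_lt|exact: emb_prec|..] => z /=.
  by rewrite fi gi.
by rewrite fj gj.
Qed.

End AmalgIso.

(** The condition of [all_amalgamations] with an arbitrary index type, since amalgamations over a
    composite are indexed by dependent pairs. *)
Definition complete (Y X Y' : permutation) (i : embedding Y X) (j : embedding Y Y')
    (I : Type) (A : I -> amalgamation i j) : Prop :=
  forall B : amalgamation i j, exists! a : I, amalg_iso B (A a).

Lemma complete_inj (Y X Y' : permutation) (i : embedding Y X) (j : embedding Y Y')
    (I : Type) (A : I -> amalgamation i j) (a b : I) :
  complete A -> amalg_iso (A a) (A b) -> a = b.
Proof.
move=> cA ab; have [c [_ uc]] := cA (A b).
by rewrite -(uc a (amalg_iso_sym ab)) -(uc b) //;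
  exists (emb_of_homo (f := id) (fun _ _ h => h) (fun _ _ h => h)); split=> //;
  apply/emb_iso_surj => x; exists x.
Qed.

Definition amalg_swap (Y X Y' : permutation) (i : embedding Y X) (j : embedding Y Y')
    (A : amalgamation i j) : amalgamation j i :=
  @Amalgamation _ _ _ j i A (amalg_j A) (amalg_i A)
    (fun y => esym (amalg_comm A y))
    (fun z => match amalg_surj z with or_introl h => or_intror h
              | or_intror h => or_introl h end).

Lemma complete_swap (Y X Y' : permutation) (i : embedding Y X) (j : embedding Y Y')
    (I : Type) (A : I -> amalgamation i j) :
  complete A -> complete (fun a => amalg_swap (A a)).
Proof.
move=> cA B; have [a [[f [fe fi fj]] ua]] := cA (amalg_swap B).
exists a; split; first by exists f; split.
by move=> b [g [ge gi gj]]; apply: ua; exists g; split.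
Qed.

Section SubPermutation.
Variables (D : permutation) (P : D -> Prop).

Definition sub_sort : Set := {z : D | P z}.

Lemma sub_val_inj : injective (fun u : sub_sort => sval u).
Proof. by move=> [u hu] [v hv] /= uv; apply: eq_exist. Qed.

Lemma sub_finite : finite_set [set: sub_sort].
Proof.
rewrite -(preimage_setT (fun u : sub_sort => sval u)).
by apply: finite_preimage (perm_finite D) => u v _ _; exact: sub_val_inj.
Qed.

Definition sub_perm : permutation.
Proof.
refine (@Permutation sub_sort (fun u v => plt (sval u) (sval v))
  (fun u v => pprec (sval u) (sval v)) sub_finite _ _ _ _ _ _).
- by move=> u; exact: plt_irr.
- by move=> u v w; exact: plt_trans.
- by move=> u v uv; apply: plt_total => /sub_val_inj.
- by move=> u; exact: pprec_irr.
- by move=> u v w; exact: pprec_trans.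
- by move=> u v uv; apply: pprec_total => /sub_val_inj.
Defined.

Definition sub_incl : embedding sub_perm D :=
  @emb_of_homo sub_perm D (fun u => sval u) (fun _ _ h => h) (fun _ _ h => h).

Definition sub_lift (X : permutation) (f : embedding X D) (fP : forall x, P (f x)) :
  embedding X sub_perm :=
  @emb_of_homo X sub_perm (fun x => exist _ (f x) (fP x))
    (fun x y h => @emb_lt _ _ f x y h) (fun x y h => @emb_prec _ _ f x y h).

End SubPermutation.

Section AmalgComposition.
Variables (Y X1 X2 Y' : permutation).
Variables (i1 : embedding Y X1) (i2 : embedding X1 X2) (j : embedding Y Y').

Definition amalg_comp (A : amalgamation i1 j) (B : amalgamation i2 (amalg_j A)) :
  amalgamation (emb_comp i2 i1) j.
Proof.
refine (@Amalgamation _ _ _ _ _ B (emb_comp (amalg_i B) (amalg_i A)) (amalg_j B) _ _).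
- by move=> y; rewrite /= amalg_comm amalg_comm.
- move=> z; have [[w <-]|[x <-]] := amalg_surj z; last by right; exists x.
  have [[y <-]|[x <-]] := amalg_surj w; first by left; exists y.
  by right; exists (i2 x); rewrite -amalg_comm.
Defined.

Variables (I : Type) (A : I -> amalgamation i1 j) (J : I -> Type).
Variable B : forall a, J a -> amalgamation i2 (amalg_j (A a)).
Hypotheses (cA : complete A) (cB : forall a, complete (@B a)).

Let C (c : {a : I & J a}) : amalgamation (emb_comp i2 i1) j :=
  amalg_comp (B (projT2 c)).

(** In [D] the images of [Y'] and [X1] form an amalgamation of [i1] and [j], and over it [D] is an
    amalgamation with [X2]. *)
Let C_ex (D : amalgamation (emb_comp i2 i1) j) : exists c, amalg_iso D (C c).
Proof.
pose P (z : D) := (exists y, amalg_i D y = z) \/ exists x, amalg_j D (i2 x) = z.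
have Pi y : P (amalg_i D y) by left; exists y.
have Pj x : P (emb_comp (amalg_j D) i2 x) by right; exists x.
have cD1 y : sub_lift Pi (j y) = sub_lift Pj (i1 y).
  by apply: sub_val_inj; rewrite /= (amalg_comm D y).
have sD1 (z : sub_perm P) :
    (exists y, sub_lift Pi y = z) \/ (exists x, sub_lift Pj x = z).
  by case: z => z [[y yz]|[x xz]]; [left; exists y|right; exists x]; apply: sub_val_inj.
pose D1 : amalgamation i1 j := Amalgamation cD1 sD1.
have [a [[f [[g [fK gK]] fi fj]] _]] := cA D1.
pose h := emb_comp (sub_incl P) g.
have hi y : h (amalg_i (A a) y) = amalg_i D y by rewrite /= -fi fK.
have hj x : h (amalg_j (A a) x) = amalg_j D (i2 x) by rewrite /= -fj fK.
have sD2 (z : D) : (exists w, h w = z) \/ (exists x, amalg_j D x = z).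
  have [[y <-]|[x <-]] := amalg_surj z; last by right; exists x.
  by left; exists (amalg_i (A a) y).
pose D2 : amalgamation i2 (amalg_j (A a)) := Amalgamation hj sD2.
have [b [[u [ui uh uj]] _]] := cB D2.
exists (existT _ a b), u; split=> // y.
by rewrite -hi [LHS]uh.
Qed.

Let C_inj (c c' : {a : I & J a}) : amalg_iso (C c) (C c') -> c = c'.
Proof.
case: c c' => [a b] [a' b'] [f [_ fi fj]].
(* [f] restricts to the inner amalgamations, which are covered by the images of [Y'] and [X1], and
   [f] respects these. *)
have ex (w : A a) : exists w' : A a', amalg_i (B b') w' = f (amalg_i (B b) w).
  have [[y <-]|[x <-]] := amalg_surj w.
    by exists (amalg_i (A a') y); rewrite -[LHS]fi.
  by exists (amalg_j (A a') x); rewrite [in RHS]amalg_comm [LHS]amalg_comm -[LHS]fj.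
have [g gE] := choice ex.
have gi y : g (amalg_i (A a) y) = amalg_i (A a') y.
  by apply: (@emb_inj _ _ (amalg_i (B b'))); rewrite gE; apply: fi.
have gj x : g (amalg_j (A a) x) = amalg_j (A a') x.
  apply: (@emb_inj _ _ (amalg_i (B b'))); rewrite gE.
  by rewrite [in LHS]amalg_comm [RHS]amalg_comm; apply: fj.
have aa' : amalg_iso (A a) (A a').
  apply: (amalg_isoP (f := g)) => // u v uv.
    by rewrite -(emb_plt (amalg_i (B b'))) !gE !emb_plt.
  by rewrite -(emb_pprec (amalg_i (B b'))) !gE !emb_pprec.
have e := complete_inj cA aa'; move: e b' f fi fj ex g gE gi gj aa' => <- b' f fi fj _ g gE gi gj _.
congr existT; apply: (complete_inj (@cB a)).
apply: (@amalg_isoP _ _ _ i2 (amalg_j (A a)) (B b) (B b') f);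
  [exact: emb_lt|exact: emb_prec| |exact: fj].
move=> w; rewrite -gE; congr (amalg_i _ _).
by have [[y <-]|[x <-]] := amalg_surj w.
Qed.

Lemma complete_comp : complete C.
Proof.
move=> D; have [c Dc] := C_ex D; exists c; split=> // c' Dc'.
exact/C_inj/(amalg_iso_trans (amalg_iso_sym Dc)).
Qed.

End AmalgComposition.

Lemma emb_isoV (Y X : permutation) (i : embedding Y X) : emb_iso i ->
  exists j : embedding X Y, [/\ emb_iso j, cancel i j & cancel j i].
Proof. by move=> [j [ij ji]]; exists j; split=> //; exists i. Qed.

(* Even positive coordinates leave room for further points in every cell. *)
Lemma emb_ind (P : forall Y X : permutation, embedding Y X -> Prop) :
  (forall Y X (i : embedding Y X), emb_iso i -> P Y X i) ->
  (forall Z Y X (j : embedding Y X) (i : embedding Z Y),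
     P Y X j -> P Z Y i -> P Z X (emb_comp j i)) ->
  (forall x s, gen (x :: s) -> all even_pt (x :: s) -> x \notin s ->
     P _ _ (incl1 x s)) ->
  forall Y X (i : embedding Y X), P Y X i.
Proof.
move=> Piso Pcomp Pone.
have Pincl e : forall s u (su : {subset s <= u}), gen u -> all even_pt u ->
    u =i s ++ e -> P _ _ (incl su).
  elim: e => [|x e IH] s u su gu eu us.
    apply/Piso/emb_iso_surj => -[p pu].
    have ps : p \in s by move: (pu); rewrite us cats0.
    by exists (ppt ps); apply: pp_val_inj.
  have [xs|xs] := boolP (x \in s).
    apply: IH => // p; rewrite us !mem_cat inE orbCA; case: eqP => //= ->.
    by rewrite xs.
  have xsu : {subset x :: s <= u}.
    by move=> p; rewrite us !(inE, mem_cat) => /orP[->|->]; rewrite ?orbT.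
  have -> : incl su = emb_comp (incl xsu) (incl1 x s).
    by apply: emb_eq => p; apply: pp_val_inj.
  apply: Pcomp; first by apply: IH => // p; rewrite us !(inE, mem_cat) orbCA orbA.
  apply: Pone => //; first exact: gen_sub gu.
  by apply/allP => p /xsu; apply: (allP eu).
move=> Y X i; have [f fe] := coord_exists X.
have fi_lt x y : ((f (i x)).1 < (f (i y)).1)%N = plt x y.
  by rewrite coord_lt emb_plt.
have fi_prec x y : ((f (i x)).2 < (f (i y)).2)%N = pprec x y.
  by rewrite coord_prec emb_pprec.
pose fi : coordinates Y := Coordinates fi_lt fi_prec.
pose s := map fi (enum_perm Y); pose t := map f (enum_perm X).
have st : {subset s <= t} by move=> p /mapP[y _ ->]; apply/map_f/mem_enum_perm.
have [u [ui uE]] := @coord_iso Y fi _ s (@mem_enum_perm Y) (fun=> erefl).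
have [v [vi vE]] := @coord_iso X f _ t (@mem_enum_perm X) (fun=> erefl).
have [v' [v'i vK v'K]] := emb_isoV vi.
have -> : i = emb_comp v' (emb_comp (incl st) u).
  apply: emb_eq => y; rewrite /= -[LHS]vK; congr (v' _); apply: pp_val_inj.
  by rewrite vE /= uE.
apply: (Pcomp); first exact: Piso.
apply: Pcomp; last exact: Piso.
apply: (Pincl t); first exact: coord_gen.
  by apply/allP => _ /mapP[x _ ->].
by move=> p; rewrite mem_cat; apply/idP/orP => [->|[/st|]//]; right.
Qed.

(** * Reduction of axiom (c) to one-point extensions *)

Section Splitting.
Variables (k : comPzRingType).
Variable mu : forall Y X : permutation, embedding Y X -> k.
Hypothesis mu_iso : forall (Y X : permutation) (i : embedding Y X),
  emb_iso i -> mu i = 1.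
Hypothesis mu_comp : forall (Z Y X : permutation) (j : embedding Y X)
  (i : embedding Z Y), mu (emb_comp j i) = mu j * mu i.

(** One complete family is enough, by [splits_complete]; the existential form lets finiteness of the
    set of amalgamations be proved in the same induction. *)
Definition splits (Y X Y' : permutation) (i : embedding Y X) (j : embedding Y Y') : Prop :=
  exists (I : finType) (A : I -> amalgamation i j),
    complete A /\ mu i = \sum_a mu (amalg_i (A a)).

Lemma splits_complete (Y X Y' : permutation) (i : embedding Y X)
    (j : embedding Y Y') (J : finType) (B : J -> amalgamation i j) :
  splits i j -> complete B -> mu i = \sum_b mu (amalg_i (B b)).
Proof.
move=> [I [A [cA ->]]] cB.
have hex a : exists b, amalg_iso (A a) (B b) by have [b [? _]] := cB (A a); exists b.
have gex b : exists a, amalg_iso (B b) (A a) by have [a [? _]] := cA (B b); exists a.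
have [h hP] := choice hex; have [g gP] := choice gex.
rewrite [RHS](reindex h); last first.
  exists g => a _.
    apply: (complete_inj cA); apply: amalg_iso_sym.
    exact: amalg_iso_trans (hP a) (gP _).
  apply: (complete_inj cB); apply: amalg_iso_sym.
  exact: amalg_iso_trans (gP a) (hP _).
apply: eq_bigr => a _; have [f [fe fi _]] := hP a.
have -> : amalg_i (B (h a)) = emb_comp f (amalg_i (A a)).
  by apply: emb_eq => y; rewrite /= fi.
by rewrite mu_comp (mu_iso fe) mul1r.
Qed.

(** Amalgamations of the composite are amalgamations with [i1] followed by amalgamations with [i2];
    multiplicativity factors the double sum. *)
Lemma splits_comp_i (Y X1 X2 Y' : permutation) (i1 : embedding Y X1)
    (i2 : embedding X1 X2) (j : embedding Y Y') :
  splits i1 j -> (forall A : amalgamation i1 j, splits i2 (amalg_j A)) ->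
  splits (emb_comp i2 i1) j.
Proof.
move=> [I [A [cA e1]]] h2.
pose J a := sval (cid (h2 (A a))).
pose B a : J a -> _ := sval (cid (proj2_sig (cid (h2 (A a))))).
have BP a := proj2_sig (cid (proj2_sig (cid (h2 (A a))))).
exists {a : I & J a}, (fun c => amalg_comp (B _ (tagged c))); split.
  by apply: complete_comp => // a; have [] := BP a.
rewrite mu_comp e1 mulr_sumr.
rewrite -(@sig_big_dep _ _ _ _ _ xpredT (fun _ => xpredT)
  (fun a b => mu (amalg_i (amalg_comp (B a b))))) /=.
apply: eq_bigr => a _; rewrite (proj2 (BP a)) mulr_suml.
by apply: eq_bigr => b _; rewrite mu_comp.
Qed.

Lemma splits_comp_j (Y X Y1 Y2 : permutation) (i : embedding Y X)
    (j1 : embedding Y Y1) (j2 : embedding Y1 Y2) :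
  splits i j1 -> (forall A : amalgamation i j1, splits (amalg_i A) j2) ->
  splits i (emb_comp j2 j1).
Proof.
move=> [I [A [cA e1]]] h2.
pose J a := sval (cid (h2 (A a))).
pose B a : J a -> _ := sval (cid (proj2_sig (cid (h2 (A a))))).
have BP a := proj2_sig (cid (proj2_sig (cid (h2 (A a))))).
pose C (c : {a : I & J a}) := amalg_swap
  (@amalg_comp _ _ _ _ j1 j2 i (amalg_swap (A (tag c))) (amalg_swap (B _ (tagged c)))).
exists {a : I & J a}, C; split.
  apply: complete_swap; apply: (@complete_comp _ _ _ _ j1 j2 i I (fun a => amalg_swap (A a))
    J (fun a b => amalg_swap (B a b))); first exact: complete_swap.
  by move=> a; apply: complete_swap; have [] := BP a.
rewrite e1 -(@sig_big_dep _ _ _ _ _ xpredT (fun _ => xpredT)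
  (fun a b => mu (amalg_i (B a b)))) /=.
by apply: eq_bigr => a _; rewrite (proj2 (BP a)).
Qed.

(** The only amalgamation is [Y'] itself, and both values are 1. *)
Lemma splits_iso_i (Y X Y' : permutation) (i : embedding Y X) (j : embedding Y Y') :
  emb_iso i -> splits i j.
Proof.
move=> ii; have [i' [ii' iK Ki]] := emb_isoV ii.
have c y : emb_of_homo (f := @id Y') (fun _ _ h => h) (fun _ _ h => h) (j y) =
    emb_comp j i' (i y) by rewrite /= iK.
pose A : amalgamation i j := @Amalgamation _ _ _ i j Y' _ _ c
  (fun z => or_introl (ex_intro _ z erefl)).
exists unit, (fun=> A); split=> [B|].
  exists tt; split=> [|[] //]; apply/amalg_iso_sym.
  apply: (@amalg_isoP _ _ _ i j A B (amalg_i B)); [exact: emb_lt|exact: emb_prec| |] => // x.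
  by rewrite /= amalg_comm Ki.
rewrite big_const card_unit /= addr0 mu_iso // mu_iso //.
by apply/emb_iso_surj => x; exists x.
Qed.

Lemma splits_iso_j (Y X Y' : permutation) (i : embedding Y X) (j : embedding Y Y') :
  emb_iso j -> splits i j.
Proof.
move=> jj; have [j' [jj' jK Kj]] := emb_isoV jj.
have c y : emb_comp i j' (j y) =
    emb_of_homo (f := @id X) (fun _ _ h => h) (fun _ _ h => h) (i y) by rewrite /= jK.
pose A : amalgamation i j := @Amalgamation _ _ _ i j X _ _ c
  (fun z => or_intror (ex_intro _ z erefl)).
exists unit, (fun=> A); split=> [B|].
  exists tt; split=> [|[] //]; apply/amalg_iso_sym.
  apply: (@amalg_isoP _ _ _ i j A B (amalg_j B)); [exact: emb_lt|exact: emb_prec| |] => // x.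
  by rewrite /= -amalg_comm Kj.
by rewrite big_const card_unit /= addr0 mu_comp [X in _ * X]mu_iso ?mulr1.
Qed.

Hypothesis split_one : forall x z s, gen (x :: z :: s) -> all even_pt (z :: s) ->
  x \notin z :: s -> z \notin s -> splits (incl1 x s) (incl1 z s).

(** The image misses at most one point. Unlike one-point extensions, these embeddings are stable
    under amalgamation, where the new point may fall on an existing one. *)
Definition small (Y X : permutation) (i : embedding Y X) : Prop :=
  forall x y : X, (forall u, i u <> x) -> (forall u, i u <> y) -> x = y.

Lemma small_amalg (Y X Y' : permutation) (i : embedding Y X) (j : embedding Y Y')
    (A : amalgamation i j) : small i -> small (amalg_i A).
Proof.
move=> si u v nu nv.
have [[y /nu]|[x xu]] := amalg_surj u; first by [].
have [[y /nv]|[x' xv]] := amalg_surj v; first by [].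
rewrite -xu -xv; congr (amalg_j A _); apply: si => w wx.
  by apply: (nu (j w)); rewrite amalg_comm wx.
by apply: (nv (j w)); rewrite amalg_comm wx.
Qed.

(** The missing point is placed at odd coordinates. These differ from the even coordinates of
    [z :: s], so it is in general position with respect to [z] too. *)
Lemma small_coord (s : seq pt) (z : pt) (X : permutation) (i : embedding (pp s) X) :
  gen (z :: s) -> all even_pt (z :: s) -> small i -> ~ emb_iso i ->
  exists x (v : embedding (pp (x :: s)) X),
    [/\ gen (x :: z :: s), x \notin z :: s, emb_iso v & i = emb_comp v (incl1 x s)].
Proof.
move=> g ev si nii.
have [x0 nx0] : exists x0, forall u, i u <> x0.
  apply: contrapT => h; apply: nii; apply/emb_iso_surj => x0.
  by apply: contrapT => nx; apply: h; exists x0 => u ux; apply: nx; exists u.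
have evs p : p \in s -> even_pt p.
  by move=> ps; apply: (allP ev); rewrite inE ps orbT.
have pick (c : pt -> nat) (r : rel X) : transitive r ->
    (forall u v, u <> v -> r u v || r v u) -> irreflexive r ->
    (forall p, even_pt p -> ~~ odd (c p) && (1 < c p)%N) ->
    (forall p q (ps : p \in s) (qs : q \in s),
      r (i (ppt ps)) (i (ppt qs)) = (c p < c q)%N) ->
    exists a, odd a /\ forall p (ps : p \in s),
      ((r x0 (i (ppt ps)) = (a < c p)%N) * (r (i (ppt ps)) x0 = (c p < a)%N))%type.
  move=> rT rE rI cev rc.
  pose below p := `[< exists ps : p \in s, r (i (ppt ps)) x0 >].
  (* The new coordinate is one more than the largest one below the missing point. If there is none,
     the maximum is 0, and 1 still precedes all coordinates, which are at least 2. *)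
  pose m := \max_(p <- s | below p) c p.
  have odd_m : ~~ odd m.
    rewrite /m big_seq_cond; elim/big_ind: _ => //.
      by move=> u v; rewrite /maxn; case: ifP.
    by move=> p /andP[/evs/cev/andP[]].
  exists m.+1; split=> [|p ps]; first by rewrite /= odd_m.
  have [rp|nrp] := boolP (r (i (ppt ps)) x0).
    have -> : r x0 (i (ppt ps)) = false.
      by apply/negP => /(rT _ _ _ rp); rewrite rI.
    have le : (c p <= m)%N.
      by apply: (@leq_bigmax_seq _ s below c p) => //; apply/asboolP; exists ps.
    by rewrite !ltnS le ltnNge (leqW le).
  have := rE _ _ (nx0 (ppt ps)); rewrite (negbTE nrp) /= => rp; rewrite rp.
  have lt : (m.+1 < c p)%N.
    have /andP[ocp c1] := cev _ (evs _ ps).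
    rewrite -[(m.+1 < _)%N]/(m.+2 <= _)%N ltn_neqAle; apply/andP; split.
      by apply/eqP => e; rewrite -e /= odd_m in ocp.
    rewrite /m big_seq_cond; elim/big_ind: _ => //; first exact: ltnW.
      by move=> u v; rewrite /maxn; case: ifP.
    by move=> q /andP[qs /asboolP[qs' rq]]; rewrite -(rc _ _ qs' ps) (rT _ _ _ rq rp).
  by rewrite lt ltnNge (ltnW lt).
have gs : gen s by apply: gen_sub g; apply: sub_cons.
have [a [oa aE]] : exists a, odd a /\ forall p (ps : p \in s),
    ((plt x0 (i (ppt ps)) = (a < p.1)%N) * (plt (i (ppt ps)) x0 = (p.1 < a)%N))%type.
  apply: (pick fst (@plt X) (@plt_trans X) (@plt_total X) (@plt_irr X)).
    by move=> [[|[|u]] v] /and4P[] //= *; apply/andP.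
  by move=> p q ps qs; rewrite emb_plt; apply: (ltx_gen gs ps qs).
have [b [ob bE]] : exists b, odd b /\ forall p (ps : p \in s),
    ((pprec x0 (i (ppt ps)) = (b < p.2)%N) * (pprec (i (ppt ps)) x0 = (p.2 < b)%N))%type.
  apply: (pick snd (@pprec X) (@pprec_trans X) (@pprec_total X) (@pprec_irr X)).
    by move=> [v [|[|u]]] /and4P[] //= *; apply/andP.
  by move=> p q ps qs; rewrite emb_pprec; apply: (lty_gen gs ps qs).
have xzs : (a, b) \notin z :: s.
  by apply/negP => /(allP ev)/and4P[]; rewrite /= oa.
have gx : gen ((a, b) :: z :: s).
  have na p : p \in z :: s -> a <> p.1.
    by move=> /(allP ev)/and4P[+ _ _ _] e; rewrite -e oa.
  have nb p : p \in z :: s -> b <> p.2.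
    by move=> /(allP ev)/and4P[_ + _ _] e; rewrite -e ob.
  split=> p q; rewrite [p \in _ :: _]in_cons [q \in _ :: _]in_cons
    => /orP[/eqP->|ps] /orP[/eqP->|qs] //=.
  - by move=> /(na _ qs).
  - by move=> /esym/(na _ ps).
  - exact: (proj1 g).
  - by move=> /(nb _ qs).
  - by move=> /esym/(nb _ ps).
  - exact: (proj2 g).
have gxs : gen ((a, b) :: s).
  by apply: gen_sub gx => p; rewrite !inE => /orP[->|->]; rewrite ?orbT.
pose h (u : pp ((a, b) :: s)) : X := match pselect (sval u \in s) with
  | left t => i (ppt t) | right _ => x0 end.
have hs (u : pp s) : h (incl1 (a, b) s u) = i u.
  rewrite /h; case: pselect => [t|[]]; last exact: (svalP u).
  by congr (i _); apply: pp_val_inj.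
have ab : (a, b) \notin s by apply: contra xzs => t; rewrite inE t orbT.
have hx : h (ppt (mem_head _ s)) = x0.
  by rewrite /h; case: pselect => // t; rewrite t in ab.
have split_u (u : pp ((a, b) :: s)) :
    (exists p (ps : p \in s), u = incl1 (a, b) s (ppt ps)) \/ u = ppt (mem_head _ s).
  case: u => p pi; have [e|ne] := eqVneq p (a, b); [right; exact: pp_val_inj|left].
  have ps : p \in s by have := pi; rewrite in_cons (negbTE ne).
  by exists p, ps; apply: pp_val_inj.
have hlt : {homo h : u v / plt u v}.
  move=> u v; rewrite [plt u v](ltx_gen gxs (svalP u) (svalP v)).
  case: (split_u u) => [[p [ps ->]]|->]; case: (split_u v) => [[q [qs ->]]|->];
    rewrite ?hs ?hx ?aE ?plt_irr ?ltnn //= emb_plt => pq.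
  by rewrite [plt _ _](ltx_gen gs ps qs).
have hprec : {homo h : u v / pprec u v}.
  move=> u v; rewrite [pprec u v](lty_gen gxs (svalP u) (svalP v)).
  case: (split_u u) => [[p [ps ->]]|->]; case: (split_u v) => [[q [qs ->]]|->];
    rewrite ?hs ?hx ?bE ?pprec_irr ?ltnn //= emb_pprec => pq.
  by rewrite [pprec _ _](lty_gen gs ps qs).
exists (a, b), (emb_of_homo hlt hprec); split=> //.
  apply/emb_iso_surj => w; have [[u <-]|nw] := EM (exists u, i u = w).
    by exists (incl1 (a, b) s u); apply: hs.
  exists (ppt (mem_head _ s)); rewrite /= hx; apply: si => // u uw.
  by apply: nw; exists u.
by apply: emb_eq => u; rewrite /= [RHS]hs.
Qed.

(** Induction on [j] applies because smallness survives amalgamation. For a one-point [j], a small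
    embedding is an isomorphism or, up to isomorphism, a one-point extension. *)
Lemma splits_small (Y Y' : permutation) (j : embedding Y Y') :
  forall X (i : embedding Y X), small i -> splits i j.
Proof.
elim/emb_ind: j => {Y Y'} [Y Y' j jj|Z Y X j i IHj IHi|z s g ev zs] X' i'.
- by move=> _; apply: splits_iso_j.
- move=> si; apply: splits_comp_j; first exact: IHi.
  by move=> A; apply/IHj/small_amalg.
- move=> si; have [ii|nii] := EM (emb_iso i'); first exact: splits_iso_i.
  have [x [v [gx xzs vi ->]]] := small_coord g ev si nii.
  apply: splits_comp_i => [|A]; last exact: splits_iso_i.
  exact: split_one.
Qed.

Lemma splits_all (Y X Y' : permutation) (i : embedding Y X) (j : embedding Y Y') :
  splits i j.
Proof.
elim/emb_ind: i Y' j => {Y X} [Y X i ii|Z Y X j i IHj IHi|x s g ev xs] Y' j'.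
- exact: splits_iso_i.
- by apply: splits_comp_i => // A; apply: IHj.
- apply: splits_small => -[p pi] [q qi] np nq; apply: pp_val_inj => /=.
  have aux r (ri : r \in x :: s) : (forall u, incl1 x s u <> ppt ri) -> r = x.
    move=> nr; move: (ri); rewrite inE => /orP[/eqP//|rs].
    by case: (nr (ppt rs)); apply: pp_val_inj.
  by rewrite (aux p pi np) (aux q qi nq).
Qed.

Lemma splits_measure : is_measure mu.
Proof.
split=> // Y X Y' i j n A cA; apply: splits_complete => //; exact: splits_all.
Qed.

End Splitting.

Lemma mem_cons_cat (x : pt) (s t : seq pt) : (x :: s) ++ t =i s ++ x :: t.
Proof. by move=> p; rewrite /= !(inE, mem_cat) orbCA. Qed.

Lemma gen_cons_cat (x : pt) (s t : seq pt) : gen (s ++ x :: t) -> gen ((x :: s) ++ t).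
Proof. by apply: gen_sub => p; rewrite mem_cons_cat. Qed.

(** * From a cell function to a measure *)

Section MeasureOfCell.
Variables (k : comPzRingType) (F : pt -> seq pt -> k).
Hypothesis cF : cell_function F.

(** By [cell_swap] the points may be added in any order: [front] brings a given point to the
    beginning, its later occurrence contributing 1. *)
Lemma chain_set (s s' t t' : seq pt) : gen (s ++ t) -> s =i s' ->
  s ++ t =i s' ++ t' -> chain F s t = chain F s' t'.
Proof.
have nil u v : {subset v <= u} -> chain F u v = 1.
  elim: v u => //= x v IH u vu; rewrite cell_mem ?vu ?mem_head // mul1r IH // => p pv.
  by rewrite inE vu ?orbT // inE pv orbT.
have same (v u u' : seq pt) : gen (u ++ v) -> u =i u' -> chain F u v = chain F u' v.
  elim: v u u' => //= x v IH u u' g uu'.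
  rewrite (cell_set cF _ uu'); last first.
    by apply: gen_sub g => p; rewrite mem_cat !inE => /orP[->|->]; rewrite ?orbT.
  congr (_ * _); apply: IH => [|p]; last by rewrite !inE uu'.
  exact: gen_cons_cat.
have front (v u : seq pt) x : gen (u ++ v) -> x \in v ->
    chain F u v = F x u * chain F (x :: u) v.
  elim: v u => //= y v IH u g; rewrite inE.
  have [exy _|xy /= xv] := eqVneq x y.
    subst y.
    rewrite (cell_mem cF (mem_head x u)) mul1r; congr (_ * _).
    apply: same => [|p]; last by rewrite !inE orbA orbb.
    exact: gen_cons_cat.
  have g' : gen (x :: y :: u ++ v).
    apply: gen_sub g => p; rewrite !(inE, mem_cat) => /or4P[/eqP->|->|->|->];
      by rewrite ?xv ?orbT.
  have g3 : gen (x :: y :: u).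
    by apply: gen_sub g' => p; rewrite !(inE, mem_cat) => /or3P[->|->|->]; rewrite ?orbT.
  rewrite IH //; last first.
    exact: gen_cons_cat.
  rewrite mulrA -(cell_swap cF g3) -mulrA; congr (_ * (_ * _)).
  by apply: same => // p; rewrite !inE orbCA.
elim: t s s' t' => [|x t IH] s s' t' g ss' tt' /=.
  by rewrite nil // => p pt'; rewrite -ss'; move: (tt' p); rewrite cats0 mem_cat pt' orbT.
have gxs : gen (x :: s).
  by apply: gen_sub g => p; rewrite mem_cat !inE => /orP[->|->]; rewrite ?orbT.
have g' : gen ((x :: s) ++ t).
  exact: gen_cons_cat.
have IH' : chain F (x :: s) t = chain F (x :: s') t'.
  apply: IH => // p; first by rewrite !inE ss'.
  rewrite mem_cons_cat tt' /= !(inE, mem_cat); case: eqP => //= ->.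
  by have := tt' x; rewrite !(inE, mem_cat) eqxx orbT => <-.
rewrite IH' (cell_set cF gxs ss').
have [xs|xs] := boolP (x \in s').
  rewrite cell_mem // mul1r; apply: same => [|p].
    apply: gen_sub g => p; rewrite tt' !(inE, mem_cat) => /or3P[/eqP->|->|->];
      by rewrite ?xs ?orbT.
  by rewrite inE; case: eqP => // ->.
rewrite -front //; first by apply: gen_sub g => p; rewrite tt'.
by have := tt' x; rewrite !(inE, mem_cat) eqxx orbT (negbTE xs) /= => <-.
Qed.

(** The source of multiplicativity: the points of [u] are added first and count 1 when they recur in
    [t]. *)
Lemma chain_cat (s u t : seq pt) : gen (s ++ t) -> {subset u <= t} ->
  chain F s t = chain F s u * chain F (u ++ s) t.
Proof.
elim: u s => [|x u IH] s g ut /=; first by rewrite mul1r.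
have xt : x \in t by apply: ut; rewrite inE eqxx.
have gx : gen ((x :: s) ++ t).
  apply: gen_sub g => p; rewrite !(inE, mem_cat) => /or3P[/eqP->|->|->];
    by rewrite ?xt ?orbT.
rewrite -mulrA.
have -> : chain F (x :: u ++ s) t = chain F (u ++ x :: s) t.
  have e : x :: u ++ s =i u ++ x :: s.
    by move=> p; rewrite !(inE, mem_cat); case: (p == x); case: (p \in u).
  apply: chain_set => // [|p]; last by rewrite [LHS]mem_cat [RHS]mem_cat e.
  apply: gen_sub gx => p; rewrite !(inE, mem_cat).
  have := ut p; rewrite inE; case: (p == x) => //=.
  by case: (p \in u) => [-> //|_]; rewrite ?orbT.
rewrite -IH // => [|p pu]; last by apply: ut; rewrite inE pu orbT.
rewrite -(@chain_set s s (x :: t) t) // => [|p].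
  by apply: gen_sub gx => p; rewrite mem_cons_cat.
by rewrite -mem_cons_cat /= inE; case: eqP => // ->; rewrite mem_cat xt orbT.
Qed.

Lemma chain_map (s t : seq pt) (phi : pt -> pt) : gen (s ++ t) ->
  increasing_on (s ++ t) phi -> chain F (map phi s) (map phi t) = chain F s t.
Proof.
elim: t s => //= x t IH s g inc.
have sub : {subset x :: s <= s ++ x :: t}.
  by move=> p; rewrite mem_cat !inE => /orP[->|->]; rewrite ?orbT.
have perm : {subset (x :: s) ++ t <= s ++ x :: t}.
  by move=> p; rewrite mem_cons_cat.
congr (_ * _).
  apply: (cell_map cF); first exact: gen_sub g.
  by move=> p q /sub ps /sub qs; apply: inc.
apply: (IH (x :: s)); first exact: gen_sub g.
by move=> p q /perm ps /perm qs; apply: inc.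
Qed.

Definition std_coord (X : permutation) : coordinates X := sval (cid (coord_exists X)).

Definition mu_of (Y X : permutation) (i : embedding Y X) : k :=
  chain F (map (std_coord X \o i) (enum_perm Y)) (map (std_coord X) (enum_perm X)).

Lemma mu_of_chain (Y X : permutation) (i : embedding Y X) (f : coordinates X)
    (s t : seq pt) : s =i map (f \o i) (enum_perm Y) -> t =i map f (enum_perm X) ->
  mu_of i = chain F s t.
Proof.
move=> sE tE; pose c := std_coord X.
(* [phi] carries the standard coordinates to [f]; its value away from these points is immaterial. *)
pose phi (p : pt) : pt := if [seq x <- enum_perm X | c x == p] is x :: _ then f x else p.
have phiE x : phi (c x) = f x.
  have : x \in [seq y <- enum_perm X | c y == c x].
    by rewrite mem_filter eqxx mem_enum_perm.
  rewrite /phi; case E: [seq _ <- _ | _] => [//|y e] _.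
  have : y \in [seq y <- enum_perm X | c y == c x] by rewrite E mem_head.
  rewrite mem_filter => /andP[/eqP cyx _]; congr (f _).
  by apply: (coord_inj1 (f := c)); rewrite cyx.
rewrite /mu_of -/c; set s0 := map _ _; set t0 := map _ (enum_perm X).
have sub : {subset s0 ++ t0 <= t0}.
  by move=> p; rewrite mem_cat => /orP[/mapP[y _ ->]|//]; apply/map_f/mem_enum_perm.
have gc : gen (s0 ++ t0) := gen_sub sub (coord_gen c _).
rewrite -(@chain_map s0 t0 phi) //; last first.
  move=> p q /sub/mapP[x _ ->] /sub/mapP[y _ ->]; rewrite !phiE.
  by rewrite !coord_lt !coord_prec.
have es : map phi s0 =i s.
  by move=> p; rewrite sE -map_comp (eq_map (g := f \o i)) // => y /=; rewrite phiE.
have et : map phi t0 =i t.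
  by move=> p; rewrite tE -map_comp (eq_map (g := f)) // => y /=; rewrite phiE.
apply: chain_set => // [|p]; last by rewrite !mem_cat es et.
apply: gen_sub (coord_gen f (enum_perm X)) => p; rewrite mem_cat es et sE tE.
by move=> /orP[/mapP[y _ ->]|//]; apply/map_f/mem_enum_perm.
Qed.

Lemma mu_of_incl1 (x : pt) (s : seq pt) : gen (x :: s) -> mu_of (incl1 x s) = F x s.
Proof.
move=> g.
pose f : coordinates (pp (x :: s)) := @Coordinates (pp (x :: s)) (fun u => sval u)
  (fun u v => esym (ltx_gen g (svalP u) (svalP v)))
  (fun u v => esym (lty_gen g (svalP u) (svalP v))).
have sE : s =i map (f \o incl1 x s) (enum_perm (pp s)).
  move=> p; apply/idP/mapP => [ps|[u _ ->]]; last exact: (svalP u).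
  by exists (ppt ps); rewrite ?mem_enum_perm.
have tE : x :: s =i map f (enum_perm (pp (x :: s))).
  move=> p; apply/idP/mapP => [ps|[u _ ->]]; last exact: (svalP u).
  by exists (ppt ps); rewrite ?mem_enum_perm.
rewrite (mu_of_chain sE tE) (@chain_set s s (x :: s) [:: x]) //=; first by rewrite mulr1.
- apply: (gen_sub _ (g)) => p; rewrite !(inE, mem_cat).
  by case: (p \in s); rewrite ?orbT ?orbF.
- by move=> p; rewrite !(inE, mem_cat); case: (p \in s); rewrite ?orbT ?orbF.
Qed.

Lemma mu_of_measure : is_measure mu_of.
Proof.
have m_iso Y X (i : embedding Y X) : emb_iso i -> mu_of i = 1.
  move=> /emb_iso_surj si; rewrite /mu_of; set s := map _ _; set t := map _ _.
  have ts : {subset t <= s}.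
    by move=> _ /mapP[x _ ->]; have [y <-] := si x; apply/(map_f (_ \o i))/mem_enum_perm.
  have st : {subset s <= t}.
    by move=> _ /mapP[y _ ->]; apply/map_f/mem_enum_perm.
  rewrite (@chain_set s s t [::]) // => [|p].
    by apply: gen_sub (coord_gen (std_coord X) (enum_perm X)) => p;
      rewrite mem_cat => /orP[/st|].
  by rewrite !mem_cat orbF; apply/orP/idP => [[|/ts]//|]; left.
have m_comp Z Y X (j : embedding Y X) (i : embedding Z Y) :
    mu_of (emb_comp j i) = mu_of j * mu_of i.
  pose f := std_coord X.
  have fj_lt x y : ((f (j x)).1 < (f (j y)).1)%N = plt x y.
    by rewrite coord_lt emb_plt.
  have fj_prec x y : ((f (j x)).2 < (f (j y)).2)%N = pprec x y.
    by rewrite coord_prec emb_pprec.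
  pose fj : coordinates Y := Coordinates fj_lt fj_prec.
  rewrite (@mu_of_chain _ _ i fj _ _ (fun=> erefl) (fun=> erefl)) mulrC.
  rewrite {1 2}/mu_of.
  set s := map _ (enum_perm Z); set t := map _ (enum_perm X).
  have e : map (std_coord X \o j) (enum_perm Y) = map fj (enum_perm Y) by [].
  rewrite e; set u := map _ (enum_perm Y).
  have st : {subset s <= t} by move=> _ /mapP[y _ ->]; apply/map_f/mem_enum_perm.
  have su : {subset s <= u}.
    by move=> _ /mapP[y _ ->]; apply: (map_f fj); apply: mem_enum_perm.
  have ut : {subset u <= t}.
    by move=> _ /mapP[y _ ->]; apply: (map_f f); apply: mem_enum_perm.
  have gt : gen t by apply: coord_gen.
  rewrite (@chain_cat s u t) //; last first.
    by apply: gen_sub gt => p; rewrite mem_cat => /orP[/st|].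
  congr (_ * _); apply: chain_set.
  - by apply: gen_sub gt => p; rewrite !mem_cat => /orP[/orP[/ut|/st]|].
  - by move=> p; rewrite mem_cat; apply/orP/idP => [[|/su]//|]; left.
  - move=> p; rewrite !mem_cat; congr orb; apply/orP/idP => [[|/su]//|]; by left.
apply: splits_measure => // x z s g ev xzs zs.
have [A [cA AE]] := cand_all_amalgamations g ev xzs zs.
exists 'I_(size (cand s x z)), A; split; first exact: cA.
have gx : gen (x :: s).
  by apply: (gen_sub _ (g)) => p; rewrite !inE => /orP[->|->]; rewrite ?orbT.
rewrite (mu_of_incl1 gx) (cell_split cF g ev xzs zs) (big_nth z) big_mkord.
apply: eq_bigr => a _; have [x'c ->] := AE a; rewrite mu_of_incl1 //.
exact: cand_gen x'c.
Qed.

End MeasureOfCell.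

Lemma mu_of_cell_of (k : comPzRingType)
    (nu : forall Y X : permutation, embedding Y X -> k)
    (F : pt -> seq pt -> k) : is_measure nu -> cell_function F ->
  (forall x s, gen (x :: s) -> cell_of nu x s = F x s) ->
  forall (Y X : permutation) (i : embedding Y X), nu Y X i = mu_of F i.
Proof.
move=> mnu cF e Y X i.
rewrite (measure_chain mnu (f := std_coord X) (fun=> erefl) (fun=> erefl)) /mu_of.
set s := map _ _; set t := map _ _.
have : gen (s ++ t).
  apply: gen_sub (coord_gen (std_coord X) (enum_perm X)) => p; rewrite mem_cat.
  by move=> /orP[/mapP[y _ ->]|//]; apply/map_f/mem_enum_perm.
elim: t s => //= x t IH s g; rewrite e; last first.
  by apply: gen_sub g => p; rewrite mem_cat !inE => /orP[->|->]; rewrite ?orbT.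
congr (_ * _); apply: IH.
exact: gen_cons_cat.
Qed.

(** * Values attached to cells *)

Fixpoint nearest (r : rel pt) (s : seq pt) : option pt :=
  if s is p :: s' then
    if nearest r s' is Some q then (if r q p then Some q else Some p) else Some p
  else None.

Definition nbr (r : rel pt) (x : pt) (s : seq pt) : option pt :=
  nearest r (filter (r x) s).

Definition to_right (p q : pt) : bool := (p.1 < q.1)%N.
Definition to_left (p q : pt) : bool := (q.1 < p.1)%N.
Definition above (p q : pt) : bool := (p.2 < q.2)%N.
Definition below (p q : pt) : bool := (q.2 < p.2)%N.

Notation lincomb := (seq int).

Definition vadd (u v : lincomb) : lincomb := [seq p.1 + p.2 | p <- zip u v].

Record corner_weights := CornerWeights {
  w_none : lincomb; w_vert : lincomb; w_point : lincomb;
  w_out : lincomb; w_in : lincomb }.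

(* [h] and [v] are the points bounding a cell horizontally and vertically at
   one of its corners, the directions [rh] and [rv] pointing out of the cell. *)
Definition corner (w : corner_weights) (rh rv : rel pt) (h v : option pt) : lincomb :=
  match h, v with
  | None, None => w_none w
  | None, Some _ => w_vert w
  | Some h, Some v =>
      if h == v then w_point w
      else if rv v h then (if rh h v then w_out w else w_in w)
      else nseq 9 0
  | _, _ => nseq 9 0
  end.

(* Coefficients with respect to
   [mu(.12), mu(1.2), mu(.21), mu(2.1), mu(13.2), mu(.231), mu(2.31), mu(21.354), 1],
   the dot preceding the marked element. The weights come from solving the
   linear system formed by the relations [cell_split]. *)
Definition w_ne : corner_weights := @CornerWeights
  [:: 0; 1; 0; 0; 0; 0; -1; -1; 0] [:: 0; 0; 0; 0; 0; 0; 0; -1; 0]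
  [:: 0; 0; 0; 0; 0; 1; 0; 0; 0] (nseq 9 0) [:: 0; 0; 0; 0; 0; 0; 0; -1; 0].
Definition w_nw : corner_weights := @CornerWeights
  [:: 0; 0; 0; 1; -1; 0; 0; 0; 0] (nseq 9 0)
  [:: 0; 0; 0; 0; -1; -1; -1; 0; -1] [:: 0; 0; 0; 0; 0; 0; 0; 1; 0] (nseq 9 0).
Definition w_se : corner_weights := @CornerWeights
  [:: 0; 0; 1; 0; 1; 1; 1; 1; 1] (nseq 9 0)
  [:: 0; 0; 0; 0; 1; 0; 0; 0; 0] (nseq 9 0) [:: 0; 0; 0; 0; 0; 0; 0; -1; 0].
Definition w_sw : corner_weights := @CornerWeights
  [:: 1; 0; 0; 0; 0; -1; 0; 0; 0] (nseq 9 0)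
  [:: 0; 0; 0; 0; 0; 0; 1; 1; 0] [:: 0; 0; 0; 0; 0; 0; 0; 1; 0] (nseq 9 0).

Definition cell_comb (x : pt) (s : seq pt) : lincomb :=
  let l := nbr to_left x s in let r := nbr to_right x s in
  let b := nbr below x s in let t := nbr above x s in
  vadd (vadd (corner w_ne to_right above r t) (corner w_nw to_left above l t))
       (vadd (corner w_se to_right below r b) (corner w_sw to_left below l b)).

Fixpoint eval (k : comPzRingType) (t : seq k) (v : lincomb) : k :=
  match t, v with
  | a :: t', c :: v' => a *~ c + eval t' v'
  | _, _ => 0
  end.

Definition cell_value (k : comPzRingType) (t : seq k) (x : pt) (s : seq pt) : k :=
  if x \in s then 1 else eval t (cell_comb x s).

Definition nbrs (x : pt) (s : seq pt) : seq pt :=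
  undup (pmap id [:: nbr to_left x s; nbr to_right x s; nbr below x s; nbr above x s]).

Definition direction (r : rel pt) : Prop :=
  [/\ irreflexive r, transitive r &
    forall s, gen s -> {in s &, forall p q, p != q -> r p q || r q p}].

Lemma to_right_dir : direction to_right.
Proof.
split=> [p|q p t|s [g _] p q ps qs pq]; rewrite /to_right ?ltnn //; first exact: ltn_trans.
by rewrite -neq_ltn; apply: contraNneq pq => /(g _ _ ps qs) ->.
Qed.

Lemma to_left_dir : direction to_left.
Proof.
split=> [p|q p t|s [g _] p q ps qs pq]; rewrite /to_left ?ltnn //.
  by move=> pq qt; apply: ltn_trans qt pq.
by rewrite orbC -neq_ltn; apply: contraNneq pq => /(g _ _ ps qs) ->.
Qed.

Lemma above_dir : direction above.
Proof.
split=> [p|q p t|s [_ g] p q ps qs pq]; rewrite /above ?ltnn //; first exact: ltn_trans.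
by rewrite -neq_ltn; apply: contraNneq pq => /(g _ _ ps qs) ->.
Qed.

Lemma below_dir : direction below.
Proof.
split=> [p|q p t|s [_ g] p q ps qs pq]; rewrite /below ?ltnn //.
  by move=> pq qt; apply: ltn_trans qt pq.
by rewrite orbC -neq_ltn; apply: contraNneq pq => /(g _ _ ps qs) ->.
Qed.

Section Nearest.
Variable r : rel pt.
Hypothesis dr : direction r.

Let rI : irreflexive r. Proof. by case: dr. Qed.
Let rT : transitive r. Proof. by case: dr. Qed.
Let rN p q : r p q -> r q p = false.
Proof. by move=> pq; apply/negP => /(rT pq); rewrite rI. Qed.

Lemma nearest_mem s p : nearest r s = Some p -> p \in s.
Proof.
elim: s p => //= q s IH p; case E: (nearest r s) => [t|]; last first.
  by case=> <-; rewrite mem_head.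
by case: ifP => _ [<-]; rewrite ?mem_head // inE IH ?orbT.
Qed.

Lemma nearest_none s : nearest r s = None -> s = [::].
Proof. by case: s => //= p s; case: nearest => [q|] //; case: ifP. Qed.

Lemma nearest_eq s p : p \in s -> (forall q, q \in s -> q = p \/ r p q) ->
  nearest r s = Some p.
Proof.
elim: s => //= a s IH ps hp.
have hs q : q \in s -> q = p \/ r p q by move=> qs; apply: hp; rewrite inE qs orbT.
have [pins|pns] := boolP (p \in s).
  rewrite IH //; have [->|->//] := hp a (mem_head a s); by rewrite rI.
have e : p = a by move: ps; rewrite inE (negbTE pns) orbF => /eqP.
case E: (nearest r s) => [t|]; last by rewrite e.
have ts := nearest_mem E; have [tp|pt] := hs t ts; first by rewrite -tp ts in pns.
by rewrite -e (rN pt).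
Qed.

Lemma nearest_min s p q : gen s -> nearest r s = Some p -> q \in s -> q = p \/ r p q.
Proof.
elim: s p => //= a s IH p g.
have gs : gen s by apply: gen_sub g; apply: sub_cons.
have tot u : u \in s -> u = a \/ r u a \/ r a u.
  move=> us; have [->|ua] := eqVneq u a; [by left|right].
  case: dr => _ _ /(_ _ g u a); rewrite mem_head inE us orbT => /(_ isT isT ua).
  by move=> /orP.
case E: (nearest r s) => [t|].
  have ts := nearest_mem E; have h := IH _ gs E.
  case: ifP => [ta [<-]|ta [<-]]; rewrite inE => /orP[/eqP->|qs].
  - by right.
  - exact: h.
  - by left.
  have [tE|[|at']] := tot _ ts; last 2 first.
  - by rewrite ta.
  - by have [->|/(rT at')] := h qs; right.
  by have [->|] := h qs; [left|right; rewrite -tE].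
by case=> <-; rewrite (nearest_none E) inE => /eqP ->; left.
Qed.

Lemma nbrP (x p : pt) (s : seq pt) : gen s ->
  nbr r x s = Some p <->
  [/\ p \in s, r x p & forall q, q \in s -> r x q -> q = p \/ r p q].
Proof.
move=> g; split=> [E|[ps xp hp]].
  have := nearest_mem E; rewrite mem_filter => /andP[xp ps]; split=> // q qs xq.
  apply: (nearest_min _ E); last by rewrite mem_filter xq qs.
  by apply: gen_sub g => u; rewrite mem_filter => /andP[].
apply: nearest_eq; first by rewrite mem_filter xp ps.
by move=> q; rewrite mem_filter => /andP[xq qs]; apply: hp.
Qed.

Lemma nbr_mem (x p : pt) (s : seq pt) : nbr r x s = Some p -> p \in s.
Proof. by move=> /nearest_mem; rewrite mem_filter => /andP[]. Qed.

Lemma nbr_rel (x p : pt) (s : seq pt) : nbr r x s = Some p -> r x p.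
Proof. by move=> /nearest_mem; rewrite mem_filter => /andP[]. Qed.

Lemma nbr_none (x q : pt) (s : seq pt) : nbr r x s = None -> q \in s -> r x q = false.
Proof.
move=> /nearest_none E qs; apply/negP => xq.
by have : q \in [seq p <- s | r x p]; [rewrite mem_filter xq qs|rewrite E].
Qed.

(** Only comparisons with the base point and its neighbour enter, so the same criterion serves
    sublists, increasing maps and the merging maps of the swap relations. *)
Lemma nbr_transfer (phi : pt -> pt) (x x' : pt) (s s' : seq pt) :
  (forall p, nbr r x s = Some p -> phi p \in s' /\ r x' (phi p)) ->
  (forall q, q \in s' -> r x' q ->
    exists2 p, nbr r x s = Some p & q = phi p \/ r (phi p) q) ->
  nbr r x' s' = omap phi (nbr r x s).
Proof.
case E: (nbr r x s) => [p|] h1 h2 /=.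
  have [ps xp] := h1 _ erefl; apply: nearest_eq; first by rewrite mem_filter xp ps.
  by move=> q; rewrite mem_filter => /andP[xq qs]; have [_ [<-]] := h2 _ qs xq.
case E': (nbr r x' s') => [q|//].
by have [] := h2 _ (nbr_mem E') (nbr_rel E').
Qed.

Lemma nbr_sub (x : pt) (s s' : seq pt) : gen s -> {subset s' <= s} ->
  (forall p, nbr r x s = Some p -> p \in s') -> nbr r x s' = nbr r x s.
Proof.
move=> g s's h; rewrite (@nbr_transfer id x x s s') ?omap_id // => [p E|q qs xq].
  by split; [apply: h|apply: nbr_rel E].
case E: (nbr r x s) => [p|]; last by rewrite (nbr_none E (s's _ qs)) in xq.
by exists p => //; have [_ _] := (nbrP x p g).1 E; apply=> //; apply: s's.
Qed.

Lemma nbr_map (phi : pt -> pt) (x : pt) (s s' : seq pt) : gen (x :: s) ->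
  {in x :: s &, forall p q, r (phi p) (phi q) = r p q} -> s' =i map phi s ->
  nbr r (phi x) s' = omap phi (nbr r x s).
Proof.
move=> g inc ss'; have gs : gen s by apply: gen_sub g; apply: sub_cons.
have xi : x \in x :: s by rewrite mem_head.
apply: nbr_transfer => [p E|q].
  have ps := nbr_mem E; rewrite ss' map_f //; split=> //.
  by rewrite inc ?(nbr_rel E) // inE ps orbT.
rewrite ss' => /mapP[q' qs ->]; have qi : q' \in x :: s by rewrite inE qs orbT.
rewrite inc // => xq.
case E: (nbr r x s) => [p|]; last by rewrite (nbr_none E qs) in xq.
exists p => //; have [_ _ h] := (nbrP x p gs).1 E.
have [->|pq] := h _ qs xq; [by left|right].
by rewrite inc // inE (nbr_mem E) orbT.
Qed.

End Nearest.

Lemma nbrs_sub (x : pt) (s : seq pt) : {subset nbrs x s <= s}.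
Proof.
move=> p; rewrite mem_undup mem_pmap map_id !inE.
by move=> /or4P[]/eqP/esym/nbr_mem.
Qed.

Lemma mem_nbrs (x p : pt) (s : seq pt) :
  (p \in nbrs x s) = [|| nbr to_left x s == Some p, nbr to_right x s == Some p,
    nbr below x s == Some p | nbr above x s == Some p].
Proof.
by rewrite mem_undup mem_pmap map_id !inE !(eq_sym (Some p)).
Qed.

Lemma increasing_dir (s : seq pt) (phi : pt -> pt) : increasing_on s phi ->
  [/\ {in s &, forall p q, to_left (phi p) (phi q) = to_left p q},
      {in s &, forall p q, to_right (phi p) (phi q) = to_right p q},
      {in s &, forall p q, below (phi p) (phi q) = below p q} &
      {in s &, forall p q, above (phi p) (phi q) = above p q}].
Proof.
by move=> inc; split=> p q ps qs; rewrite /to_left /to_right /below /above inc.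
Qed.

Lemma increasing_inj (s : seq pt) (phi : pt -> pt) : gen s -> increasing_on s phi ->
  {in s &, injective phi}.
Proof.
move=> [g _] inc p q ps qs e; apply: g => //.
have [pq _] := inc _ _ ps qs; have [qp _] := inc _ _ qs ps.
by move: pq qp; rewrite e ltnn; case: (ltngtP p.1 q.1).
Qed.

Lemma corner_map (w : corner_weights) (rh rv : rel pt) (phi : pt -> pt) (h v : option pt) :
  (forall p q, h = Some p -> v = Some q ->
    [/\ (phi p == phi q) = (p == q), rh (phi p) (phi q) = rh p q
      & rv (phi q) (phi p) = rv q p]) ->
  corner w rh rv (omap phi h) (omap phi v) = corner w rh rv h v.
Proof. by case: h v => [p|] [q|] //= /(_ p q erefl erefl)[-> -> ->]. Qed.

Lemma cell_comb_map (x : pt) (s s' : seq pt) (phi : pt -> pt) : gen (x :: s) ->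
  increasing_on (x :: s) phi -> s' =i map phi s ->
  cell_comb (phi x) s' = cell_comb x s.
Proof.
move=> g inc ss'; have [il ir ib ia] := increasing_dir inc.
have inj := increasing_inj g inc.
have m r p : direction r -> nbr r x s = Some p -> p \in x :: s.
  by move=> _ /nbr_mem ps; rewrite inE ps orbT.
rewrite /cell_comb (nbr_map to_left_dir g il ss') (nbr_map to_right_dir g ir ss').
rewrite (nbr_map below_dir g ib ss') (nbr_map above_dir g ia ss').
have prop r r' h v : direction r -> direction r' -> nbr r x s = Some h ->
    nbr r' x s = Some v -> [/\ h \in x :: s, v \in x :: s & (phi h == phi v) = (h == v)].
  move=> dr dr' /(m _ _ dr) hs /(m _ _ dr') vs.
  by split=> //; rewrite (inj_in_eq inj).
rewrite !corner_map // => h v /prop eh /eh.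
- by case=> [||hs vs ->]; [exact: to_left_dir|exact: below_dir|rewrite il ?ib].
- by case=> [||hs vs ->]; [exact: to_right_dir|exact: below_dir|rewrite ir ?ib].
- by case=> [||hs vs ->]; [exact: to_left_dir|exact: above_dir|rewrite il ?ia].
- by case=> [||hs vs ->]; [exact: to_right_dir|exact: above_dir|rewrite ir ?ia].
Qed.

(* The first coordinate corresponds to [<] and the second one to the order of
   appearance, so that [w] is the inverse of the word of the permutation. *)
Definition word_pts (w : seq nat) : seq pt :=
  [seq (i.*2.+2, (nth 0 w i).*2.+2)%N | i <- iota 0 (size w)].

Definition others (x : pt) (s : seq pt) : seq pt := [seq p <- s | p != x].

(** A marked permutation in standard form: the ranks in the second order, listed along the first
    order, and the index of the marked point. *)
Definition key : Type := (seq nat * nat)%type.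
Definition key_pt (k : key) : pt := (k.2.*2.+2, (nth 0 k.1 k.2).*2.+2)%N.
Definition key_rest (k : key) : seq pt := others (key_pt k) (word_pts k.1).

Definition rank1 (s : seq pt) (p : pt) : nat := count (fun q => q.1 < p.1)%N s.
Definition rank2 (s : seq pt) (p : pt) : nat := count (fun q => q.2 < p.2)%N s.
Definition ranks (s : seq pt) (p : pt) : pt := ((rank1 s p).*2.+2, (rank2 s p).*2.+2)%N.
Definition word_of (s : seq pt) : seq nat :=
  [seq rank2 s (nth (0, 0)%N s (index i (map (rank1 s) s))) | i <- iota 0 (size s)].

(** The isomorphism type of [x] together with the points bounding its cell, on which alone cell
    values depend. *)
Definition key_of (x : pt) (s : seq pt) : key :=
  let s' := x :: nbrs x s in (word_of s', rank1 s' x).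

Lemma size_vadd (n : nat) (u v : lincomb) : size u = n -> size v = n -> size (vadd u v) = n.
Proof. by move=> su sv; rewrite size_map size_zip su sv minnn. Qed.

Lemma size_cell_comb (x : pt) (s : seq pt) : size (cell_comb x s) = 9.
Proof.
have c w rh rv h v : [&& size (w_none w) == 9, size (w_vert w) == 9,
    size (w_point w) == 9, size (w_out w) == 9 & size (w_in w) == 9]%N ->
    size (corner w rh rv h v) = 9%N.
  case/and5P => /eqP a /eqP b /eqP d /eqP e /eqP f; case: h v => [h|] [v|] //=.
  by do 3?case: ifP.
by rewrite /cell_comb; do !apply: size_vadd; apply: c.
Qed.

Lemma eval_vadd (k : comPzRingType) (t : seq k) (u v : lincomb) : size u = size v ->
  eval t (vadd u v) = eval t u + eval t v.
Proof.
elim: u v t => [|a u IH] [|b v] [|c t] //=; rewrite ?addr0 // => -[/IH e].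
by rewrite [X in _ + X]e mulrzDr addrACA.
Qed.

Lemma eval_zero (k : comPzRingType) (t : seq k) (n : nat) : eval t (nseq n 0) = 0.
Proof. by elim: n t => [|n IH] [|a t] //=; rewrite IH mulr0z addr0. Qed.

Lemma eval_last (k : comPzRingType) (t : seq k) : size t = 8 ->
  eval (rcons t 1) (rcons (nseq 8 0) 1) = 1.
Proof.
by case: t => [|? [|? [|? [|? [|? [|? [|? [|? [|? ?]]]]]]]]] //= _;
  rewrite !mulr0z !add0r addr0.
Qed.

Lemma gen_cons (x : pt) (s : seq pt) : gen (x :: s) -> gen s.
Proof. by apply: gen_sub; apply: sub_cons. Qed.

Lemma cell_comb_local (x : pt) (s s' : seq pt) : gen s -> {subset s' <= s} ->
  {subset nbrs x s <= s'} -> cell_comb x s' = cell_comb x s.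
Proof.
move=> g s's ns.
have h r : direction r -> (forall p, nbr r x s = Some p -> p \in nbrs x s) ->
    nbr r x s' = nbr r x s.
  by move=> dr hr; apply: nbr_sub => // p /hr/ns.
rewrite /cell_comb !h //; try by move=> p E; rewrite mem_nbrs E eqxx ?orbT.
all: by (exact: to_left_dir || exact: to_right_dir || exact: below_dir || exact: above_dir).
Qed.

Lemma rank_lt (c : pt -> nat) (s : seq pt) (p q : pt) : p \in s ->
  (count (fun t => c t < c p)%N s < count (fun t => c t < c q)%N s)%N = (c p < c q)%N.
Proof.
move=> ps.
have mono m n : (m <= n)%N ->
    (count (fun t => c t < m)%N s <= count (fun t => c t < n)%N s)%N.
  by move=> mn; apply: sub_count => t /= tm; apply: leq_trans mn.
apply/idP/idP => [|pq].
  by apply: contraTT; rewrite -!leqNgt; apply: mono.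
apply: (@leq_trans (count (fun t => c t < (c p).+1)%N s)); last exact: mono.
elim: s ps {mono} => //= t s IH; rewrite inE => /orP[/eqP<-|/IH h].
  rewrite ltnn ltnSn add0n add1n ltnS; apply: sub_count => u /= up; exact: ltnW.
rewrite -addnS; apply: leq_add => //; rewrite ltnS.
by case: ltngtP.
Qed.

Lemma rank_size (c : pt -> nat) (s : seq pt) (p : pt) : p \in s ->
  (count (fun t => c t < c p)%N s < size s)%N.
Proof.
move=> ps; rewrite -(count_predC (fun t => c t < c p)%N s) -addn1 leq_add2l.
by rewrite -has_count; apply/hasP; exists p; rewrite //= ltnn.
Qed.

Lemma ranks_increasing (s : seq pt) : increasing_on s (ranks s).
Proof.
move=> p q ps qs; rewrite /= !ltnS !ltn_double.
by split; [apply: (rank_lt fst)|apply: (rank_lt snd)].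
Qed.

Lemma perm_iota (s : seq nat) : uniq s -> (forall m, m \in s -> (m < size s)%N) ->
  perm_eq s (iota 0 (size s)).
Proof.
move=> us sm; apply: uniq_perm => //; first exact: iota_uniq.
have sub : {subset s <= iota 0 (size s)} by move=> m ms; rewrite mem_iota /= add0n sm.
have [|_ h] := uniq_min_size us sub; first by rewrite size_iota.
by move=> m; rewrite h.
Qed.

Section WordOf.
Variable s : seq pt.
Hypotheses (us : uniq s) (gs : gen s).

Let inj1 : {in s &, injective (rank1 s)}.
Proof.
move=> p q ps qs e; apply: (proj1 gs) => //.
have := rank_lt fst q ps; have := rank_lt fst p qs.
by rewrite -/(rank1 s p) -/(rank1 s q) e ltnn; case: ltngtP.
Qed.

Let inj2 : {in s &, injective (rank2 s)}.
Proof.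
move=> p q ps qs e; apply: (proj2 gs) => //.
have := rank_lt snd q ps; have := rank_lt snd p qs.
by rewrite -/(rank2 s p) -/(rank2 s q) e ltnn; case: ltngtP.
Qed.

Let perm1 : perm_eq (map (rank1 s) s) (iota 0 (size s)).
Proof.
rewrite -[size s](size_map (rank1 s)); apply: perm_iota.
  by rewrite map_inj_in_uniq.
by move=> _ /mapP[p ps ->]; rewrite size_map; apply: (rank_size fst).
Qed.

Let inv i := nth (0, 0)%N s (index i (map (rank1 s) s)).

Let invK p : p \in s -> inv (rank1 s p) = p.
Proof.
move=> ps; have rp : rank1 s p \in map (rank1 s) s by apply: map_f.
have lt : (index (rank1 s p) (map (rank1 s) s) < size s)%N.
  by rewrite -[X in (_ < X)%N](size_map (rank1 s)) index_mem.
apply: inj1 => //; first exact: mem_nth.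
by rewrite -(nth_map _ 0%N) // nth_index.
Qed.

Lemma size_word_of : size (word_of s) = size s.
Proof. by rewrite size_map size_iota. Qed.

Lemma nth_word_of p : p \in s -> nth 0%N (word_of s) (rank1 s p) = rank2 s p.
Proof.
move=> ps; have lt := rank_size fst ps.
by rewrite (nth_map 0%N) ?size_iota // nth_iota // add0n -/(inv _) invK.
Qed.

Lemma perm_word_of : perm_eq (word_of s) (iota 0 (size s)).
Proof.
have e : perm_eq (word_of s) (map (rank2 s) s).
  have -> : map (rank2 s) s = map (rank2 s \o inv) (map (rank1 s) s).
    by rewrite -map_comp; apply/eq_in_map => p ps /=; rewrite invK.
  by apply: (perm_map (rank2 s \o inv)); rewrite perm_sym.
rewrite (perm_trans e) // -[size s](size_map (rank2 s)); apply: perm_iota.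
  by rewrite map_inj_in_uniq.
by move=> _ /mapP[p ps ->]; rewrite size_map; apply: (rank_size snd).
Qed.

Lemma word_pts_of : word_pts (word_of s) =i map (ranks s) s.
Proof.
move=> q; apply/mapP/mapP => [[i]|[p ps ->]].
  rewrite mem_iota size_word_of add0n => /= lt ->.
  have : i \in map (rank1 s) s by rewrite (perm_mem perm1) mem_iota add0n.
  by case/mapP => p ps ip; exists p => //; rewrite /ranks ip nth_word_of.
exists (rank1 s p); last by rewrite nth_word_of.
by rewrite mem_iota size_word_of add0n; apply: (rank_size fst).
Qed.

End WordOf.

Definition all_keys (n : nat) : seq key :=
  flatten [seq [seq (w, i) | w <- permutations (iota 0 m), i <- iota 0 m] | m <- iota 0 n.+1].

(** Five points suffice: the marked one and at most four bounding its cell. *)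
Definition reduced_keys : seq key :=
  [seq k <- all_keys 5 | all (mem (nbrs (key_pt k) (key_rest k))) (key_rest k)].

Lemma size_nbrs (x : pt) (s : seq pt) : (size (nbrs x s) <= 4)%N.
Proof.
apply: (leq_trans (size_undup _)); rewrite size_pmap.
exact: (leq_trans (count_size _ _)).
Qed.

Section KeyOf.
Variables (x : pt) (s : seq pt).
Hypotheses (gx : gen (x :: s)) (xs : x \notin s).

Let P := x :: nbrs x s.
Let PS : {subset P <= x :: s}.
Proof. by move=> p; rewrite !inE => /orP[->//|/nbrs_sub->]; rewrite orbT. Qed.
Let uP : uniq P.
Proof. by rewrite /= undup_uniq andbT; apply: contra xs; apply: nbrs_sub. Qed.
Let gP : gen P. Proof. exact: gen_sub gx. Qed.

Lemma key_pt_of : key_pt (key_of x s) = ranks P x.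
Proof. by rewrite /key_pt /= nth_word_of ?mem_head. Qed.

Lemma key_rest_of : key_rest (key_of x s) =i map (ranks P) (nbrs x s).
Proof.
have inj := increasing_inj gP (@ranks_increasing P).
move=> q; rewrite mem_filter key_pt_of word_pts_of //.
apply/andP/mapP => [[qx /mapP[p pP qp]]|[p pn ->]].
  exists p => //; move: pP; rewrite inE => /orP[/eqP px|//].
  by rewrite qp px eqxx in qx.
have pP : p \in P by rewrite inE pn orbT.
rewrite map_f //; split=> //; rewrite (inj_in_eq inj) ?mem_head //.
by apply: contraNneq xs => <-; apply: nbrs_sub pn.
Qed.

Lemma key_of_reduced : key_of x s \in reduced_keys.
Proof.
rewrite mem_filter; apply/andP; split.
  apply/allP => q; rewrite key_rest_of => /mapP[p pn ->{q}] /=.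
  have [il ir ib ia] := increasing_dir (@ranks_increasing P).
  have h r : direction r -> {in P &, forall p q, r (ranks P p) (ranks P q) = r p q} ->
      (forall p, nbr r x s = Some p -> p \in nbrs x s) -> nbr r x s = Some p ->
      nbr r (key_pt (key_of x s)) (key_rest (key_of x s)) = Some (ranks P p).
    move=> dr inc hr E; rewrite key_pt_of (nbr_map dr gP inc key_rest_of).
    by rewrite (nbr_sub dr (gen_cons gx) (@nbrs_sub x s) hr) E.
  move: pn; rewrite !mem_nbrs => /or4P[]/eqP E.
  - by rewrite (h _ to_left_dir il _ E) ?eqxx // => q; rewrite mem_nbrs => ->; rewrite eqxx.
  - by rewrite (h _ to_right_dir ir _ E) ?eqxx ?orbT // => q;
    rewrite mem_nbrs => ->; rewrite eqxx ?orbT.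
  - by rewrite (h _ below_dir ib _ E) ?eqxx ?orbT // => q;
    rewrite mem_nbrs => ->; rewrite eqxx ?orbT.
  - by rewrite (h _ above_dir ia _ E) ?eqxx ?orbT // => q;
    rewrite mem_nbrs => ->; rewrite eqxx ?orbT.
apply/flatten_mapP; exists (size P); first by rewrite mem_iota; exact: size_nbrs.
apply/allpairsP; exists (word_of P, rank1 P x); split=> //.
  by rewrite mem_permutations; apply: perm_word_of.
by rewrite mem_iota; apply: (rank_size fst); rewrite mem_head.
Qed.

End KeyOf.

(** * The splitting relations *)

Definition vsum (l : seq lincomb) : lincomb := foldr vadd (nseq 9 0) l.

(** If the new point falls on [z], the extension is an isomorphism and has value 1, which is the
    last basis vector. *)
Definition piece (z : pt) (s : seq pt) (p : pt) : lincomb :=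
  if p == z then rcons (nseq 8 0) 1 else cell_comb p (z :: s).

Definition additive_at (x z : pt) (s : seq pt) : Prop :=
  cell_comb x s = vsum [seq piece z s p | p <- cand s x z].

Lemma pt_eqE (p q : pt) : (p == q) = (p.1 == q.1) && (p.2 == q.2).
Proof. by case: p q => a b [c d]; rewrite xpair_eqE. Qed.

Lemma eqn_lt (m n : nat) : (m == n) = ~~ (m < n)%N && ~~ (n < m)%N.
Proof. by case: ltngtP. Qed.

Lemma slots_translate (a b : nat) : (0 < a)%N -> (0 < b)%N ->
  [:: b.-1; b; b.+1] = [seq (n + b - a)%N | n <- [:: a.-1; a; a.+1]].
Proof. by move=> a0 b0 /=; congr [:: _; _; _]; lia. Qed.

Lemma translate_cmp (a b n : nat) : (0 < a)%N -> (0 < b)%N ->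
  n \in [:: a.-1; a; a.+1] ->
  ((n + b - a < b)%N = (n < a)%N) * ((b < n + b - a)%N = (a < n)%N) *
  ((n + b - a == b)%N = (n == a)).
Proof. by rewrite !inE => a0 b0 /or3P[]/eqP->; do !split; lia. Qed.

(** * Transport of a splitting relation to standard position *)

Section Transfer.
Variables (x z x1 z1 : pt) (s s1 : seq pt) (phi : pt -> pt).
Hypotheses (g : gen (x :: z :: s)) (ev : all even_pt (z :: s)).
Hypotheses (xzs : x \notin z :: s) (zs : z \notin s).
Let s0 := nbrs x s.
Hypothesis inc : increasing_on (x :: z :: s0) phi.
Hypotheses (px : phi x = x1) (pz : phi z = z1) (ps1 : s1 =i map phi s0).
Hypothesis ev1 : all even_pt (z1 :: s1).

Let s0s : {subset s0 <= s} := @nbrs_sub x s.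
Let sub0 : {subset x :: z :: s0 <= x :: z :: s}.
Proof. by move=> p; rewrite !inE => /or3P[->|->|/s0s->]; rewrite ?orbT. Qed.
Let g0 : gen (x :: z :: s0) := gen_sub sub0 g.
Let gxs : gen (x :: s).
Proof. by apply: (gen_sub _ g) => p; rewrite !inE => /orP[->|->]; rewrite ?orbT. Qed.
Let gs : gen s := gen_cons gxs.
Let gzs : gen (z :: s) := gen_cons g.

Let g1 : gen (x1 :: z1 :: s1).
Proof.
have e : x1 :: z1 :: s1 =i map phi (x :: z :: s0).
  by move=> p; rewrite /= !inE ps1 px pz.
have := inc; clear -e g0 => inc; split=> p q; rewrite !e => /mapP[u us ->] /mapP[v vs ->] h.
  have [uv _] := inc us vs; have [vu _] := inc vs us; congr phi.
  apply: (proj1 g0) => //; move: uv vu; rewrite h ltnn; by case: (ltngtP u.1 v.1).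
have [_ uv] := inc us vs; have [_ vu] := inc vs us; congr phi.
apply: (proj2 g0) => //; move: uv vu; rewrite h ltnn; by case: (ltngtP u.2 v.2).
Qed.

Let inj := increasing_inj g0 inc.

Let xzs1 : x1 \notin z1 :: s1.
Proof.
apply/negP; rewrite inE -px -pz ps1 => /orP[/eqP e|/mapP[q q0 e]].
  by case/negP: xzs; rewrite (inj _ _ e) ?mem_head // inE mem_head orbT.
case/negP: xzs; rewrite (inj _ _ e) ?mem_head // !inE ?q0 ?orbT //.
by rewrite s0s ?orbT.
Qed.

Let zs1 : z1 \notin s1.
Proof.
apply/negP; rewrite -pz ps1 => /mapP[q q0 e].
by case/negP: zs; rewrite (inj _ _ e) ?s0s // !inE ?eqxx ?q0 ?orbT.
Qed.

Let separatedE (c : pt -> nat) (rl rr : rel pt) : direction rl -> direction rr ->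
  (forall p q, rl p q = (c q < c p)%N) -> (forall p q, rr p q = (c p < c q)%N) ->
  (forall p, nbr rl x s = Some p -> p \in s0) ->
  (forall p, nbr rr x s = Some p -> p \in s0) ->
  {in x :: z :: s0 &, forall p q, (c (phi p) < c (phi q))%N = (c p < c q)%N} ->
  separated c s1 x1 z1 = separated c s x z.
Proof.
move=> dl dr lE rE nl nr cinc.
have xi : x \in x :: z :: s0 by rewrite mem_head.
have zi : z \in x :: z :: s0 by rewrite !inE eqxx orbT.
have -> : separated c s1 x1 z1 = separated c s0 x z.
  apply/hasP/hasP => [[q]|[q q0 h]].
    rewrite ps1 => /mapP[q' q0 ->]; have qi : q' \in x :: z :: s0 by rewrite !inE q0 !orbT.
    by rewrite -px -pz !cinc // => h; exists q'.
  have qi : q \in x :: z :: s0 by rewrite !inE q0 !orbT.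
  by exists (phi q); rewrite ?ps1 ?map_f // -px -pz !cinc.
apply/hasP/hasP => [[q q0 h]|[q qs /orP[]/andP[h1 h2]]]; first by exists q; rewrite ?s0s.
  case E: (nbr rr x s) => [p|]; last by have := nbr_none E qs; rewrite rE h1.
  exists p; first exact: nr.
  have [_ xp hp] := (nbrP dr x p gs).1 E; rewrite rE in xp; rewrite xp /=.
  have xq : rr x q by rewrite rE.
  have [<-|] := hp _ qs xq; rewrite ?rE ?h2 // => pq.
  by rewrite (ltn_trans pq h2).
case E: (nbr rl x s) => [p|]; last by have := nbr_none E qs; rewrite lE h2.
exists p; first exact: nl.
have [_ xp hp] := (nbrP dl x p gs).1 E; rewrite lE in xp; rewrite xp andbT.
have xq : rl x q by rewrite lE.
have [<-|] := hp _ qs xq; rewrite ?lE ?h1 ?orbT // => pq.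
by rewrite (ltn_trans h1 pq) orbT.
Qed.

Let sep1 : separated fst s1 x1 z1 = separated fst s x z.
Proof.
apply: (separatedE to_left_dir to_right_dir) => // [p E|p E|p q ps qs].
- by rewrite /s0 mem_nbrs E eqxx.
- by rewrite /s0 mem_nbrs E eqxx orbT.
- by have [] := inc ps qs.
Qed.

Let sep2 : separated snd s1 x1 z1 = separated snd s x z.
Proof.
apply: (separatedE below_dir above_dir) => // [p E|p E|p q ps qs].
- by rewrite /s0 mem_nbrs E eqxx !orbT.
- by rewrite /s0 mem_nbrs E eqxx !orbT.
- by have [] := inc ps qs.
Qed.

(** Slots around [z] are translated to those around [z1]; if [x] and [z] are separated, the only
    slot is that of [x], and it goes to that of [x1]. *)
Let shift (c : pt -> nat) (a : nat) : nat :=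
  if separated c s x z then c x1 else (a + c z1 - c z)%N.

Let sigma (p : pt) : pt := (shift fst p.1, shift snd p.2).

Let z0 : (0 < z.1)%N /\ (0 < z.2)%N.
Proof. by case/andP: ev => /and4P[]. Qed.
Let z10 : (0 < z1.1)%N /\ (0 < z1.2)%N.
Proof. by case/andP: ev1 => /and4P[]. Qed.

Let slots_shift (c : pt -> nat) : separated c s1 x1 z1 = separated c s x z ->
  (0 < c z)%N -> (0 < c z1)%N -> slots c s1 x1 z1 = map (shift c) (slots c s x z).
Proof.
by rewrite /slots /shift => ->; case: ifP => _ //; apply: slots_translate.
Qed.

Let shift_cmp (c : pt -> nat) (a : nat) : separated c s1 x1 z1 = separated c s x z ->
  (0 < c z)%N -> (0 < c z1)%N ->
  ((c x1 < c z1)%N = (c x < c z)%N) -> ((c z1 < c x1)%N = (c z < c x)%N) ->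
  a \in slots c s x z ->
  ((shift c a < c z1)%N = (a < c z)%N) * ((c z1 < shift c a)%N = (c z < a)%N) *
  ((shift c a == c z1) = (a == c z)).
Proof.
rewrite /slots /shift => _; case: ifP => _ cz cz1 h1 h2.
  by rewrite inE => /eqP ->; rewrite !eqn_lt h1 h2.
exact: translate_cmp.
Qed.

Let x1z1 : [/\ (x1.1 < z1.1)%N = (x.1 < z.1)%N, (z1.1 < x1.1)%N = (z.1 < x.1)%N,
  (x1.2 < z1.2)%N = (x.2 < z.2)%N & (z1.2 < x1.2)%N = (z.2 < x.2)%N].
Proof.
have xi : x \in x :: z :: s0 by rewrite mem_head.
have zi : z \in x :: z :: s0 by rewrite !inE eqxx orbT.
have [a b] := inc xi zi; have [c d] := inc zi xi.
by rewrite -px -pz a b c d.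
Qed.

Let cmp1 a : a \in slots fst s x z ->
  ((shift fst a < z1.1)%N = (a < z.1)%N) * ((z1.1 < shift fst a)%N = (z.1 < a)%N) *
  ((shift fst a == z1.1) = (a == z.1)).
Proof.
by case: x1z1 => e1 e2 _ _; case: z0 z10 => p1 _ [p2 _]; apply: (shift_cmp sep1).
Qed.

Let cmp2 a : a \in slots snd s x z ->
  ((shift snd a < z1.2)%N = (a < z.2)%N) * ((z1.2 < shift snd a)%N = (z.2 < a)%N) *
  ((shift snd a == z1.2) = (a == z.2)).
Proof.
by case: x1z1 => _ _ e1 e2; case: z0 z10 => _ p1 [_ p2]; apply: (shift_cmp sep2).
Qed.

Let cand_sigma : cand s1 x1 z1 = map sigma (cand s x z).
Proof.
rewrite /cand (slots_shift sep1) ?(slots_shift sep2);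
  do ?[by case: z0|by case: z10].
have -> : [seq (a, b) | a <- map (shift fst) (slots fst s x z),
    b <- map (shift snd) (slots snd s x z)] =
    map sigma [seq (a, b) | a <- slots fst s x z, b <- slots snd s x z].
  by rewrite allpairs_mapl map_allpairs; elim: (slots fst s x z) => //= a l ->;
    rewrite -map_comp.
rewrite filter_map; congr map; apply: eq_in_filter => p /allpairsP[[a b] [/= ai bi ->]] /=.
by rewrite (cmp1 ai) (cmp2 bi).
Qed.

Let piece_sigma p : p \in cand s x z -> piece z1 s1 (sigma p) = piece z s p.
Proof.
move=> pc; have pc1 : sigma p \in cand s1 x1 z1 by rewrite cand_sigma map_f.
have := pc; rewrite mem_cand => /and3P[p1 p2 _].
have eqz : (sigma p == z1) = (p == z).
  by rewrite !pt_eqE /= (cmp1 p1) (cmp2 p2).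
rewrite /piece eqz; case: eqP => // pnz.
have gp := cand_gen g ev xzs zs pc.
have ps : p \notin s.
  apply/negP => ps; have [h1 h2 h3 h4] := cand_side g ev xzs zs pc ps.
  case/negP: xzs; rewrite inE; apply/orP; right.
  suff -> : x = p by [].
  apply: (proj1 g); rewrite ?mem_head ?inE ?ps ?orbT //.
  by move: h1 h2; rewrite !ltnn; case: ltngtP.
(* A candidate is on the same side as [x] of every point of [s], so each of its neighbours is [z] or
   a neighbour of [x]. *)
have loc : cell_comb p (z :: s0) = cell_comb p (z :: s).
  apply: cell_comb_local => //.
    by move=> q; rewrite !inE => /orP[->//|/s0s->]; rewrite orbT.
  have nb r : direction r -> (forall q, q \in s -> r p q = r x q) ->
      (forall q, nbr r x s = Some q -> q \in s0) ->
      forall q, nbr r p (z :: s) == Some q -> q \in z :: s0.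
    move=> dr rE nr q /eqP E; have := nbr_mem E; rewrite !inE => /orP[->//|qs].
    apply/orP; right; apply: nr; apply/(nbrP dr) => //; split=> //.
      by rewrite -rE // (nbr_rel E).
    move=> u us xu; have [_ _] := (nbrP dr p q gzs).1 E.
    by apply; rewrite ?inE ?us ?orbT ?rE.
  have side q : q \in s -> [/\ to_left p q = to_left x q, to_right p q = to_right x q,
      below p q = below x q & above p q = above x q].
    by move=> qs; have [] := cand_side g ev xzs zs pc qs.
  move=> q; rewrite mem_nbrs => /or4P[].
  - apply: (nb _ to_left_dir) => [u /side[]//|u E]; by rewrite /s0 mem_nbrs E eqxx.
  - apply: (nb _ to_right_dir) => [u /side[]//|u E]; by rewrite /s0 mem_nbrs E eqxx ?orbT.
  - apply: (nb _ below_dir) => [u /side[]//|u E]; by rewrite /s0 mem_nbrs E eqxx ?orbT.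
  - apply: (nb _ above_dir) => [u /side[]//|u E]; by rewrite /s0 mem_nbrs E eqxx ?orbT.
have pzs0 : p \notin z :: s0.
  by rewrite inE negb_or; apply/andP; split; [apply/eqP|apply: contra ps; apply: s0s].
pose psi q := if q == p then sigma p else phi q.
have psiE q : q \in z :: s0 -> psi q = phi q.
  by rewrite /psi; case: eqP => // -> pin; rewrite pin in pzs0.
have psip : psi p = sigma p by rewrite /psi eqxx.
rewrite -loc -psip; apply: cell_comb_map.
- by apply: gen_sub gp => q; rewrite !inE => /or3P[->|->|/s0s->]; rewrite ?orbT.
- have psub q : q \in z :: s0 -> q \in x :: z :: s0 by rewrite !inE => ->; rewrite orbT.
  have pq q : q \in z :: s0 ->
      [/\ ((sigma p).1 < (phi q).1)%N = (p.1 < q.1)%N, ((phi q).1 < (sigma p).1)%N = (q.1 < p.1)%N,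
       ((sigma p).2 < (phi q).2)%N = (p.2 < q.2)%N & ((phi q).2 < (sigma p).2)%N = (q.2 < p.2)%N].
    rewrite inE => /orP[/eqP->|q0]; first by rewrite pz /= !(cmp1 p1) !(cmp2 p2).
    have qs1 : phi q \in s1 by rewrite ps1 map_f.
    have [-> -> -> ->] := cand_side g1 ev1 xzs1 zs1 pc1 qs1.
    have [-> -> -> ->] := cand_side g ev xzs zs pc (s0s q0).
    have qi : q \in x :: z :: s0 by rewrite !inE q0 !orbT.
    have [a b] := inc (mem_head _ _) qi; have [c d] := inc qi (mem_head _ _).
    by rewrite -px a b c d.
  move=> u v; rewrite [u \in p :: _]in_cons [v \in p :: _]in_cons.
  move=> /orP[/eqP->|ui] /orP[/eqP->|vi]; rewrite ?psip ?psiE //.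
  - by rewrite !ltnn.
  - by have [-> _ -> _] := pq v vi.
  - by have [_ -> _ ->] := pq u ui.
  - by apply: inc; apply: psub.
- move=> q; rewrite inE -pz ps1 /= inE psiE ?mem_head //; congr orb.
  by congr (q \in _); apply/eq_in_map => u u0; rewrite psiE // inE u0 orbT.
Qed.

Lemma additive_transfer : additive_at x1 z1 s1 -> additive_at x z s.
Proof.
rewrite /additive_at cand_sigma -map_comp => e.
have <- : cell_comb x1 s1 = cell_comb x s.
  rewrite -(@cell_comb_local x s s0) // -px; apply: cell_comb_map => //.
    by apply: gen_sub g0 => p; rewrite !inE => /orP[->|->]; rewrite ?orbT.
  by move=> p q pi qi; apply: inc; [move: pi|move: qi]; rewrite !inE => /orP[->|->];
    rewrite ?orbT.
by rewrite e; congr vsum; apply/eq_in_map => p pc /=; rewrite piece_sigma.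
Qed.

End Transfer.

(** Plain case analysis, so that the large finite checks can be evaluated. *)
Definition int_eqb (a b : int) : bool :=
  match a, b with
  | Posz m, Posz n | Negz m, Negz n => eqn m n
  | _, _ => false
  end.

Fixpoint vec_eqb (u v : lincomb) : bool :=
  match u, v with
  | a :: u', b :: v' => int_eqb a b && vec_eqb u' v'
  | [::], [::] => true
  | _, _ => false
  end.

Lemma int_eqbP (a b : int) : int_eqb a b -> a = b.
Proof. by case: a b => [m|m] [n|n] //= /eqnP ->. Qed.

Lemma vec_eqbP (u v : lincomb) : vec_eqb u v -> u = v.
Proof. by elim: u v => [|a u IH] [|b v] //= /andP[/int_eqbP-> /IH->]. Qed.

Lemma rank1_lt (s : seq pt) (p q : pt) : p \in s ->
  (rank1 s p < rank1 s q)%N = (p.1 < q.1)%N.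
Proof. exact: (rank_lt fst). Qed.

Lemma rank2_lt (s : seq pt) (p q : pt) : p \in s ->
  (rank2 s p < rank2 s q)%N = (p.2 < q.2)%N.
Proof. exact: (rank_lt snd). Qed.

Definition dbl (p : pt) : pt := (p.1.*2, p.2.*2)%N.
Definition gap_pt (k : key) : pt := dbl (key_pt k).
Definition gap_rest (k : key) : seq pt := map dbl (key_rest k).
(** The points of a key now have coordinates 4 i + 4, so 4 c + 2 with c from 0 to n runs through the
    n + 1 gaps; all coordinates stay even. *)
Definition gaps (n : nat) : seq pt :=
  [seq (c.*2.*2.+2, d.*2.*2.+2)%N | c <- iota 0 n.+1, d <- iota 0 n.+1].

Definition all_gaps (P : key -> pt -> bool) : bool :=
  all (fun k => all (P k) (gaps (size k.1))) reduced_keys.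

Lemma all_gaps_additive : all_gaps (fun k z =>
  vec_eqb (cell_comb (gap_pt k) (gap_rest k))
    (vsum [seq piece z (gap_rest k) p | p <- cand (gap_rest k) (gap_pt k) z])).
Proof. by vm_cast_no_check (erefl true). Qed.

Lemma additive_all (x z : pt) (s : seq pt) : gen (x :: z :: s) ->
  all even_pt (z :: s) -> x \notin z :: s -> z \notin s -> additive_at x z s.
Proof.
move=> g ev xzs zs; pose k := key_of x s; pose P := x :: nbrs x s.
have gx : gen (x :: s).
  by apply: (gen_sub _ g) => p; rewrite !inE => /orP[->|->]; rewrite ?orbT.
have xs : x \notin s by apply: contra xzs => t; rewrite inE t orbT.
have Psub : {subset P <= x :: s}.
  by move=> p; rewrite !inE => /orP[->//|/nbrs_sub->]; rewrite orbT.
have zP : z \notin P.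
  apply/negP => /Psub; rewrite inE => /orP[/eqP zx|]; last exact/negP.
  by case/negP: xzs; rewrite zx mem_head.
(* The number of points of [P] before [z] in each order is the index of the gap that contains
   [z]. *)
pose zk : pt := ((rank1 P z).*2.*2.+2, (rank2 P z).*2.*2.+2)%N.
pose phi p := if p == z then zk else dbl (ranks P p).
have phiE p : p \in P -> phi p = dbl (ranks P p).
  by rewrite /phi; case: eqP => // -> pin; rewrite pin in zP.
have phiz : phi z = zk by rewrite /phi eqxx.
have n1 p : p \in P -> p.1 <> z.1.
  move=> pP e; case/negP: (zP); rewrite -(_ : p = z) //.
  apply: (proj1 g) => //; last by rewrite !inE eqxx orbT.
  by have := Psub _ pP; rewrite !inE => /orP[->|->]; rewrite ?orbT.
have n2 p : p \in P -> p.2 <> z.2.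
  move=> pP e; case/negP: (zP); rewrite -(_ : p = z) //.
  apply: (proj2 g) => //; last by rewrite !inE eqxx orbT.
  by have := Psub _ pP; rewrite !inE => /orP[->|->]; rewrite ?orbT.
have lt4 m n : ((m.*2.+2.*2 < n.*2.*2.+2)%N = (m < n)%N) *
    ((n.*2.*2.+2 < m.*2.+2.*2)%N = ~~ (m < n)%N).
  by rewrite -leqNgt; clear; split; lia.
have pz p : p \in P -> [/\ ((phi p).1 < zk.1)%N = (p.1 < z.1)%N,
    (zk.1 < (phi p).1)%N = (z.1 < p.1)%N, ((phi p).2 < zk.2)%N = (p.2 < z.2)%N
    & (zk.2 < (phi p).2)%N = (z.2 < p.2)%N].
  move=> pP; rewrite phiE //= !lt4 (rank1_lt z pP) (rank2_lt z pP).
  by split=> //; move: (n1 _ pP) (n2 _ pP); case: ltngtP => //; case: ltngtP.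
have inc : increasing_on (x :: z :: nbrs x s) phi.
  have mem p : p \in x :: z :: nbrs x s -> p = z \/ p \in P.
    by rewrite !inE => /or3P[->|/eqP->|->]; rewrite ?orbT; [right|left|right].
  move=> p q /mem[->|pP] /mem[->|qP]; rewrite ?phiz ?ltnn //.
  - by have [_ -> _ ->] := pz q qP.
  - by have [-> _ -> _] := pz p pP.
  - rewrite !phiE //= !ltn_double !ltnS !ltn_double.
    by rewrite (rank1_lt q pP) (rank2_lt q pP).
have evk p : even_pt (dbl (ranks P p)).
  by rewrite /even_pt /= !negbK !odd_double.
apply: (@additive_transfer x z (gap_pt k) zk s (gap_rest k) phi g ev xzs zs inc _ phiz).
- by rewrite phiE ?mem_head // /gap_pt key_pt_of.
- move=> q; rewrite /gap_rest.
  have -> : map phi (nbrs x s) = map dbl (map (ranks P) (nbrs x s)).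
    by rewrite -map_comp; apply/eq_in_map => p pn; rewrite phiE // inE pn orbT.
  apply/mapP/mapP => [[p pk ->]|[p pn ->]]; exists p => //; move: pk || move: pn;
    by rewrite key_rest_of.
- rewrite /= {1}/even_pt /= !negbK !odd_double /=; apply/allP => q /mapP[p].
  by rewrite key_rest_of // => /mapP[u _ ->] ->.
apply: vec_eqbP; apply: (allP (allP all_gaps_additive _ (key_of_reduced gx xs))).
apply/allpairsP; exists (rank1 P z, rank2 P z); split=> //;
  by rewrite mem_iota add0n (_ : size k.1 = size P) ?size_word_of // ltnS count_size.
Qed.

Lemma eval_vsum (k : comPzRingType) (t : seq k) (l : seq lincomb) :
  all (fun u => size u == 9) l -> eval t (vsum l) = \sum_(u <- l) eval t u.
Proof.
move=> h; have [] : eval t (vsum l) = \sum_(u <- l) eval t u /\ size (vsum l) = 9%N.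
  elim: l h => [_|u l IH /= /andP[/eqP su /IH[e sl]]].
    by rewrite big_nil (eval_zero t 9).
  by rewrite eval_vadd ?sl // big_cons e; split=> //; apply: size_vadd.
by [].
Qed.

Lemma cell_value_split (k : comPzRingType) (t : seq k) (x z : pt) (s : seq pt) :
  size t = 8%N -> gen (x :: z :: s) -> all even_pt (z :: s) ->
  x \notin z :: s -> z \notin s ->
  cell_value (rcons t 1) x s = \sum_(p <- cand s x z) cell_value (rcons t 1) p (z :: s).
Proof.
move=> st g ev xzs zs.
have xs : x \notin s by apply: contra xzs => h; rewrite inE h orbT.
rewrite {1}/cell_value (negbTE xs) (additive_all g ev xzs zs) eval_vsum; last first.
  by apply/allP => _ /mapP[p _ ->]; rewrite /piece; case: ifP => // _; rewrite size_cell_comb.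
rewrite big_map !big_seq; apply: eq_bigr => p pc; rewrite /piece /cell_value.
case: eqP => [->|pz]; first by rewrite mem_head eval_last.
rewrite inE; case: eqP => //= _; case: ifP => // ps.
have [h1 h2 _ _] := cand_side g ev xzs zs pc ps.
case/negP: xs; suff -> : x = p by [].
apply: (proj1 g); rewrite ?mem_head ?inE ?ps ?orbT //.
by move: h1 h2; rewrite !ltnn; case: ltngtP.
Qed.

(** * The swap relations *)

(* The entries for the permutations listed at [w_ne], in that order. *)
Definition short_row (v : seq int) : seq int :=
  rcons [seq nth 0 v i | i <- [:: 1; 2; 4; 3; 5; 7; 8; 9]%N] 1.

Fixpoint dot (u v : seq int) : int :=
  match u, v with
  | a :: u', b :: v' => intZmod.addz (intRing.mulz a b) (dot u' v')
  | _, _ => Posz 0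
  end.

Definition short_table : seq (seq int) := map short_row value_table.

(* The two products are equal either formally or at each of the 37 rows. *)
Definition swap_vec (u v u' v' : lincomb) : bool :=
  (vec_eqb u u' && vec_eqb v v') || (vec_eqb u v' && vec_eqb v u') ||
  all (fun t => int_eqb (intRing.mulz (dot t u) (dot t v))
                        (intRing.mulz (dot t u') (dot t v'))) short_table.

Definition swap_at (x y : pt) (s : seq pt) : bool :=
  swap_vec (cell_comb x s) (cell_comb y (x :: s))
           (cell_comb y s) (cell_comb x (y :: s)).

Lemma eval_dot (t : seq int) (v : lincomb) : eval t v = dot t v.
Proof. by elim: t v => [|a t IH] [|b v] //=; rewrite IH mulrzz. Qed.

Lemma swap_vecP (u v u' v' : lincomb) : swap_vec u v u' v' ->
  forall row, row \in value_table -> let t := short_row row in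
    eval t u * eval t v = eval t u' * eval t v'.
Proof.
move=> + row rin t; rewrite !eval_dot.
case/orP => [/orP[]/andP[/vec_eqbP -> /vec_eqbP ->]|/allP h] //; first exact: mulrC.
by apply/int_eqbP/h/map_f.
Qed.

Lemma swap_vecC (u v u' v' : lincomb) : swap_vec u v u' v' -> swap_vec u' v' u v.
Proof.
have eC a b : vec_eqb a b = vec_eqb b a.
  have iC m n : int_eqb m n = int_eqb n m.
    by case: m n => [m|m] [n|n] //=; rewrite -[LHS]/(m == n) eq_sym.
  by elim: a b => [|m a IH] [|n b] //=; rewrite iC IH.
case/orP => [/orP[]/andP[h1 h2]|/allP h]; rewrite /swap_vec.
- by rewrite eC h1 eC h2.
- by rewrite [vec_eqb u' v]eC h2 [vec_eqb v' u]eC h1 orbT.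
apply/orP; right; apply/allP => t /h /int_eqbP ->.
by case: intRing.mulz => m //=; apply/eqnP.
Qed.

(* Exchanging the coordinates if necessary, only the points [x] and [y] with no
   other point between their first coordinates need to be compared: otherwise
   neither affects the cell of the other. Monotone maps bring [x], [y] to
   abscissae 2, 3 and ordinates 2, 6, and the points adjacent to them to
   abscissae 0, 1, 4, 5 and ordinates in [0 .. 8], 4 being the ordinate of a point
   adjacent to both. *)
Definition tau (p : pt) : pt := (p.2, p.1).
Definition orient (o : bool) (p : pt) : pt := if o then tau p else p.

(** The outer vertical bounds, at ordinate 1 or 7. Abscissa 1 or 4 means that the point is also a
    horizontal neighbour, 0 or 5 that it lies farther out. *)
Definition ends (v : nat) : seq (seq pt) :=
  [::] :: [seq [:: (h, v)] | h <- [:: 0; 1; 4; 5]%N].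
(** Between the two ordinates there is no bound, one point adjacent to both, or two points adjacent
    to one each. *)
Definition middles : seq (seq pt) :=
  [::] :: [seq [:: (h, 4%N)] | h <- [:: 0; 1; 4; 5]%N] ++
    [seq [:: (h, 3%N); (h', 5%N)] | h <- [:: 0; 1; 4; 5]%N, h' <- [:: 0; 1; 4; 5]%N].
(** A horizontal neighbour that is not a vertical one lies beyond an outer vertical bound or between
    the two inner ones. *)
Definition extras (h : nat) : seq (seq pt) :=
  [::] :: [seq [:: (h, v)] | v <- [:: 0; 4; 8]%N].

(** What actual neighbours satisfy: ordinates 0 and 8 occur among [l] and [r] only beyond a bound at
    1 or 7, ordinate 4 only between two inner points; abscissae 0 and 5 need a nearer point at 1 or
    4, and each of 1 and 4 carries at most one point. *)
Definition valid (l r b c t : seq pt) : bool :=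
  let s := l ++ r ++ b ++ c ++ t in
  let single h := all (fun p => if p.1 != h then true
    else all (fun q => (q.1 != h) || (q.2 == p.2)) s) s in
  let present h h' := all (fun p => p.1 != h) s || has (fun p => p.1 == h') s in
  [&& ~~ nilp b || all (fun p => p.2 != 0) (l ++ r),
      ~~ nilp t || all (fun p => p.2 != 8) (l ++ r),
      (size c == 2) || all (fun p => p.2 != 4) (l ++ r),
      present 0 1, present 5 4, single 1 & single 4]%N.

Definition coarse_ok : bool :=
  all (fun b => all (fun c => all (fun t => all (fun l => all (fun r =>
    if ~~ valid l r b c t then true else
    all (fun o => let s := map (orient o) (l ++ r ++ b ++ c ++ t) in
      swap_at (orient o (2, 2)%N) (orient o (3, 6)%N) s &&
      swap_at (orient o (2, 6)%N) (orient o (3, 2)%N) s) [:: false; true])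
  (extras 4)) (extras 1)) (ends 7)) middles) (ends 1).

Lemma coarse_okP : coarse_ok.
Proof. by vm_cast_no_check (erefl true). Qed.

Section StepFunctions.
Local Open Scope nat_scope.

(** On the coordinates that occur, the pair goes to 2 and 3, its neighbours to 1 and 4, and
    everything farther out to 0 and 5. *)
Definition hstep (cx cy : nat) (l r : option nat) (n : nat) : nat :=
  if n < cx then (if l is Some m then (if n < m then 0 else 1) else 0)
  else if n == cx then 2 else if n == cy then 3
  else if r is Some m then (if n <= m then 4 else 5) else 5.

(** The coordinates that can occur: none lies between [cx] and [cy], or between one of them and the
    adjacent outer neighbour. *)
Definition hnice (cx cy : nat) (l r : option nat) (n : nat) : bool :=
  if n < cx then (if l is Some m then n <= m < cx else false)
  else if n == cx then true else if n == cy then true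
  else if r is Some m then cy < m <= n else false.

(** Only coordinates beyond the neighbours are merged, so a comparison survives as soon as one side
    is in the pair or a neighbour; cells see no other comparisons. *)
Lemma hstep_cmp cx cy l r n m : cx < cy -> hnice cx cy l r n -> hnice cx cy l r m ->
  [|| n == cx, n == cy, (n < cx) && (l == Some n) | (cy < n) && (r == Some n)] ->
  ((hstep cx cy l r n < hstep cx cy l r m) = (n < m)) *
  ((hstep cx cy l r m < hstep cx cy l r n) = (m < n)).
Proof.
rewrite /hnice /hstep.
have oE (o : option nat) (k : nat) : (o == Some k) = if o is Some j then eqn j k else false.
  by case: o.
rewrite !oE.
case: (ltngtP n cx) => hn; case: (ltngtP m cx) => hm; case: l => [l|];
  case: r => [r|] //; rewrite ?orbF ?orbT //;
  try (case: (eqVneq n cy) => ?); try (case: (eqVneq m cy) => ?);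
  repeat (case: ifP => ?); rewrite ?eqnE => *; split; lia.
Qed.

(** On the coordinates that occur, 2 and 6 are the pair, 1 and 7 the outer neighbours, 0 and 8 what
    lies beyond them, 3 and 5 two distinct inner neighbours; 4 is a common inner neighbour or
    whatever lies between two distinct ones. *)
Definition vstep (lo hi : nat) (b tl bh t : option nat) (n : nat) : nat :=
  if n < lo then (if b is Some m then (if n < m then 0 else 1) else 0)
  else if n == lo then 2
  else if n < hi then
    (if tl is Some u then if bh is Some v then
       if u == v then 4 else if n <= u then 3 else if n < v then 4 else 5
     else 4 else 4)
  else if n == hi then 6
  else if t is Some m then (if n <= m then 7 else 8) else 8.

Definition vnice (lo hi : nat) (b tl bh t : option nat) (n : nat) : bool :=
  if n < lo then (if b is Some m then n <= m < lo else false)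
  else if n == lo then true
  else if n < hi then
    (if tl is Some u then if bh is Some v then
      [&& lo < u, u <= n, n <= v & v < hi] else false else false)
  else if n == hi then true
  else if t is Some m then hi < m <= n else false.

Definition vmark (lo hi : nat) (b tl bh t : option nat) (n : nat) : bool :=
  [|| n == lo, n == hi, (n < lo) && (b == Some n), (hi < n) && (t == Some n) |
    (lo < n < hi) && ((tl == Some n) || (bh == Some n))].

Lemma vstep_lt lo hi b tl bh t n m : lo < hi -> n < m ->
  vnice lo hi b tl bh t n -> vnice lo hi b tl bh t m ->
  vmark lo hi b tl bh t n || vmark lo hi b tl bh t m ->
  vstep lo hi b tl bh t n < vstep lo hi b tl bh t m.
Proof.
have oE (o : option nat) (k : nat) : (o == Some k) = if o is Some j then eqn j k else false.
  by case: o.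
rewrite /vnice /vstep /vmark !oE => lohi nm.
case: (ltngtP n lo) => hn.
- case: (ltngtP m lo) => hm.
  + by case: b => [b|] //; case: t => [t|] //=; repeat (case: ifP => ?);
      rewrite ?eqnE; lia.
  + case: b => [b|] // ; case: (ltngtP m hi) => hm'; case: tl => [tl|] //;
      case: bh => [bh|] //; case: t => [t|] //; repeat (case: ifP => ?) => //.
  + by case: b => [b|] //; case: ifP.
- have hm : lo < m by apply: ltn_trans nm.
  rewrite (ltnNge m) (ltnW hm) /= (gtn_eqF hm).
  case: (ltngtP n hi) => hn'.
  + case: tl => [tl|] //; case: bh => [bh|] //.
    case: (ltngtP m hi) => hm'; last 2 first.
    * by case: t => [t|] //; repeat (case: ifP => ?).
    * by repeat (case: ifP => ?).
    by case: eqP => [->|_]; repeat (case: ifP => ?); rewrite ?eqnE; lia.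
  + have hm' : hi < m by apply: ltn_trans nm.
    rewrite (ltnNge m) (ltnW hm') /= (gtn_eqF hm'); case: t => [t|] //.
    by case: ifP => ?; case: ifP => ?; rewrite ?eqnE; lia.
  + have hm' : hi < m by rewrite -hn'.
    by rewrite (ltnNge m) (ltnW hm') /= (gtn_eqF hm'); case: t => [t|] //; case: ifP.
- have hm : lo < m by rewrite -hn.
  rewrite (ltnNge m) (ltnW hm) /= (gtn_eqF hm).
  case: (ltngtP m hi) => hm' //; last by case: t => [t|] //; case: ifP.
  by case: tl => [tl|] //; case: bh => [bh|] //; repeat (case: ifP => ?).
Qed.

Lemma vstep_cmp lo hi b tl bh t n m : lo < hi -> vnice lo hi b tl bh t n ->
  vnice lo hi b tl bh t m -> vmark lo hi b tl bh t n ->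
  ((vstep lo hi b tl bh t n < vstep lo hi b tl bh t m) = (n < m)) *
  ((vstep lo hi b tl bh t m < vstep lo hi b tl bh t n) = (m < n)).
Proof.
move=> lohi nn nm mn; case: (ltngtP n m) => [h|h|<-]; last by rewrite ltnn.
  have lt := vstep_lt lohi h nn nm; rewrite mn in lt.
  by rewrite !(lt_pair (lt isT)).
have lt := vstep_lt lohi h nm nn; rewrite mn orbT in lt.
by rewrite !(lt_pair (lt isT)).
Qed.

End StepFunctions.

Definition axis (r : rel pt) : Prop :=
  [\/ r = to_left, r = to_right, r = below | r = above].

Lemma axis_dir (r : rel pt) : axis r -> direction r.
Proof.
by case=> ->; [exact: to_left_dir|exact: to_right_dir|exact: below_dir|exact: above_dir].
Qed.

Lemma nbr_nbrs (r : rel pt) (x p : pt) (s : seq pt) : axis r ->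
  nbr r x s = Some p -> p \in nbrs x s.
Proof. by case=> -> E; rewrite mem_nbrs E eqxx ?orbT. Qed.

(** In each direction, the combination uses only comparisons that involve [x] or its neighbour in
    that direction, so other points may be merged. *)
Lemma cell_comb_coarse (phi : pt -> pt) (x : pt) (s u s' : seq pt) : gen (x :: s) ->
  {subset u <= s} -> {subset nbrs x s <= u} -> s' =i map phi u ->
  (forall r p q, axis r -> q \in u -> p = x \/ nbr r x s = Some p ->
    (r (phi p) (phi q) = r p q) /\ (r (phi q) (phi p) = r q p)) ->
  cell_comb (phi x) s' = cell_comb x s.
Proof.
move=> g us nu s'E faith.
have gs := gen_cons g.
have trans r : axis r -> nbr r (phi x) s' = omap phi (nbr r x s).
  move=> ri; have dr := axis_dir ri; apply: nbr_transfer => // [p E|q].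
    have pu := nu _ (nbr_nbrs ri E); split; first by rewrite s'E map_f.
    by have [-> _] := faith r x p ri pu (or_introl erefl); apply: nbr_rel E.
  rewrite s'E => /mapP[q' qu ->].
  have [-> _] := faith r x q' ri qu (or_introl erefl) => xq.
  case E: (nbr r x s) => [p|]; last by rewrite (nbr_none E (us _ qu)) in xq.
  exists p => //; have [_ _ h] := (nbrP dr x p gs).1 E.
  have [->|pq] := h _ (us _ qu) xq; [by left|right].
  by have [-> _] := faith r p q' ri qu (or_intror E).
have cor (w : corner_weights) ri rj : axis ri -> axis rj ->
    corner w ri rj (omap phi (nbr ri x s)) (omap phi (nbr rj x s)) =
    corner w ri rj (nbr ri x s) (nbr rj x s).
  move=> ii jj; apply: corner_map => h v Eh Ev.
  have hu := nu _ (nbr_nbrs ii Eh); have vu := nu _ (nbr_nbrs jj Ev).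
  have [e1 e2] := faith ri h v ii vu (or_intror Eh).
  have [e3 e4] := faith rj v h jj hu (or_intror Ev).
  split=> //; apply/eqP/eqP => [e|->//].
  case: (axis_dir ii) => rI _ /(_ s gs h v (us _ hu) (us _ vu)) tot.
  by apply/eqP/negPn/negP => /tot; rewrite -e1 -e2 e rI.
have [al ar ab aa] : [/\ axis to_left, axis to_right, axis below & axis above].
  by split; [apply: Or41|apply: Or42|apply: Or43|apply: Or44].
by rewrite /cell_comb !trans // !cor.
Qed.

Lemma orientK (o : bool) (p : pt) : orient o (orient o p) = p.
Proof. by case: o p => -[]. Qed.

(** * Swapping two points adjacent along one axis *)

Section SwapGeometry.
Variables (o : bool) (x y lo hi : pt) (s : seq pt).
Hypotheses (g : gen (x :: y :: s)) (xys : x \notin y :: s) (ys : y \notin s).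

Let c1 (p : pt) : nat := (orient o p).1.
Let c2 (p : pt) : nat := (orient o p).2.
Let rl : rel pt := if o then below else to_left.
Let rr : rel pt := if o then above else to_right.
Let rd : rel pt := if o then to_left else below.
Let ru : rel pt := if o then to_right else above.

Hypothesis xy : (c1 x < c1 y)%N.
Hypothesis adj : forall q, q \in s -> ~~ (c1 x < c1 q < c1 y)%N.
Hypothesis lohi : (c2 lo < c2 hi)%N.
Hypothesis lohiE : (lo, hi) = (x, y) \/ (lo, hi) = (y, x).

Let rlE p q : rl p q = (c1 q < c1 p)%N.
Proof. by rewrite /rl /c1; case: (o). Qed.
Let rrE p q : rr p q = (c1 p < c1 q)%N.
Proof. by rewrite /rr /c1; case: (o). Qed.
Let rdE p q : rd p q = (c2 q < c2 p)%N.
Proof. by rewrite /rd /c2; case: (o). Qed.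
Let ruE p q : ru p q = (c2 p < c2 q)%N.
Proof. by rewrite /ru /c2; case: (o). Qed.

Let arl : axis rl. Proof. by rewrite /rl; case: (o); [apply: Or43|apply: Or41]. Qed.
Let arr : axis rr. Proof. by rewrite /rr; case: (o); [apply: Or44|apply: Or42]. Qed.
Let ard : axis rd. Proof. by rewrite /rd; case: (o); [apply: Or41|apply: Or43]. Qed.
Let aru : axis ru. Proof. by rewrite /ru; case: (o); [apply: Or42|apply: Or44]. Qed.

Let axisE r : axis r -> [\/ r = rl, r = rr, r = rd | r = ru].
Proof.
by rewrite /rl /rr /rd /ru; case: (o) => -[]->;
  do ?[exact: Or41|exact: Or42|exact: Or43|exact: Or44].
Qed.

Let inj1 p q : p \in x :: y :: s -> q \in x :: y :: s -> c1 p = c1 q -> p = q.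
Proof. by rewrite /c1; case: (o) => *; [apply: (proj2 g)|apply: (proj1 g)]. Qed.
Let inj2 p q : p \in x :: y :: s -> q \in x :: y :: s -> c2 p = c2 q -> p = q.
Proof. by rewrite /c2; case: (o) => *; [apply: (proj1 g)|apply: (proj2 g)]. Qed.

Let gs : gen s. Proof. exact: gen_cons (gen_cons g). Qed.
Let xi : x \in x :: y :: s. Proof. exact: mem_head. Qed.
Let yi : y \in x :: y :: s. Proof. by rewrite !inE eqxx orbT. Qed.
Let si q : q \in s -> q \in x :: y :: s. Proof. by rewrite !inE => ->; rewrite !orbT. Qed.
Let loi : lo \in x :: y :: s. Proof. by case: lohiE => -[-> _]. Qed.
Let hii : hi \in x :: y :: s. Proof. by case: lohiE => -[_ ->]. Qed.
Let ns q : q \in s -> [/\ q <> x, q <> y, q <> lo & q <> hi].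
Proof.
move=> qs; have nx : q <> x by move=> e; case/negP: xys; rewrite -e inE qs orbT.
have ny : q <> y by move=> e; case/negP: ys; rewrite -e.
by case: lohiE => -[-> ->].
Qed.

Let L := nbr rl x s.
Let R := nbr rr y s.
Let Bl := nbr rd lo s.
Let Tl := nbr ru lo s.
Let Bh := nbr rd hi s.
Let Th := nbr ru hi s.

Let below_max r c u p q : axis r -> (forall a b, r a b = (c b < c a)%N) ->
  nbr r u s = Some p -> q \in s -> (c q < c u)%N -> (c q <= c p < c u)%N.
Proof.
move=> ar rE E qs qu; have [ps up h] := (nbrP (axis_dir ar) u p gs).1 E.
rewrite rE in up; rewrite up andbT.
by have [|->//|] := h q qs; rewrite rE // => /ltnW.
Qed.

Let above_min r c u p q : axis r -> (forall a b, r a b = (c a < c b)%N) ->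
  nbr r u s = Some p -> q \in s -> (c u < c q)%N -> (c u < c p <= c q)%N.
Proof.
move=> ar rE E qs qu; have [ps up h] := (nbrP (axis_dir ar) u p gs).1 E.
rewrite rE in up; rewrite up /=.
by have [|->//|] := h q qs; rewrite rE // => /ltnW.
Qed.

Let hs := hstep (c1 x) (c1 y) (omap c1 L) (omap c1 R).
Let vs := vstep (c2 lo) (c2 hi) (omap c2 Bl) (omap c2 Tl) (omap c2 Bh) (omap c2 Th).

Let hn q : q \in x :: y :: s ->
  hnice (c1 x) (c1 y) (omap c1 L) (omap c1 R) (c1 q).
Proof.
rewrite !inE => /or3P[/eqP->|/eqP->|qs]; rewrite /hnice ?ltnn ?eqxx //.
  by rewrite ltnNge (ltnW xy) /= (gtn_eqF xy).
case: (ltngtP (c1 q) (c1 x)) => // qx.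
  case E: L => [p|] /=; last by have := nbr_none E qs; rewrite rlE qx.
  exact: (below_max arl rlE E).
case: (ltngtP (c1 q) (c1 y)) => // qy.
  by have := adj qs; rewrite qx qy.
case E: R => [p|] /=; last by have := nbr_none E qs; rewrite rrE qy.
exact: (above_min arr rrE E).
Qed.

Let vn q : q \in x :: y :: s ->
  vnice (c2 lo) (c2 hi) (omap c2 Bl) (omap c2 Tl) (omap c2 Bh) (omap c2 Th) (c2 q).
Proof.
rewrite !inE => q3; have : [\/ q = lo, q = hi | q \in s].
  case/or3P: q3 => [/eqP->|/eqP->|qs]; last by apply: Or33.
    by case: lohiE => -[-> ->]; [apply: Or31|apply: Or32].
  by case: lohiE => -[-> ->]; [apply: Or32|apply: Or31].
case=> [->|->|qs]; rewrite /vnice ?ltnn ?eqxx //.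
  by rewrite ltnNge (ltnW lohi) /= (gtn_eqF lohi).
case: (ltngtP (c2 q) (c2 lo)) => // ql.
  case E: Bl => [p|] /=; last by have := nbr_none E qs; rewrite rdE ql.
  exact: (below_max ard rdE E).
case: (ltngtP (c2 q) (c2 hi)) => // qh.
  case E: Tl => [p|] /=; last by have := nbr_none E qs; rewrite ruE ql.
  case E': Bh => [p'|] /=; last by have := nbr_none E' qs; rewrite rdE qh.
  have /andP[-> ->] := above_min aru ruE E qs ql.
  by have /andP[-> ->] := below_max ard rdE E' qs qh.
case E: Th => [p|] /=; last by have := nbr_none E qs; rewrite ruE qh.
exact: (above_min aru ruE E).
Qed.

Let hmark p := [\/ p = x, p = y, L = Some p | R = Some p].
Let vmarkp p := [\/ p = lo \/ p = hi, Bl = Some p, Th = Some p | Tl = Some p \/ Bh = Some p].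

Let Ls p : L = Some p -> p \in s /\ (c1 p < c1 x)%N.
Proof. by move=> E; rewrite -rlE (nbr_mem E) (nbr_rel E). Qed.
Let Rs p : R = Some p -> p \in s /\ (c1 y < c1 p)%N.
Proof. by move=> E; rewrite -rrE (nbr_mem E) (nbr_rel E). Qed.
Let Bls p : Bl = Some p -> p \in s /\ (c2 p < c2 lo)%N.
Proof. by move=> E; rewrite -rdE (nbr_mem E) (nbr_rel E). Qed.
Let Tls p : Tl = Some p -> p \in s /\ (c2 lo < c2 p)%N.
Proof. by move=> E; rewrite -ruE (nbr_mem E) (nbr_rel E). Qed.
Let Bhs p : Bh = Some p -> p \in s /\ (c2 p < c2 hi)%N.
Proof. by move=> E; rewrite -rdE (nbr_mem E) (nbr_rel E). Qed.
Let Ths p : Th = Some p -> p \in s /\ (c2 hi < c2 p)%N.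
Proof. by move=> E; rewrite -ruE (nbr_mem E) (nbr_rel E). Qed.

(* A point next to one of [lo], [hi] on the side of the other one lies either
   between them or on the far side of the latter, where it is next to it. *)
Let Tl_far p : Tl = Some p -> (c2 hi < c2 p)%N -> Th = Some p.
Proof.
move=> E hp; have [ps _ h] := (nbrP (axis_dir aru) lo p gs).1 E.
apply/(nbrP (axis_dir aru)) => //; split=> // [|q qs]; first by rewrite ruE.
by rewrite ruE => hq; apply: h => //; rewrite ruE (ltn_trans lohi hq).
Qed.

Let Bh_far p : Bh = Some p -> (c2 p < c2 lo)%N -> Bl = Some p.
Proof.
move=> E hp; have [ps _ h] := (nbrP (axis_dir ard) hi p gs).1 E.
apply/(nbrP (axis_dir ard)) => //; split=> // [|q qs]; first by rewrite rdE.
by rewrite rdE => hq; apply: h => //; rewrite rdE (ltn_trans hq lohi).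
Qed.

Let ne2 p : p \in s -> (c2 p != c2 lo) /\ (c2 p != c2 hi).
Proof.
move=> ps; have [_ _ nl nh] := ns ps.
by split; apply/eqP => /inj2 e; [apply: nl|apply: nh]; apply: e => //; apply: si.
Qed.

Let ne1 p : p \in s -> (c1 p != c1 x) /\ (c1 p != c1 y).
Proof.
move=> ps; have [nx ny _ _] := ns ps.
by split; apply/eqP => /inj1 e; [apply: nx|apply: ny]; apply: e => //; apply: si.
Qed.

Let hcmp p q : hmark p -> q \in x :: y :: s ->
  ((hs (c1 p) < hs (c1 q))%N = (c1 p < c1 q)%N) *
  ((hs (c1 q) < hs (c1 p))%N = (c1 q < c1 p)%N).
Proof.
move=> hp qi.
have pi : p \in x :: y :: s by case: hp => [->|->|/Ls[/si]|/Rs[/si]].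
apply: hstep_cmp => //; [exact: hn|exact: hn|].
case: hp => [->|->|E|E]; rewrite ?eqxx ?orbT //.
  by have [_ ->] := Ls E; rewrite E eqxx !orbT.
by have [_ ->] := Rs E; rewrite E eqxx !orbT.
Qed.

Let vcmp p q : vmarkp p -> q \in x :: y :: s ->
  ((vs (c2 p) < vs (c2 q))%N = (c2 p < c2 q)%N) *
  ((vs (c2 q) < vs (c2 p))%N = (c2 q < c2 p)%N).
Proof.
move=> hp qi.
have pi : p \in x :: y :: s.
  by case: hp => [[->|->]|/Bls[/si]|/Ths[/si]|[/Tls[/si]|/Bhs[/si]]].
apply: vstep_cmp => //; [exact: vn|exact: vn|]; rewrite /vmark.
case: hp => [[->|->]|E|E|[E|E]]; rewrite ?eqxx ?orbT //.
- by have [_ ->] := Bls E; rewrite E eqxx !orbT.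
- by have [_ ->] := Ths E; rewrite E eqxx !orbT.
- have [ps lt] := Tls E; case: (ltngtP (c2 p) (c2 hi)) => hp; last 2 first.
  + by rewrite (Tl_far E hp) eqxx !orbT.
  + by rewrite orbT.
  by rewrite lt E eqxx !orbT.
- have [ps lt] := Bhs E; case: (ltngtP (c2 p) (c2 lo)) => hp; last 2 first.
  + by rewrite lt E eqxx !orbT.
  + by [].
  by rewrite (Bh_far E hp) eqxx !orbT.
Qed.

Let psi (p : pt) : pt := (hs (c1 p), vs (c2 p)).
Let phi (p : pt) : pt := orient o (psi p).
Let u := pmap id [:: L; R; Bl; Th; Tl; Bh].

Let phi1 p : c1 (phi p) = hs (c1 p). Proof. by rewrite {1}/c1 /phi orientK. Qed.
Let phi2 p : c2 (phi p) = vs (c2 p). Proof. by rewrite {1}/c2 /phi orientK. Qed.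

Let mem_u p : (p \in u) = [|| L == Some p, R == Some p, Bl == Some p, Th == Some p,
  Tl == Some p | Bh == Some p].
Proof. by rewrite mem_pmap map_id !inE !(eq_sym (Some p)). Qed.

Let us : {subset u <= s}.
Proof. by move=> p; rewrite mem_u => /or4P[||| /or3P[]] /eqP/nbr_mem. Qed.

(** No point of [s] lies between [x] and [y] along the first axis, so they have the same neighbours
    in [s] there; hence six neighbours suffice for both cells. *)
Let Ly p : nbr rl y s = Some p -> L = Some p.
Proof.
rewrite /L /nbr; congr (nearest _ _ = _); apply: eq_in_filter => q qs.
rewrite !rlE; case: (ltngtP (c1 q) (c1 x)) => [lt|lt|e].
- by rewrite (ltn_trans lt xy).
- by have := adj qs; rewrite lt /= => /negbTE.
- by have [/eqP] := ne1 qs.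
Qed.

Let Rx p : nbr rr x s = Some p -> R = Some p.
Proof.
rewrite /R /nbr; congr (nearest _ _ = _); apply: eq_in_filter => q qs.
rewrite !rrE; case: (ltngtP (c1 y) (c1 q)) => [lt|lt|e].
- by rewrite (ltn_trans xy lt).
- by have := adj qs; rewrite lt andbT => /negbTE.
- by case: (ne1 qs); rewrite e eqxx.
Qed.

Let nbr_cons r a b p : axis r -> nbr r a (b :: s) = Some p ->
  gen (b :: s) -> p = b \/ nbr r a s = Some p.
Proof.
move=> ar E gb; have [ps ap h] := (nbrP (axis_dir ar) a p gb).1 E.
move: ps; rewrite inE => /orP[/eqP->|ps]; [by left|right].
apply/(nbrP (axis_dir ar)) => //; split=> // q qs; apply: h.
by rewrite inE qs orbT.
Qed.

(** Treats the four cells of the swap relation at once: [t] is [s], or [s] with the other point of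
    the pair added. *)
Let cell_phi a t : (a = x \/ a = y) -> gen (a :: t) ->
  t = s \/ (exists b, [/\ t = b :: s, b = x \/ b = y & a <> b]) ->
  forall w, w =i map phi ([seq b <- t | b \notin s] ++ u) ->
  cell_comb (phi a) w = cell_comb a t.
Proof.
move=> axy ga tE w wE; have gt := gen_cons ga.
have tb q : q \in t -> q \in s \/ q = x \/ q = y.
  case: tE => [->|[b [-> bxy _]]]; first by move=> ?; left.
  by rewrite inE => /orP[/eqP->|?]; [right|left].
have st q : q \in s -> q \in t.
  by case: tE => [->|[b [-> _ _]]] //; rewrite inE => ->; rewrite orbT.
have ti q : q \in t -> q \in x :: y :: s by move=> /tb[/si|[->|->]].
have nb r p : axis r -> nbr r a t = Some p ->
    (p = x \/ p = y) \/ nbr r a s = Some p.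
  move=> ar; case: tE => [->|[b [tE bxy _]]] E; first by right.
  rewrite tE in E gt; have [->|] := nbr_cons ar E gt; first by left.
  by right.
have hmk r p : r = rl \/ r = rr -> nbr r a t = Some p -> hmark p.
  move=> rE E; have ar : axis r by case: rE => ->.
  case: (nb r p ar E) => [[->|->]|{}E]; [exact: Or41|exact: Or42|].
  case: rE E => ->; case: axy => ->; [|move/Ly|move/Rx|] => E;
    by [apply: Or43|apply: Or44].
have vmk r p : r = rd \/ r = ru -> nbr r a t = Some p -> vmarkp p.
  move=> rE E; have ar : axis r by case: rE => ->.
  have xlo v : v = x \/ v = y -> v = lo \/ v = hi.
    by case: lohiE => -[-> ->] [->|->]; [left|right|right|left].
  case: (nb r p ar E) => [/xlo pE|{}E]; first exact: Or41.
  by case: rE E => ->; case: (xlo _ axy) => -> E;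
    [apply: Or42|apply: Or44; right|apply: Or44; left|apply: Or43].
have sub : {subset [seq b <- t | b \notin s] ++ u <= t}.
  by move=> q; rewrite mem_cat mem_filter => /orP[/andP[]//|/us/st].
apply: (@cell_comb_coarse phi a t ([seq b <- t | b \notin s] ++ u)) => // [q qn|r p q ar qu pE].
  have [qs|qs] := boolP (q \in s); last by rewrite mem_cat mem_filter qs (nbrs_sub qn).
  rewrite mem_cat; apply/orP; right; rewrite mem_u.
  move: qn; rewrite mem_nbrs.
  have nbs r : axis r -> nbr r a t == Some q -> q \in u.
    move=> ar /eqP E; have [qx qy _ _] := ns qs.
    case: (nb r q ar E) => [[//|//]|{}E]; rewrite mem_u.
    by case: (axisE ar) E => ->; case: axy => ->;
      (try (move/Ly)); (try (move/Rx));
      rewrite /L /R /Bl /Th /Tl /Bh; case: lohiE => -[-> ->] ->; rewrite eqxx ?orbT.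
  by rewrite -mem_u => /or4P[]; apply: nbs; [exact: Or41|exact: Or42|exact: Or43|exact: Or44].
have qi : q \in x :: y :: s by apply/ti/sub.
have ah : a = x \/ a = y -> hmark a by case=> ->; [apply: Or41|apply: Or42].
have av : a = x \/ a = y -> vmarkp a.
  by case=> ->; apply: Or41; case: lohiE => -[-> ->]; [left|right|right|left].
case: (axisE ar) => rE; rewrite rE in pE *.
- have hp : hmark p by case: pE => [->|]; [apply: ah|apply: hmk; left].
  by rewrite !rlE !phi1 !(hcmp hp qi).
- have hp : hmark p by case: pE => [->|]; [apply: ah|apply: hmk; right].
  by rewrite !rrE !phi1 !(hcmp hp qi).
- have hp : vmarkp p by case: pE => [->|]; [apply: av|apply: vmk; left].
  by rewrite !rdE !phi2 !(vcmp hp qi).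
- have hp : vmarkp p by case: pE => [->|]; [apply: av|apply: vmk; right].
  by rewrite !ruE !phi2 !(vcmp hp qi).
Qed.

Let inL p : L = Some p -> p \in u. Proof. by rewrite mem_u => ->; rewrite eqxx. Qed.
Let inR p : R = Some p -> p \in u. Proof. by rewrite mem_u => ->; rewrite eqxx ?orbT. Qed.
Let inBl p : Bl = Some p -> p \in u. Proof. by rewrite mem_u => ->; rewrite eqxx ?orbT. Qed.
Let inTh p : Th = Some p -> p \in u. Proof. by rewrite mem_u => ->; rewrite eqxx ?orbT. Qed.
Let inTl p : Tl = Some p -> p \in u. Proof. by rewrite mem_u => ->; rewrite eqxx ?orbT. Qed.
Let inBh p : Bh = Some p -> p \in u. Proof. by rewrite mem_u => ->; rewrite eqxx ?orbT. Qed.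

Let hs_L p : L = Some p -> hs (c1 p) = 1%N.
Proof. by move=> E; have [_ lt] := Ls E; rewrite /hs /hstep lt E /= ltnn. Qed.

Let hs_R p : R = Some p -> hs (c1 p) = 4%N.
Proof.
move=> E; have [_ lt] := Rs E; have xp := ltn_trans xy lt.
by rewrite /hs /hstep ltnNge (ltnW xp) /= (gtn_eqF xp) (gtn_eqF lt) E /= leqnn.
Qed.

Let vs_Bl p : Bl = Some p -> vs (c2 p) = 1%N.
Proof. by move=> E; have [_ lt] := Bls E; rewrite /vs /vstep lt E /= ltnn. Qed.

Let vs_Th p : Th = Some p -> vs (c2 p) = 7%N.
Proof.
move=> E; have [_ lt] := Ths E; have xp := ltn_trans lohi lt.
rewrite /vs /vstep ltnNge (ltnW xp) /= (gtn_eqF xp) ltnNge (ltnW lt) /= (gtn_eqF lt).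
by rewrite E /= leqnn.
Qed.

Let hs_far p : p \in s -> [\/ hs (c1 p) = 0%N, L = Some p, R = Some p | hs (c1 p) = 5%N].
Proof.
move=> ps; have pi := si ps; have := hn pi; rewrite /hnice /hs /hstep.
have [n1 n2] := ne1 ps; rewrite (negbTE n1) (negbTE n2).
case: ifP => lt.
  case E: L => [q|] //= /andP[pq _]; case: ifP => [_|/negbT]; first exact: Or41.
  rewrite -leqNgt => qp; have qi := si (Ls E).1.
  by apply: Or42; rewrite (inj1 pi qi) //; apply/eqP; rewrite eqn_leq pq qp.
case E: R => [q|] //= /andP[_ qp]; case: ifP => [pq|_]; last exact: Or44.
have qi := si (Rs E).1.
by apply: Or43; rewrite (inj1 pi qi) //; apply/eqP; rewrite eqn_leq pq qp.
Qed.

Let hs_side p : p \in s -> hs (c1 p) \in [:: 0; 1; 4; 5]%N.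
Proof. by case/hs_far => [->|/hs_L->|/hs_R->|->]. Qed.

Let vert : seq (option pt) := [:: Bl; Th; Tl; Bh].

Let eq2 p q : p \in s -> q \in s -> (c2 p <= c2 q)%N -> (c2 q <= c2 p)%N -> p = q.
Proof.
by move=> ps qs pq qp; apply: inj2 (si ps) (si qs) _; apply/eqP; rewrite eqn_leq pq qp.
Qed.

(** A point that is not a vertical neighbour has a neighbour in front of it. Between [lo] and [hi]
    it has one on each side, so the two inner neighbours differ. *)
Let vs_gap p : p \in s -> Some p \notin vert ->
  [\/ vs (c2 p) = 0%N /\ Bl <> None, vs (c2 p) = 8%N /\ Th <> None |
    vs (c2 p) = 4%N /\ exists a b, [/\ Tl = Some a, Bh = Some b, (c2 a < c2 hi)%N & a <> b]].
Proof.
rewrite !inE !negb_or => ps /and4P[nBl nTh nTl nBh]; have := vn (si ps).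
rewrite /vnice /vs /vstep; have [n1 n2] := ne2 ps; rewrite (negbTE n1) (negbTE n2).
case: ifP => lt.
  case E: Bl nBl => [q|] //= nBl /andP[pq _]; case: ifP => [_|/negbT]; first exact: Or31.
  rewrite -leqNgt => qp; case/negP: nBl; apply/eqP; congr Some.
  exact: eq2 ps (Bls E).1 pq qp.
case: ifP => lt'.
  case E: Tl nTl => [a|] //; case E': Bh nBh => [b|] //= nBh nTl /and4P[la ap pb bh].
  have na : a <> p by move=> e; case/negP: nTl; rewrite e.
  have nb : b <> p by move=> e; case/negP: nBh; rewrite e.
  have [as' bs] := ((Tls E).1, (Bhs E').1).
  have ab : a <> b by move=> e; apply: na; apply: eq2 => //; rewrite e.
  have -> : (c2 a == c2 b) = false by apply/eqP => /inj2 e; apply: ab; apply: e; apply: si.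
  have -> : (c2 p <= c2 a)%N = false by apply/negP => pa; apply: na; apply: eq2.
  have -> : (c2 p < c2 b)%N.
    by rewrite ltnNge; apply/negP => bp; apply: nb; apply: eq2.
  apply: Or33; split=> //; exists a, b; split=> //.
  exact: leq_ltn_trans ap lt'.
case E: Th nTh => [q|] //= nTh /andP[_ qp]; case: ifP => [pq|_]; last exact: Or32.
case/negP: nTh; apply/eqP; congr Some; exact: eq2 ps (Ths E).1 pq qp.
Qed.

(** A horizontal neighbour that is also a vertical one is skipped here, since [end_pts] or [mid_pts]
    lists it. *)
Let near (h : nat) (q : option pt) : seq pt :=
  if q is Some p then if Some p \in vert then [::] else [:: (h, vs (c2 p))] else [::].
Let end_pts (v : nat) (q : option pt) : seq pt :=
  if q is Some p then [:: (hs (c1 p), v)] else [::].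
Let mid_pts : seq pt :=
  if Tl is Some p then if Bh is Some q then
    if (c2 p < c2 hi)%N then
      if p == q then [:: (hs (c1 p), 4%N)] else [:: (hs (c1 p), 3%N); (hs (c1 q), 5%N)]
    else [::] else [::] else [::].

Let near_ext h q : (forall p, q = Some p -> p \in s) -> near h q \in extras h.
Proof.
case: q => [p|] // /(_ p erefl) ps; rewrite /near; case: ifPn => // np.
by case: (vs_gap ps np) => -[-> _]; rewrite !inE eqxx ?orbT.
Qed.

Let end_in v q : (forall p, q = Some p -> p \in s) -> end_pts v q \in ends v.
Proof.
case: q => [p|] // /(_ p erefl) /hs_side hp; rewrite /end_pts /ends inE; apply/orP; right.
by apply/mapP; exists (hs (c1 p)).
Qed.

Let mid_in : mid_pts \in middles.
Proof.
rewrite /mid_pts /middles; case E: Tl => [p|]; last exact: mem_head.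
case E': Bh => [q|]; last exact: mem_head.
have [hp hq] := (hs_side (Tls E).1, hs_side (Bhs E').1).
case: ifP => _; last exact: mem_head.
rewrite inE; apply/orP; right; rewrite mem_cat; apply/orP.
case: ifP => _; [left|right].
  by apply/mapP; exists (hs (c1 p)).
by apply/allpairsP; exists (hs (c1 p), hs (c1 q)).
Qed.

Let vs_mid p q : Tl = Some p -> Bh = Some q -> (c2 p < c2 hi)%N ->
  if p == q then vs (c2 p) = 4%N else vs (c2 p) = 3%N /\ vs (c2 q) = 5%N.
Proof.
move=> E E' ph; have [ps lp] := Tls E; have [qs hq] := Bhs E'.
have /andP[pq _] := below_max ard rdE E' ps ph.
have lq := leq_trans lp pq.
rewrite /vs /vstep E E' /= !(ltnNge _ (c2 lo)) (ltnW lp) (ltnW lq) /= (gtn_eqF lp) (gtn_eqF lq).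
rewrite ph hq leqnn; case: eqP => [->|npq]; first by rewrite eqxx.
have -> : (c2 p == c2 q) = false by apply/eqP => /inj2 e; apply: npq; apply: e; apply: si.
have -> : (c2 q <= c2 p)%N = false by apply/negP => qp; apply: npq; apply: eq2.
by rewrite ltnn.
Qed.

Let pts := near 1 L ++ near 4 R ++ end_pts 1 Bl ++ mid_pts ++ end_pts 7 Th.

Let pts_psi : pts =i map psi u.
Proof.
have inV p : Some p \in vert -> psi p \in end_pts 1 Bl ++ mid_pts ++ end_pts 7 Th.
  have inB q : Bl = Some q -> psi q \in end_pts 1 Bl.
    by move=> E; rewrite E mem_seq1 /psi (vs_Bl E).
  have inT q : Th = Some q -> psi q \in end_pts 7 Th.
    by move=> E; rewrite E mem_seq1 /psi (vs_Th E).
  rewrite !mem_cat !inE => /or4P[]/eqP/esym E.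
  - by rewrite inB.
  - by rewrite inT ?orbT.
  - have [ps lp] := Tls E; case: (ltngtP (c2 p) (c2 hi)) => ph.
    + case E': Bh => [q|]; last by have := nbr_none E' ps; rewrite rdE ph.
      rewrite /mid_pts E E' ph /psi; have := vs_mid E E' ph.
      by case: eqP => _ => [->|[-> _]]; rewrite mem_head ?orbT.
    + by rewrite (inT _ (Tl_far E ph)) !orbT.
    + by have [_] := ne2 ps; rewrite ph eqxx.
  - have [ps hp] := Bhs E; case: (ltngtP (c2 p) (c2 lo)) => lp.
    + by rewrite (inB _ (Bh_far E lp)).
    + case E': Tl => [q|]; last by have := nbr_none E' ps; rewrite ruE lp.
      have /andP[_ qp] := above_min aru ruE E' ps lp.
      have qh := leq_ltn_trans qp hp.
      rewrite /mid_pts E E' qh /psi; have := vs_mid E' E qh.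
      by case: eqP => [->->|_ [_ ->]]; rewrite ?mem_head ?orbT // !inE eqxx !orbT.
    + by have [] := ne2 ps; rewrite lp eqxx.
have inN h p q : q = Some p -> hs (c1 p) = h ->
      psi p \in near h q ++ end_pts 1 Bl ++ mid_pts ++ end_pts 7 Th.
  move=> -> hp; rewrite mem_cat /near; case: ifPn => [/inV->|_]; first by rewrite orbT.
  by rewrite /psi hp mem_head.
move=> p; apply/idP/mapP => [|[q]].
  rewrite !mem_cat => /or4P[||| /orP[]].
  - rewrite /near; case E: L => [q|] //; case: ifP => // _; rewrite inE => /eqP->.
    by exists q; [apply: inL|rewrite /psi (hs_L E)].
  - rewrite /near; case E: R => [q|] //; case: ifP => // _; rewrite inE => /eqP->.
    by exists q; [apply: inR|rewrite /psi (hs_R E)].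
  - case E: Bl => [q|] //; rewrite inE => /eqP->.
    by exists q; [apply: inBl|rewrite /psi (vs_Bl E)].
  - rewrite /mid_pts; case E: Tl => [a|] //; case E': Bh => [b|] //.
    case: ifP => // ah; have := vs_mid E E' ah; case: eqP => [_ va|_ [va vb]].
      by rewrite inE => /eqP->; exists a; [apply: inTl|rewrite /psi va].
    rewrite !inE => /orP[]/eqP->; [exists a|exists b];
      rewrite ?(inTl E) ?(inBh E') // /psi ?va ?vb //.
  - case E: Th => [q|] //; rewrite inE => /eqP->.
    by exists q; [apply: inTh|rewrite /psi (vs_Th E)].
rewrite mem_u => qu ->; rewrite /pts; case/or4P: qu => [/eqP E|/eqP E|/eqP E|].
- have := inN 1%N q L E (hs_L E); rewrite !mem_cat => /orP[->//|->]; by rewrite !orbT.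
- have := inN 4 q R E (hs_R E); rewrite !mem_cat => ->; by rewrite !orbT.
- have := inV q; rewrite !mem_cat !inE E eqxx => /(_ isT) ->; by rewrite !orbT.
- move=> E; have := inV q; rewrite !mem_cat !inE !(eq_sym (Some q)).
  by case/or3P: E => ->; rewrite ?orbT => /(_ isT) ->; rewrite !orbT.
Qed.

Let opt_cases (q : option pt) : q = None \/ exists p, q = Some p.
Proof. by case: q => [p|]; [right; exists p|left]. Qed.

Let near_all h q (P : pred pt) :
  (forall p, q = Some p -> Some p \notin vert -> P (h, vs (c2 p))) -> all P (near h q).
Proof.
by case: q => [p|] //; rewrite /near; case: ifPn => // np /(_ p erefl np) /= ->.
Qed.

Let pts_valid : valid (near 1 L) (near 4 R) (end_pts 1 Bl) mid_pts (end_pts 7 Th).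
Proof.
have pu p : p \in pts -> exists2 q, q \in u & p = psi q.
  by rewrite pts_psi => /mapP[q qu ->]; exists q.
have one p : p \in u -> hs (c1 p) = 1%N -> L = Some p.
  by move=> /us ps h; case: (hs_far ps) => [e|//|/hs_R e|e]; rewrite e in h.
have four p : p \in u -> hs (c1 p) = 4%N -> R = Some p.
  by move=> /us ps h; case: (hs_far ps) => [e|/hs_L e|//|e]; rewrite e in h.
apply/and5P; split; last (apply/andP; split).
- case E: Bl => [p|] //=; rewrite all_cat.
  apply/andP; split; apply: near_all => p Ep np /=.
    by case: (vs_gap (Ls Ep).1 np) => -[-> // _]; rewrite E.
  by case: (vs_gap (Rs Ep).1 np) => -[-> // _]; rewrite E.
- case E: Th => [p|] //=; rewrite all_cat.
  apply/andP; split; apply: near_all => p Ep np /=.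
    by case: (vs_gap (Ls Ep).1 np) => -[-> // _]; rewrite E.
  by case: (vs_gap (Rs Ep).1 np) => -[-> // _]; rewrite E.
- apply/orP; have [sz|/eqP sz] := eqVneq (size mid_pts) 2%N; [by left|right].
  have nmid p : p \in s -> Some p \notin vert -> (vs (c2 p) != 4)%N.
    move=> ps np; case: (vs_gap ps np) => -[-> //] [a [b [Ea Eb ah ab]]].
    by case: sz; rewrite /mid_pts Ea Eb ah; case: eqP.
  rewrite all_cat; apply/andP; split; apply: near_all => p Ep np /=; apply: nmid => //.
    exact: (Ls Ep).1.
  exact: (Rs Ep).1.
- apply/orP; have [E|[q E]] := opt_cases L; last first.
    right; apply/hasP; exists (psi q); last by apply/eqP; apply: hs_L.
    suff: psi q \in pts by [].
    by rewrite pts_psi; apply/map_f/inL.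
  left; apply/allP => p /pu[q qu ->] /=; have qs := us qu.
  case: (hs_far qs) => [h|/hs_L->|/hs_R->|->] //; move: h.
  have := hn (si qs); rewrite /hs /hstep /hnice E /=.
  have [n1 n2] := ne1 qs; rewrite (negbTE n1) (negbTE n2).
  by case: ifP => // _; case: (R) => [r|] //= _; case: ifP.
- apply/orP; have [E|[q E]] := opt_cases R; last first.
    right; apply/hasP; exists (psi q); last by apply/eqP; apply: hs_R.
    suff: psi q \in pts by [].
    by rewrite pts_psi; apply/map_f/inR.
  left; apply/allP => p /pu[q qu ->] /=; have qs := us qu.
  case: (hs_far qs) => [->|/hs_L->|/hs_R->|h] //; move: h.
  have := hn (si qs); rewrite /hs /hstep /hnice E /=.
  have [n1 n2] := ne1 qs; rewrite (negbTE n1) (negbTE n2).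
  by case: ifP => // _; case: (L) => [r|] //= _; case: ifP.
- apply/andP; split.
    apply/allP => p /pu[q qu ->] /=; case: eqP => //= hq; apply/allP => p' /pu[q' qu' ->] /=.
    by case: eqP => //= hq'; have := one q qu hq; rewrite (one q' qu' hq') => -[->].
  apply/allP => p /pu[q qu ->] /=; case: eqP => //= hq; apply/allP => p' /pu[q' qu' ->] /=.
  by case: eqP => //= hq'; have := four q qu hq; rewrite (four q' qu' hq') => -[->].
Qed.

Let step_x : hs (c1 x) = 2%N. Proof. by rewrite /hs /hstep ltnn eqxx. Qed.
Let step_y : hs (c1 y) = 3%N.
Proof. by rewrite /hs /hstep ltnNge (ltnW xy) /= (gtn_eqF xy) eqxx. Qed.
Let step_lo : vs (c2 lo) = 2%N. Proof. by rewrite /vs /vstep ltnn eqxx. Qed.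
Let step_hi : vs (c2 hi) = 6%N.
Proof. by rewrite /vs /vstep ltnNge (ltnW lohi) /= (gtn_eqF lohi) ltnn eqxx. Qed.

Lemma swap_near : swap_at x y s.
Proof.
set w := map (orient o) pts.
have wE : w =i map phi u.
  move=> p; rewrite /w /phi -[map _ u]/(map (orient o \o psi) u) map_comp.
  by apply/mapP/mapP => -[q qi ->]; exists q => //; move: qi; rewrite pts_psi.
have xs : x \notin s by apply: contra xys => h; rewrite inE h orbT.
have xney : x <> y by move=> e; case/negP: xys; rewrite e mem_head.
have gx : gen (x :: s).
  by apply: gen_sub g => p; rewrite !inE => /orP[->|->]; rewrite ?orbT.
have gy : gen (y :: s) := gen_cons g.
have gyx : gen (y :: x :: s).
  by apply: gen_sub g => p; rewrite !inE => /or3P[->|->|->]; rewrite ?orbT.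
have fs : [seq b <- s | b \notin s] = [::].
  by apply/eqP; rewrite -size_eq0 size_filter -leqn0 leqNgt -has_count;
    apply/hasPn => b ->.
have e1 : cell_comb (phi x) w = cell_comb x s.
  by apply: cell_phi => // [||p]; [left|left|rewrite fs wE].
have e2 : cell_comb (phi y) w = cell_comb y s.
  by apply: cell_phi => // [||p]; [right|left|rewrite fs wE].
have e3 : cell_comb (phi y) (phi x :: w) = cell_comb y (x :: s).
  apply: cell_phi => //; [by right| |].
    by right; exists x; split=> //; [left|exact: nesym].
  by move=> p; rewrite /= xs fs /= !inE wE.
have e4 : cell_comb (phi x) (phi y :: w) = cell_comb x (y :: s).
  apply: cell_phi => //; [by left| |].
    by right; exists y; split=> //; right.
  by move=> p; rewrite /= ys fs /= !inE wE.
rewrite /swap_at -e1 -e2 -e3 -e4.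
have /allP h := coarse_okP.
have /allP {}h := h _ (end_in 1%N (fun p E => (Bls E).1)).
have /allP {}h := h _ mid_in.
have /allP {}h := h _ (end_in 7 (fun p E => (Ths E).1)).
have /allP {}h := h _ (near_ext 1 (fun p E => (Ls E).1)).
have := h _ (near_ext 4 (fun p E => (Rs E).1)).
have oin : o \in [:: false; true] by rewrite !inE; case: (o).
rewrite pts_valid => /allP/(_ o oin)/andP[h1 h2].
rewrite /phi /psi step_x step_y.
by case: lohiE step_lo step_hi => -[-> ->] -> ->.
Qed.

End SwapGeometry.

Lemma vec_eqb_refl (u : lincomb) : vec_eqb u u.
Proof. by elim: u => //= -[n|n] u ->; rewrite andbT; apply/eqnP. Qed.

Lemma swap_all (x y : pt) (s : seq pt) : gen (x :: y :: s) -> x \notin y :: s ->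
  y \notin s -> swap_at x y s.
Proof.
move=> g xys ys.
have xs : x \notin s by apply: contra xys => h; rewrite inE h orbT.
have xney : x <> y by move=> e; case/negP: xys; rewrite e mem_head.
have yxs : y \notin x :: s by rewrite inE negb_or ys andbT; apply/eqP/nesym.
have gy : gen (y :: s) := gen_cons g.
have g' : gen (y :: x :: s).
  by apply: gen_sub g => p; rewrite !inE => /or3P[->|->|->]; rewrite ?orbT.
have gx : gen (x :: s) := gen_cons g'.
pose c (o : bool) (p : pt) := (orient o p).1.
have cneq o : c o x <> c o y.
  rewrite /c; case: o => e; apply: xney; [apply: (proj2 g)|apply: (proj1 g)] => //;
    by rewrite ?mem_head // !inE eqxx orbT.
pose between o a b := has (fun q => c o a < c o q < c o b)%N s.
have near a b o : gen (a :: b :: s) -> a \notin b :: s -> b \notin s ->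
    (c o a < c o b)%N -> c (~~ o) a <> c (~~ o) b -> ~~ between o a b -> swap_at a b s.
  move=> gab nab nb ab cab /hasPn nbt.
  have c2E p : (orient o p).2 = c (~~ o) p by rewrite /c; case: (o).
  have [lt|lt|e] := ltngtP (c (~~ o) a) (c (~~ o) b); last by case: cab.
    by apply: (@swap_near o a b a b) => //; [rewrite !c2E|left].
  by apply: (@swap_near o a b b a) => //; [rewrite !c2E|right].
have [/existsP[o ho]|] := boolP [exists o, ~~ between o x y && ~~ between o y x].
  have /andP[bxy byx] := ho; case: (ltngtP (c o x) (c o y)) => [lt|lt|e].
  - exact: (near x y o).
  - by apply: swap_vecC; apply: (near y x o) => //; apply/nesym.
  - by case: (cneq o).
rewrite negb_exists => /forallP bt.
have btw o : exists2 q, q \in s & (c o x < c o q < c o y)%N || (c o y < c o q < c o x)%N.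
  by have := bt o; rewrite negb_and !negbK => /orP[]/hasP[q qs h]; exists q; rewrite ?h ?orbT.
have far a b : gen (b :: s) -> (a = x /\ b = y) \/ (a = y /\ b = x) ->
    cell_comb a s = cell_comb a (b :: s).
  move=> gb ab; apply: cell_comb_local => // [p|p pn]; first exact: sub_cons.
  have := nbrs_sub pn; rewrite inE => /orP[/eqP pb|//]; exfalso.
  have no r o : axis r -> (forall p q, r p q = (c o p < c o q)%N) \/
      (forall p q, r p q = (c o q < c o p)%N) -> nbr r a (b :: s) <> Some b.
    move=> ar rE E; have [q qs h] := btw o.
    have [_ rab hq] := (nbrP (axis_dir ar) a b gb).1 E.
    have {}hq : r a q -> q = b \/ r b q by apply: hq; rewrite inE qs orbT.
    have qb : q <> b by case: ab => -[_ ->] e; [case/negP: ys|case/negP: xs]; rewrite -e.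
    have {}h : (c o a < c o q < c o b)%N || (c o b < c o q < c o a)%N.
      by case: ab => -[-> ->]; rewrite // orbC.
    case: rE => rE; rewrite !rE in rab hq; case/orP: h => /andP[h1 h2].
    - by case: (hq h1) => // h3; have := ltn_trans h2 h3; rewrite ltnn.
    - by have := ltn_trans (ltn_trans h1 h2) rab; rewrite ltnn.
    - by have := ltn_trans (ltn_trans h1 h2) rab; rewrite ltnn.
    - by case: (hq h2) => // h3; have := ltn_trans h3 h1; rewrite ltnn.
  move: pn; rewrite pb mem_nbrs => /or4P[]/eqP.
  - by apply: (no to_left false (Or41 _ _ _ erefl)); right.
  - by apply: (no to_right false (Or42 _ _ _ erefl)); left.
  - by apply: (no below true (Or43 _ _ _ erefl)); right.
  - by apply: (no above true (Or44 _ _ _ erefl)); left.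
rewrite /swap_at -(far x y) //; last by left.
rewrite -(far y x) //; last by right.
by rewrite /swap_vec !vec_eqb_refl /= orbT.
Qed.

Lemma row_cell_function (row : seq int) : row \in value_table ->
  cell_function (cell_value (short_row row)).
Proof.
move=> rin; split.
- by move=> x s xs; rewrite /cell_value xs.
- move=> x s s' g ss'; rewrite /cell_value ss'; case: ifP => // _; congr (eval _ _).
  by rewrite -(@cell_comb_map x s s' id) // => p; rewrite map_id ss'.
- move=> x s phi g inc; rewrite /cell_value (cell_comb_map g inc) //.
  congr (if _ then _ else _); apply/mapP/idP => [[q qs]|xs]; last by exists x.
  move=> /(increasing_inj g inc) -> //; by rewrite ?mem_head // inE qs orbT.
- move=> x y s g; set F := cell_value _.
  have F1 z t : z \in t -> F z t = 1 by move=> zt; rewrite /F /cell_value zt.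
  have [xs|xs] := boolP (x \in s).
    rewrite (F1 x s) // (F1 x (y :: s)) ?inE ?xs ?orbT // mul1r mulr1.
    rewrite /F /cell_value inE; case: eqP => [->|_]; first by rewrite xs.
    rewrite orFb; case: ifP => // ysF; congr (eval _ _).
    rewrite -(@cell_comb_map y s (x :: s) id) //; first exact: gen_cons g.
    by move=> p; rewrite map_id inE; case: eqP => // ->.
  have [ys|ys] := boolP (y \in s).
    rewrite (F1 y s) // (F1 y (x :: s)) ?inE ?ys ?orbT // mul1r mulr1.
    rewrite /F /cell_value inE (negbTE xs) orbF.
    have -> : (x == y) = false by apply: contraNF xs => /eqP ->.
    congr (eval _ _); symmetry; apply: (@cell_comb_map x s (y :: s) id) => //.
    - by apply: gen_sub g => p; rewrite !inE => /orP[->|->]; rewrite ?orbT.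
    - by move=> p; rewrite map_id inE; case: eqP => // ->.
  have [->//|xy] := eqVneq x y.
  have xys : x \notin y :: s by rewrite inE negb_or xy xs.
  have := swap_vecP (swap_all g xys ys) rin; rewrite /F /cell_value.
  rewrite (negbTE xs) (negbTE ys) (negbTE xys) inE (negbTE ys) orbF eq_sym (negbTE xy).
  exact.
- move=> x z s g ev xzs zs; apply: cell_value_split => //.
Qed.

(** * Uniqueness *)

(** The candidate [z] is omitted: it contributes the constant 1, which cancels in the difference of
    two solutions. *)
Definition gap_relation (k : key) (z : pt) : seq key :=
  k :: [seq key_of p (z :: gap_rest k) | p <- cand (gap_rest k) (gap_pt k) z & p != z].

Definition gap_relations : seq (seq key) :=
  flatten [seq [seq gap_relation k z | z <- gaps (size k.1)] | k <- reduced_keys].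

(** A single occurrence of an unknown key has coefficient 1 or -1, so it can be solved for without
    division. *)
Definition propagate (known : seq key) (rel : seq key) : seq key :=
  if [seq k <- rel | k \notin known] is [:: k] then k :: known else known.

(** Keys list positions by value, so [[:: 1; 2; 0]] is 312. Its two marked values agree with those
    of .231 and 2.31, since [free_unit] and [dot_unit] give the same basis vectors. *)
Definition free_keys : seq key :=
  [:: ([:: 0; 1], 0); ([:: 0; 1], 1); ([:: 1; 0], 1); ([:: 1; 0], 0);
      ([:: 0; 2; 1], 1); ([:: 1; 2; 0], 0); ([:: 1; 2; 0], 1);
      ([:: 1; 0; 2; 4; 3], 2)]%N.

Lemma all_gaps_generic : all_gaps (fun k z => let s := z :: gap_rest k in
  [&& uniq (map fst (gap_pt k :: s)), uniq (map snd (gap_pt k :: s)), all even_pt s,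
      gap_pt k \notin s & z \notin gap_rest k]).
Proof. by vm_cast_no_check (erefl true). Qed.

(** Two rounds already reach every reduced key, as [reduced_closure] checks. *)
Definition closure : seq key :=
  foldl propagate (foldl propagate free_keys gap_relations) gap_relations.

Lemma reduced_closure : all (fun k => k \in closure) reduced_keys.
Proof. by vm_cast_no_check (erefl true). Qed.

Lemma gen_uniq (s : seq pt) : uniq (map fst s) -> uniq (map snd s) -> gen s.
Proof.
have inj (f : pt -> nat) p q : uniq (map f s) -> p \in s -> q \in s -> f p = f q -> p = q.
  move=> us ps qs e.
  by rewrite -(nth_index (0, 0)%N ps) -(nth_index (0, 0)%N qs); congr nth;
    apply/eqP; rewrite -(nth_uniq 0%N _ _ us) ?size_map ?index_mem //
      !(nth_map (0, 0)%N) ?index_mem // !nth_index ?e.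
by move=> u1 u2; split=> p q ps qs; apply: inj.
Qed.

Section Uniqueness.
Variables (k : comPzRingType) (F : pt -> seq pt -> k).
Hypothesis cF : cell_function F.

(** If [z] is not among the neighbours, then in both coordinates a neighbour of [x] separates them.
    The splitting relation for [z] then has a single term, so adding [z] changes nothing. *)
Lemma cell_local (x : pt) (s s' : seq pt) : gen (x :: s) -> x \notin s ->
  {subset s' <= s} -> {subset nbrs x s <= s'} -> F x s' = F x s.
Proof.
move=> g xs s's ns; have gs := gen_cons g.
have gsub t : {subset t <= s} -> gen (x :: t).
  by move=> ts; apply: gen_sub g => p; rewrite !inE => /orP[->//|/ts->]; rewrite orbT.
have step z t : {subset z :: t <= s} -> {subset s' <= t} -> z \notin t ->
    F x (z :: t) = F x t.
  move=> zts s't zt.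
  have zs : z \in s by apply: zts; rewrite mem_head.
  (* Makes all coordinates even and positive, as [cell_split] requires. *)
  pose d (p : pt) : pt := (p.1.*2.+2, p.2.*2.+2)%N.
  have dinc u : increasing_on u d by move=> p q _ _; rewrite /= !ltnS !ltn_double.
  have dinj : injective d by move=> [a b] [a' b'] [] /double_inj -> /double_inj ->.
  have xzt : x \notin z :: t by apply: contra xs => /zts.
  have gxzt := gsub _ zts.
  have gxt : gen (x :: t) by apply: gsub => p pt'; apply: zts; rewrite inE pt' orbT.
  have map_cons : map d (z :: t) = d z :: map d t by [].
  rewrite -(cell_map cF gxt (dinc _)) -(cell_map cF gxzt (dinc _)) map_cons.
  have gd : gen (d x :: d z :: map d t).
    split=> _ _ /(mapP (s := x :: z :: t))[p ps ->] /(mapP (s := x :: z :: t))[q qs ->] /=;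
      move=> [/double_inj e]; congr d; [apply: (proj1 gxzt)|apply: (proj2 gxzt)] => //.
  rewrite (cell_split cF gd).
  - have sep c r l : axis r -> axis l -> (forall p q, r p q = (c p < c q)%N) ->
        (forall p q, l p q = (c q < c p)%N) -> c x <> c z ->
        (forall p q, (c (d p) < c (d q))%N = (c p < c q)%N) ->
        separated c (map d t) (d x) (d z).
      move=> ar al rE lE cxz dE; apply/hasP.
      case: (ltngtP (c x) (c z)) => [lt|lt|//].
        case E: (nbr r x s) => [p|]; last by have := nbr_none E zs; rewrite rE lt.
        have pt' := s't _ (ns _ (nbr_nbrs ar E)).
        exists (d p); first exact: map_f.
        have [_ xp hz] := (nbrP (axis_dir ar) x p gs).1 E; rewrite rE in xp.
        have rxz : r x z by rewrite rE.
        have [zp|] := hz z zs rxz; first by rewrite zp pt' in zt.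
        by rewrite !dE xp rE => ->.
      case E: (nbr l x s) => [p|]; last by have := nbr_none E zs; rewrite lE lt.
      have pt' := s't _ (ns _ (nbr_nbrs al E)).
      exists (d p); first exact: map_f.
      have [_ xp hz] := (nbrP (axis_dir al) x p gs).1 E; rewrite lE in xp.
      have lxz : l x z by rewrite lE.
      have [zp|] := hz z zs lxz; first by rewrite zp pt' in zt.
      by rewrite !dE xp lE => ->; rewrite orbT.
    have xi : x \in x :: z :: t by rewrite mem_head.
    have zi : z \in x :: z :: t by rewrite !inE eqxx orbT.
    have xz : x <> z by move=> e; case/negP: xzt; rewrite e mem_head.
    have x1 : x.1 <> z.1 by move=> /(proj1 gxzt _ _ xi zi).
    have x2 : x.2 <> z.2 by move=> /(proj2 gxzt _ _ xi zi).
    have s1 : separated fst (map d t) (d x) (d z).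
      apply: (sep fst to_right to_left) => //; [exact: Or42|exact: Or41|].
      by move=> p q; rewrite /= !ltnS ltn_double.
    have s2 : separated snd (map d t) (d x) (d z).
      apply: (sep snd above below) => //; [exact: Or44|exact: Or43|].
      by move=> p q; rewrite /= !ltnS ltn_double.
    rewrite /cand /slots s1 s2 /= !eqSS !(inj_eq double_inj).
    by rewrite (introF eqP x1) (introF eqP x2) big_seq1.
  - by apply/allP => _ /(mapP (s := z :: t))[p _ ->]; rewrite /even_pt /= !negbK !odd_double.
  - by rewrite -map_cons (mem_map dinj).
  - by rewrite (mem_map dinj).
have grow e : {subset e <= s} -> F x (e ++ s') = F x s'.
  elim: e => //= z e IH zes.
  have es : {subset e <= s} by move=> p pe; apply: zes; rewrite inE pe orbT.
  have ess : {subset z :: e ++ s' <= s}.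
    by move=> p; rewrite inE mem_cat => /or3P[/eqP->|/es|/s's] //; apply: zes; rewrite mem_head.
  rewrite -(IH es); have [zt|zt] := boolP (z \in e ++ s').
    by apply: (cell_set cF (gsub _ ess)) => p; rewrite inE; case: eqP => // ->.
  by apply: step => // p ps'; rewrite mem_cat ps' orbT.
rewrite -(grow s) //; apply: (cell_set cF); last first.
  by move=> p; rewrite mem_cat; apply/orP/idP => [[|/s's]//|->]; left.
by apply: gsub => p; rewrite mem_cat => /orP[|/s's].
Qed.

Lemma cell_key (x : pt) (s : seq pt) : gen (x :: s) -> x \notin s ->
  F x s = F (key_pt (key_of x s)) (key_rest (key_of x s)).
Proof.
move=> g xs; have sub := @nbrs_sub x s.
have gn : gen (x :: nbrs x s).
  by apply: gen_sub g => p; rewrite !inE => /orP[->//|/sub->]; rewrite orbT.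
have inc := @ranks_increasing (x :: nbrs x s).
rewrite -(cell_local g xs sub) // -(cell_map cF gn inc) key_pt_of //.
apply: (cell_set cF); last by move=> p; rewrite key_rest_of.
have e : ranks (x :: nbrs x s) x :: map (ranks (x :: nbrs x s)) (nbrs x s) =
  map (ranks (x :: nbrs x s)) (x :: nbrs x s) by [].
rewrite e; split=> _ _ /mapP[p ps ->] /mapP[q qs ->] h; congr ranks.
  have [pq _] := inc _ _ ps qs; have [qp _] := inc _ _ qs ps.
  apply: (proj1 gn) => //; move: pq qp; rewrite h ltnn; by case: (ltngtP p.1 q.1).
have [_ pq] := inc _ _ ps qs; have [_ qp] := inc _ _ qs ps.
apply: (proj2 gn) => //; move: pq qp; rewrite h ltnn; by case: (ltngtP p.2 q.2).
Qed.

End Uniqueness.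

Lemma cell_comb_key (x : pt) (s : seq pt) : gen (x :: s) -> x \notin s ->
  cell_comb (key_pt (key_of x s)) (key_rest (key_of x s)) = cell_comb x s.
Proof.
move=> g xs; have sub := @nbrs_sub x s.
rewrite -(cell_comb_local (gen_cons g) sub) // key_pt_of //; apply: cell_comb_map.
- by apply: gen_sub g => p; rewrite !inE => /orP[->//|/sub->]; rewrite orbT.
- exact: ranks_increasing.
- exact: key_rest_of.
Qed.

Lemma free_unit : all (fun i => vec_eqb
    (cell_comb (key_pt (nth ([::], 0%N) free_keys i)) (key_rest (nth ([::], 0%N) free_keys i)))
    (rcons [seq (j == i)%:R | j <- iota 0 8] 0)) (iota 0 8).
Proof. by vm_cast_no_check (erefl true). Qed.

Section CellIsValue.
Variables (k : comPzRingType) (F : pt -> seq pt -> k).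
Hypothesis cF : cell_function F.

Definition key_value (a : key) : k := F (key_pt a) (key_rest a).

Definition free_values : seq k := map key_value free_keys.

Let t := rcons free_values 1.

(** [F] and the predicted combination satisfy the same splitting relations, so their difference
    satisfies them without the constant term. It vanishes on [free_keys], and [propagate] spreads
    this to all reduced keys. *)
Let err (a : key) : k := key_value a - eval t (cell_comb (key_pt a) (key_rest a)).

Let err_key x s : gen (x :: s) -> x \notin s ->
  F x s - eval t (cell_comb x s) = err (key_of x s).
Proof. by move=> g xs; rewrite /err cell_comb_key // (cell_key cF g xs). Qed.

Let err_split a z : a \in reduced_keys -> z \in gaps (size a.1) ->
  err a = \sum_(b <- behead (gap_relation a z)) err b.
Proof.
move=> ar zg; have := allP (allP all_gaps_generic a ar) z zg.
case/and5P => u1 u2 ev xzs zs; have g := gen_uniq u1 u2.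
set x := gap_pt a in u1 u2 ev xzs zs g *; set s := gap_rest a in u1 u2 ev xzs zs g *.
have xs : x \notin s by apply: contra xzs => h; rewrite inE h orbT.
have gx : gen (x :: s).
  by apply: gen_sub g => p; rewrite !inE => /orP[->|->]; rewrite ?orbT.
have ga : gen (key_pt a :: key_rest a).
  have inj p q : dbl p = dbl q -> p = q.
    by case: p q => [? ?] [? ?] [/double_inj-> /double_inj->].
  have mem p : p \in key_pt a :: key_rest a -> dbl p \in x :: s := @map_f _ _ dbl _ p.
  by split=> p q ps qs e; apply: inj; [apply: (proj1 gx)|apply: (proj2 gx)];
    rewrite ?mem //= e.
have inc : increasing_on (key_pt a :: key_rest a) dbl.
  by move=> p q _ _; rewrite /= !ltn_double.
have -> : err a = F x s - eval t (cell_comb x s).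
  by rewrite /err /key_value -(cell_map cF ga inc) -(cell_comb_map ga inc (s' := s)).
have -> : eval t (cell_comb x s) = cell_value t x s by rewrite /cell_value (negbTE xs).
have -> : cell_value t x s = \sum_(p <- cand s x z) cell_value t p (z :: s).
  exact: (@cell_value_split k free_values).
rewrite (cell_split cF g ev xzs zs) -sumrB.
rewrite (bigID (pred1 z)) /= big1 ?add0r => [|p /eqP->]; last first.
  by rewrite (cell_mem cF) ?mem_head // /cell_value mem_head subrr.
rewrite big_map big_filter big_seq_cond [RHS]big_seq_cond.
apply: eq_bigr => p /andP[pc pz].
have gp := cand_gen g ev xzs zs pc.
have pzs : p \notin z :: s.
  rewrite inE (negbTE pz) /=; apply/negP => ps; have [h1 h2 _ _] := cand_side g ev xzs zs pc ps.
  case/negP: xs; suff -> : x = p by [].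
  apply: (proj1 g); rewrite ?mem_head ?inE ?ps ?orbT //.
  by move: h1 h2; rewrite !ltnn; case: ltngtP.
by rewrite -err_key // /cell_value (negbTE pzs).
Qed.

Let err_propagate known rel :
  (forall a, a \in known -> err a = 0) ->
  err (head ([::], 0%N) rel) = \sum_(b <- behead rel) err b ->
  forall a, a \in propagate known rel -> err a = 0.
Proof.
move=> kn; rewrite /propagate; case E: [seq _ <- _ | _] => [|u [|v l]] //.
move=> h a; rewrite inE => /orP[/eqP->{a}|]; last exact: kn.
case: rel E h => [|b l] //= E h.
have rest : (forall c, c \in l -> c \in known) -> \sum_(b <- l) err b = 0.
  by move=> lk; rewrite big_seq big1 // => c /lk/kn.
move: E; case: ifPn => [bk [<- E]|/negPn bk E].
  rewrite h rest // => c cl; apply/negPn/negP => ck.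
  by have : c \in [seq c <- l | c \notin known]; [rewrite mem_filter ck cl|rewrite E].
rewrite (kn _ bk) in h.
have : \sum_(b <- l) err b = \sum_(c <- [seq c <- l | c \notin known]) err c.
  rewrite big_filter (bigID (mem known)) /= big1 ?add0r // => c; exact: kn.
by rewrite -h E big_seq1.
Qed.

Let err_closure a : a \in closure -> err a = 0.
Proof.
have rels r : r \in gap_relations ->
    err (head ([::], 0%N) r) = \sum_(b <- behead r) err b.
  by move=> /flattenP[_ /mapP[b br ->] /mapP[z zg ->]]; apply: err_split.
have fold l known : {subset l <= gap_relations} ->
    (forall a, a \in known -> err a = 0) ->
    forall a, a \in foldl propagate known l -> err a = 0.
  elim: l known => //= r l IH known sub kn; apply: IH.
    by move=> c cl; apply: sub; rewrite inE cl orbT.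
  by apply: err_propagate => //; apply: rels; apply: sub; rewrite mem_head.
have base b : b \in free_keys -> err b = 0.
  move=> bf.
  have i8 : index b free_keys \in iota 0 8.
    by rewrite mem_iota add0n -[8%N]/(size free_keys) index_mem.
  have := vec_eqbP (allP free_unit _ i8); rewrite nth_index // /err => ->.
  rewrite -{1}(nth_index ([::], 0%N) bf) /t /free_values; move: i8.
  move: (index b free_keys) => i; rewrite !inE.
  by do 7?[case/orP => [/eqP->|]]; [..|move=> /eqP->];
    rewrite /= !mulr0z mulr1z ?add0r ?addr0 subrr.
rewrite /closure; move: fold {rels}; move: gap_relations => l fold.
exact: (fold _ _ (fun c cl => cl) (fold _ _ (fun c cl => cl) base)).
Qed.

Lemma cell_is_value (x : pt) (s : seq pt) : gen (x :: s) -> F x s = cell_value t x s.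
Proof.
move=> g; have [xs|xs] := boolP (x \in s); first by rewrite /cell_value xs (cell_mem cF).
rewrite /cell_value (negbTE xs); apply/eqP; rewrite -subr_eq0 err_key //; apply/eqP.
apply: err_closure; exact: (allP reduced_closure _ (key_of_reduced g xs)).
Qed.

End CellIsValue.

(** * Solving the swap relations *)

(* [(c, (i, j))] stands for [c T_i T_j], where [T_8 = 1]. *)
Definition poly : Type := seq (int * (nat * nat)).

Definition mono_eq (a b : nat * nat) : bool :=
  (a == b) || (a == (b.2, b.1)).

Definition coef (P : poly) (m : nat * nat) : int :=
  foldr (fun c z => if mono_eq c.2 m then intZmod.addz c.1 z else z) (Posz 0) P.

Definition monos : seq (nat * nat) :=
  flatten [seq [seq (i, j) | j <- iota i (9 - i)] | i <- iota 0 9].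

Definition normal (P : poly) : poly :=
  if all (fun c => (c.2.1 < 9)%N && (c.2.2 < 9)%N) P then
    [seq c <- [seq (coef P m, m) | m <- monos] | ~~ int_eqb c.1 (Posz 0)]
  else P.

Definition poly_prod (c : int) (u v : lincomb) : poly :=
  [seq (intRing.mulz c (intRing.mulz (nth (Posz 0) u m.1) (nth (Posz 0) v m.2)), m)
     | m <- [seq (i, j) | i <- iota 0 9, j <- iota 0 9]].

Definition swap_poly (c : int) (w : seq nat) (i j : nat) : poly :=
  let x := nth (0, 0)%N (word_pts w) i in let y := nth (0, 0)%N (word_pts w) j in
  let s := others x (others y (word_pts w)) in
  poly_prod c (cell_comb x s) (cell_comb y (x :: s)) ++
  poly_prod (intZmod.oppz c) (cell_comb y s) (cell_comb x (y :: s)).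

(* A combination [c] per swap, chosen so that successive substitutions only meet
   relations [T_i = n] and [T_i (T_i + n) = 0] with [n = 1] or [n = -1]. *)
Definition relation_data : seq (seq (int * (seq nat * (nat * nat)))) :=
  let bc := ([:: 0; 1; 3; 2], (2, 1))%N in let bd := ([:: 0; 2; 1; 3], (3, 1))%N in
  let ce := ([:: 1; 2; 3; 0], (1, 0))%N in let de := ([:: 1; 2; 3; 0], (2, 1))%N in
  [:: [:: (1, bc)]; [:: (1, bd)]; [:: (1, ce)]; [:: (1, de)];
      [:: (1, ([:: 0; 1; 3; 2], (3, 1))%N); (1, bc); (1, ce)];
      [:: (1, ([:: 1; 3; 2; 0], (2, 1))%N); (-2, bd); (-1, de)];
      [:: (1, ([:: 0; 3; 2; 1], (2, 1))%N); (1, bc); (-1, bd)];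
      [:: (1, ([:: 0; 3; 2; 1], (3, 2))%N)];
      [:: (1, ([:: 0; 1; 2], (1, 0))%N)]; [:: (1, ([:: 0; 1; 2], (2, 1))%N)];
      [:: (1, ([:: 2; 1; 0], (1, 0))%N)]; [:: (1, ([:: 2; 1; 0], (2, 1))%N)];
      [:: (1, ([:: 0; 2; 1], (1, 0))%N)]; [:: (1, ([:: 0; 2; 1], (2, 0))%N)];
      [:: (1, ([:: 0; 2; 1], (2, 1))%N)]; [:: (1, ([:: 1; 0; 2], (1, 0))%N)];
      [:: (1, ([:: 1; 0; 2], (2, 0))%N)]; [:: (1, ([:: 1; 0; 2], (2, 1))%N)];
      [:: (1, ([:: 1; 2; 0], (1, 0))%N)]; [:: (1, ([:: 2; 0; 1], (2, 1))%N)] ].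

Definition relations : seq poly :=
  [seq normal (flatten [seq swap_poly d.1 d.2.1 d.2.2.1 d.2.2.2 | d <- r]) | r <- relation_data].

Definition env : Type := seq (nat * int).

Definition assigned (v : env) (i : nat) : option int :=
  foldr (fun p o => if eqn p.1 i then Some p.2 else o) None v.

Definition subst1 (v : env) (i : nat) : int * nat :=
  if assigned v i is Some n then (n, 8%N) else (Posz 1, i).

Definition subst (v : env) (P : poly) : poly :=
  [seq (intRing.mulz c.1 (intRing.mulz (subst1 v c.2.1).1 (subst1 v c.2.2).1),
        ((subst1 v c.2.1).2, (subst1 v c.2.2).2)) | c <- P].

Inductive action := Absurd | Assign of nat & int | Split of nat & int | Stuck.

Definition is_sign (c : int) : bool := int_eqb c (Posz 1) || int_eqb c (Negz 0).

Definition read_action (P : poly) : action :=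
  match P with
  | [:: (c, (i, j))] =>
      if is_sign c && eqn j 8 then if eqn i 8 then Absurd else Assign i 0 else Stuck
  | [:: (c, (i, j)); (m, (i', j'))] =>
      if is_sign c then
        if [&& eqn j 8, eqn i' 8 & eqn j' 8] then Assign i (intZmod.oppz (intRing.mulz c m))
        else if [&& eqn i j, eqn i i', eqn j' 8 & is_sign m] then Split i (intRing.mulz c m)
        else Stuck
      else Stuck
  | _ => Stuck
  end.

(** Contradictions and forced values take precedence over branching. *)
Definition choose_action (l : seq action) : action :=
  let direct a := match a with Absurd | Assign _ _ => true | _ => false end in
  let split a := match a with Split _ _ => true | _ => false end in
  head (head Stuck (filter split l)) (filter direct l).

Definition in_table (v : env) : bool :=
  has (fun r => all (fun i =>
    if assigned v i is Some n then int_eqb n (nth 0 (short_row r) i) else false) (iota 0 8))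
    value_table.

Arguments in_table : simpl never.

Fixpoint solve (fuel : nat) (rels : seq poly) (v : env) : bool :=
  if fuel is f.+1 then
    match choose_action [seq read_action (normal (subst v P)) | P <- rels] with
    | Absurd => true
    | Assign i n => solve f rels ((i, n) :: v)
    | Split i n => solve f rels ((i, Posz 0) :: v) &&
                   solve f rels ((i, intZmod.oppz n) :: v)
    | Stuck => in_table v
    end
  else false.

(** Substitution removes assigned unknowns, so a branch assigns at most eight values and the fuel is
    ample. Each branch ends in a contradiction or in a row of the table. *)
Lemma solve_relations : solve 12 relations [::].
Proof. by vm_cast_no_check (erefl true). Qed.

Lemma monos_unique : all (fun p => if [seq m <- monos | mono_eq p m] is [:: m] then true else false)
  [seq (i, j) | i <- iota 0 9, j <- iota 0 9].
Proof. by vm_cast_no_check (erefl true). Qed.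

Lemma relation_data_generic : all (all (fun d =>
  let w := word_pts d.2.1 in
  let x := nth (0, 0)%N w d.2.2.1 in let y := nth (0, 0)%N w d.2.2.2 in
  let s := others x (others y w) in
  [&& uniq (map fst (x :: y :: s)), uniq (map snd (x :: y :: s)), x \notin y :: s &
      y \notin x :: s])) relation_data.
Proof. by vm_cast_no_check (erefl true). Qed.

(** * Soundness of the elimination *)

Section Evaluation.
Variables (k : comPzRingType) (T : nat -> k).

Definition peval (P : poly) : k := \sum_(c <- P) (T c.2.1 * T c.2.2) *~ c.1.

Lemma peval_normal (P : poly) : peval (normal P) = peval P.
Proof.
rewrite /normal; case: ifP => // hP; rewrite /peval big_filter big_map.
have -> : \sum_(m <- monos | ~~ int_eqb (coef P m, m).1 0)
    (T m.1 * T m.2) *~ coef P m = \sum_(m <- monos) (T m.1 * T m.2) *~ coef P m.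
  rewrite [RHS](bigID (fun m => int_eqb (coef P m) 0)) /=.
  rewrite [X in _ = X + _]big1 ?add0r // => m /int_eqbP ->.
  by rewrite mulr0z.
elim: P hP => [|c P IH] /=; first by rewrite big1 ?big_nil // => m _; rewrite mulr0z.
case/andP => /andP[c1 c2] /IH {}IH; rewrite big_cons -IH.
have -> : (T c.2.1 * T c.2.2) *~ c.1 =
    \sum_(m <- monos | mono_eq c.2 m) (T m.1 * T m.2) *~ c.1.
  have := allP monos_unique c.2; rewrite -big_filter.
  have -> : c.2 \in [seq (i, j) | i <- iota 0 9, j <- iota 0 9].
    apply/allpairsPdep; exists c.2.1, c.2.2; rewrite !mem_iota c1 c2.
    by case: (c.2).
  move=> /(_ isT); case E: [seq _ <- _ | _] => [|m [|? ?]] // _.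
  have : m \in [seq m <- monos | mono_eq c.2 m] by rewrite E mem_head.
  rewrite mem_filter big_seq1 => /andP[+ _].
  by case/orP => /eqP -> //=; rewrite mulrC.
rewrite [X in _ = X + _]big_mkcond -big_split /=; apply: eq_bigr => m _.
case: ifP => _; last by rewrite add0r.
exact: mulrzDr.
Qed.

Lemma peval_cat (P Q : poly) : peval (P ++ Q) = peval P + peval Q.
Proof. exact: big_cat. Qed.

Lemma peval_prod (t : seq k) (c : int) (u v : lincomb) : T =1 nth 0 t -> size t = 9 ->
  size u = 9 -> size v = 9 -> peval (poly_prod c u v) = (eval t u * eval t v) *~ c.
Proof.
move=> tT st.
have eE w : size w = 9 -> eval t w = \sum_(i <- iota 0 9) T i *~ nth 0 w i.
  move=> sw; rewrite -[9%N]st (eq_bigr _ (fun i _ => congr1 ( *~%R^~ (nth 0 w i)) (tT i))).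
  move: sw; rewrite -st => {st}; elim: (t) w => [|a l IH] [|b w] //=; first by rewrite big_nil.
  by case=> /IH ->; rewrite big_cons -[1%N]addn0 iotaDl big_map.
move=> su sv; rewrite !eE // /peval big_map big_allpairs mulr_suml mulrz_suml.
apply: eq_bigr => i _; rewrite mulr_sumr mulrz_suml; apply: eq_bigr => j _ /=.
rewrite -[intRing.mulz c _]/(c * (nth 0 u i * nth 0 v j)).
rewrite mulrzAl mulrzAr -!mulrzA; congr (_ *~ _).
by rewrite mulrC [nth 0 u i * _]mulrC mulrA.
Qed.

End Evaluation.

Section Solution.
Variables (k : comPzRingType) (T : nat -> k).
Hypothesis T8 : T 8 = 1.

(** The summands are only required to be simultaneous eigenvectors. This property is additive, so
    the branches of the search can be collected, even when several end in the same row. *)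
Definition decomposed (e : k) : Prop := exists c : 'I_37 -> k, e = \sum_a c a /\
  forall a i, (i < 8)%N -> T i * c a = c a *~ nth 0 (short_row (values a)) i.

Lemma decomposed0 : decomposed 0.
Proof.
by exists (fun=> 0); split=> [|a i _]; [rewrite big1|rewrite mulr0 mul0rz].
Qed.

Lemma decomposedD (e f : k) : decomposed e -> decomposed f -> decomposed (e + f).
Proof.
move=> [c [-> hc]] [d [-> hd]]; exists (fun a => c a + d a); split.
  by rewrite big_split.
by move=> a i i8; rewrite mulrDr hc // hd // mulrzDl.
Qed.

(** A branch of the search is represented by an element [e] on which its assignments hold, in place
    of a quotient of the ring. *)
Definition acts (v : env) (e : k) : Prop :=
  forall i n, assigned v i = Some n -> T i * e = e *~ n.

Lemma acts_mul (v : env) (q e : k) : acts v e -> acts v (q * e).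
Proof. by move=> h i n /h E; rewrite mulrCA E mulrzAr. Qed.

Lemma acts_cons (v : env) (i : nat) (n : int) (e : k) : acts v e ->
  T i * e = e *~ n -> acts ((i, n) :: v) e.
Proof. by move=> h E j m /=; case: eqnP => [<- [<-]//|_ /h]. Qed.

Lemma subst1_acts (v : env) (e : k) (i : nat) : acts v e ->
  T i * e = (T (subst1 v i).2 * e) *~ (subst1 v i).1.
Proof.
move=> h; rewrite /subst1; case E: (assigned v i) => [n|] /=.
  by rewrite T8 mul1r (h _ _ E).
by rewrite mulr1z.
Qed.

Lemma peval_subst (v : env) (e : k) (P : poly) : acts v e ->
  peval T (subst v P) * e = peval T P * e.
Proof.
move=> h; rewrite /peval big_map !mulr_suml; apply: eq_bigr => c _ /=.
rewrite -[intRing.mulz c.1 _]/(c.1 * ((subst1 v c.2.1).1 * (subst1 v c.2.2).1)).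
rewrite !mulrzAl [c.1 * _]mulrC mulrzA; congr (_ *~ _).
rewrite -[RHS]mulrA (subst1_acts _ h) mulrzAr (mulrCA (T c.2.1)).
by rewrite (subst1_acts _ h) mulrzAr -mulrzA mulrCA mulrA.
Qed.

Definition sound (e : k) (a : action) : Prop :=
  match a with
  | Absurd => e = 0
  | Assign i n => T i * e = e *~ n
  | Split i n => T i * (T i * e) = - (T i * e) *~ n /\ n * n = 1
  | Stuck => True
  end.

Lemma read_actionP (e : k) (P : poly) : peval T P * e = 0 -> sound e (read_action P).
Proof.
have sgn c : is_sign c -> c * c = 1 by case: c => [[|[|n]]|[|n]].
have unit c (x : k) : is_sign c -> x *~ c = 0 -> x = 0.
  by move=> /sgn cc /(congr1 ( *~%R^~ c)); rewrite -mulrzA cc mulr1z mul0rz.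
rewrite /peval; case: P => [|[c [i j]] [|[m [i' j']] [|? ?]]] //=.
  rewrite big_seq1 /=; case: ifP => // /andP[sc /eqnP ->]; rewrite T8 mulr1 mulrzAl => E.
  have {}E := unit _ _ sc E.
  by case: eqnP => [i8|_] /=; [rewrite -E i8 T8 mul1r|rewrite E mulr0z].
rewrite big_cons big_seq1 /=; case: ifP => // sc E.
case: ifP => [/and3P[/eqnP jE /eqnP i'E /eqnP j'E]|_].
  rewrite /= -[intZmod.oppz _]/(- (c * m)); move: E.
  rewrite jE i'E j'E !T8 !mulr1 mulrDl !mulrzAl mul1r => /(congr1 ( *~%R^~ c)).
  rewrite mulrzDl -mulrzA (sgn _ sc) mulr1z mul0rz -mulrzA => /eqP.
  by rewrite addr_eq0 => /eqP ->; rewrite mulrNz [m * c]mulrC.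
case: ifP => // /and4P[/eqnP ij /eqnP ii' /eqnP j'E sm] /=.
rewrite -[intRing.mulz c m]/(c * m); split; last by rewrite mulrACA (sgn _ sc) (sgn _ sm).
move: E; rewrite -ij -ii' j'E T8 mulr1 mulrDl !mulrzAl -mulrA => /(congr1 ( *~%R^~ c)).
rewrite mulrzDl -mulrzA (sgn _ sc) mulr1z mul0rz -mulrzA => /eqP.
by rewrite addr_eq0 => /eqP ->; rewrite [m * c]mulrC mulNrz.
Qed.

Lemma choose_actionP (Q : action -> Prop) (I : eqType) (f : I -> action) (r : seq I) :
  (forall i, i \in r -> Q (f i)) -> Q Stuck -> Q (choose_action (map f r)).
Proof.
have pick p x0 (l : seq I) : (forall i, i \in l -> Q (f i)) -> Q x0 ->
    Q (head x0 (filter p (map f l))).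
  elim: l => //= i l IH h h0; case: (p _) => /=; first by apply: h; rewrite mem_head.
  by apply: IH => // j jl; apply: h; rewrite inE jl orbT.
by move=> h h0; do !apply: (pick).
Qed.

Lemma solveP (fuel : nat) (rels : seq poly) (v : env) (e : k) :
  (forall P, P \in rels -> peval T P = 0) -> acts v e -> solve fuel rels v -> decomposed e.
Proof.
move=> rel0; elim: fuel v e => //= f IH v e av.
have := @choose_actionP (sound e) _ (fun P => read_action (normal (subst v P))) rels.
have rd P : P \in rels -> sound e (read_action (normal (subst v P))).
  by move=> /rel0 P0; apply: read_actionP; rewrite peval_normal peval_subst // P0 mul0r.
move=> /(_ rd I); case: choose_action => [|i n|i n|] /= h.
- by rewrite h => _; exact: decomposed0.
- by apply: IH; apply: acts_cons.
- have [E nn] := h.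
  (* From T (T + n) e = 0 and n n = 1: the first summand is killed by T, and T multiplies the second
     by -n. Both are multiples of [e], so earlier assignments persist. *)
  have -> : e = (T i * e + e *~ n) *~ n + - (T i * e) *~ n.
    by rewrite mulrzDl mulNrz addrAC subrr add0r -mulrzA nn mulr1z.
  case/andP => s0 s1; apply: decomposedD.
    apply: IH s0; apply: acts_cons; last first.
      by rewrite mulr0z mulrzAr mulrDr E mulrzAr addrC mulNrz subrr mul0rz.
    have -> : (T i * e + e *~ n) *~ n = ((T i + n%:~R) *~ n) * e.
      by rewrite mulrzAl mulrDl mulrzl.
    exact: acts_mul.
  apply: IH s1; apply: acts_cons; last first.
    by rewrite -[intZmod.oppz n]/(- n) mulrzAr mulrN E !(mulrNz, mulNrz) !opprK.
  have -> : - (T i * e) *~ n = (- T i *~ n) * e by rewrite mulrzAl mulNr.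
  exact: acts_mul.
case/hasP => row rin /allP hrow.
have r37 : (index row value_table < 37)%N by rewrite -[37%N]/(size value_table) index_mem.
pose b := Ordinal r37.
exists (fun a => if a == b then e else 0); split.
  by rewrite (bigD1 b) //= eqxx big1 ?addr0 // => a /negbTE ->.
move=> a i i8; case: eqP => [->|_]; last by rewrite mulr0 mul0rz.
have := hrow i; rewrite mem_iota i8 => /(_ isT).
case E: assigned => [n|] // /int_eqbP nE.
by rewrite (av _ _ E) nE /values nth_index.
Qed.

End Solution.

Lemma size_short_row (v : seq int) : size (short_row v) = 9.
Proof. by rewrite size_rcons size_map. Qed.

Section CellSolution.
Variables (k : comPzRingType) (F : pt -> seq pt -> k).
Hypothesis cF : cell_function F.

Let t := rcons (free_values F) 1.
Let T i := nth 0 t i.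

Lemma relations_hold (P : poly) : P \in relations -> peval T P = 0.
Proof.
case/mapP => r rin ->; rewrite peval_normal.
have := allP relation_data_generic r rin; elim: r {rin} => [|d r IH].
  by rewrite /peval big_nil.
move=> /andP[hd /IH {}IH].
rewrite (_ : flatten _ = swap_poly d.1 d.2.1 d.2.2.1 d.2.2.2 ++
  flatten [seq swap_poly b.1 b.2.1 b.2.2.1 b.2.2.2 | b <- r]) // peval_cat IH addr0.
move: hd; rewrite /swap_poly; set x := nth _ _ _; set y := nth _ _ _; set s := others x _.
case/and4P => u1 u2 xys yxs; have g := gen_uniq u1 u2.
have st : size t = 9 by rewrite size_rcons size_map.
rewrite peval_cat !(@peval_prod _ T t) ?size_cell_comb //.
rewrite -[intZmod.oppz _]/(- d.1) mulrNz -mulrzBl.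
have := cell_swap cF g.
have xs : x \notin s by apply: contra xys => h; rewrite inE h orbT.
have ys : y \notin s by apply: contra yxs => h; rewrite inE h orbT.
have g' : gen (y :: x :: s).
  by apply: gen_sub g => p; rewrite !inE => /or3P[->|->|->]; rewrite ?orbT.
have gy := gen_cons g; have gx := gen_cons g'.
rewrite !(cell_is_value cF) //.
rewrite /cell_value (negbTE xs) (negbTE ys) (negbTE xys) (negbTE yxs) => ->.
by rewrite subrr mul0rz.
Qed.

Lemma decomposed1 : decomposed T 1.
Proof.
exact: (solveP _ relations_hold) solve_relations.
Qed.

End CellSolution.

(** * The thirty-seven measures *)

Definition dot_words : seq (seq nat * nat * seq nat) :=
  [:: ([::], 1, [::]); ([::], 1, [:: 2]); ([:: 1], 2, [::]); ([:: 2], 1, [::]);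
      ([::], 2, [:: 1]); ([:: 1; 3], 2, [::]); ([:: 1], 3, [:: 2]);
      ([::], 2, [:: 3; 1]); ([:: 2], 3, [:: 1]); ([:: 2; 1], 3, [:: 5; 4])]%N.

Definition dot_pt (w : seq nat) (n : nat) : pt := (n, index n w).

Definition dot_cell (d : seq nat * nat * seq nat) : pt * seq pt :=
  let w := d.1.1 ++ d.1.2 :: d.2 in (dot_pt w d.1.2, [seq dot_pt w n | n <- d.1.1 ++ d.2]).

Definition dot_comb (d : seq nat * nat * seq nat) : lincomb :=
  cell_comb (dot_cell d).1 (dot_cell d).2.

Definition free_index : seq nat := [:: 1; 2; 4; 3; 5; 7; 8; 9]%N.

(** In particular the entries for .1 and 1.32, which [short_row] drops, are recovered from the
    others. *)
Lemma dot_table : all (fun row =>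
  vec_eqb [seq dot (short_row row) (dot_comb d) | d <- dot_words] row) value_table.
Proof. by vm_cast_no_check (erefl true). Qed.

(** Eight of the ten tabulated values are the unknowns themselves, so prescribing the ten values
    fixes the measure. *)
Lemma dot_unit : all (fun i => vec_eqb
    (dot_comb (nth ([::], 0, [::])%N dot_words (nth 0%N free_index i)))
    (rcons [seq (j == i)%:R | j <- iota 0 8] 0)) (iota 0 8).
Proof. by vm_cast_no_check (erefl true). Qed.

Lemma eval_unit (k : comPzRingType) (t : seq k) (i : nat) : size t = 8 -> (i < 8)%N ->
  eval (rcons t 1) (rcons [seq (j == i)%:R | j <- iota 0 8] 0) = nth 0 t i.
Proof.
case: t => [|? [|? [|? [|? [|? [|? [|? [|? [|? ?]]]]]]]]] //= _ i8.
have : i \in iota 0 8 by rewrite mem_iota.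
rewrite !inE.
by do 7?[case/orP => [/eqP->|]]; [..|move=> /eqP->];
  rewrite /= !mulr0z mulr1z ?add0r ?addr0.
Qed.

Section Marked.
Variables (k : comPzRingType) (nu : forall Y X : permutation, embedding Y X -> k).
Hypothesis mnu : is_measure nu.

Lemma marked_cell (u v : seq nat) (x : nat) : uniq (u ++ x :: v) ->
  let c := dot_cell (u, x, v) in
  [/\ gen (c.1 :: c.2), c.1 \notin c.2 & mu_marked nu (dotted u x v) = cell_of nu c.1 c.2].
Proof.
move=> uw c; rewrite /c /dot_cell /=; set w := u ++ x :: v in uw *.
have flt (y z : word w) : ((dot_pt w (sval y)).1 < (dot_pt w (sval z)).1)%N = plt y z by [].
have fprec (y z : word w) : ((dot_pt w (sval y)).2 < (dot_pt w (sval z)).2)%N = pprec y z by [].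
pose f : coordinates (word w) := Coordinates flt fprec.
have wE n : (n \in w) = (n == x) || (n \in u ++ v).
  by rewrite /w !mem_cat inE orbCA.
have xuv : x \notin u ++ v.
  move: uw; rewrite /w cat_uniq /= negb_or => /and3P[_ /andP[xu _] /andP[xv _]].
  by rewrite mem_cat negb_or xu xv.
set s := map _ (u ++ v).
have inj n m : dot_pt w n = dot_pt w m -> n = m by case.
have xs : dot_pt w x \notin s by rewrite (mem_map inj).
have tE : dot_pt w x :: s =i map f (enum_perm (word w)).
  move=> p; apply/idP/mapP => [|[y _ ->]]; rewrite -[_ :: s]/(map (dot_pt w) (x :: u ++ v)).
    case/mapP => n; rewrite inE -wE => nw ->.
    by exists (exist _ n nw) => //; exact: mem_enum_perm.
  by rewrite (mem_map inj) inE -wE; exact: (svalP y).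
have g : gen (dot_pt w x :: s).
  by apply: gen_sub (coord_gen f (enum_perm (word w))) => p; rewrite tE.
split=> //; rewrite /mu_marked.
have sE : s =i map (f \o del_incl (mark (dotted u x v))) (enum_perm (del (mark (dotted u x v)))).
  move=> p; apply/idP/mapP => [/mapP[n nuv ->]|[y _ ->]].
    have nw : n \in w by rewrite wE nuv orbT.
    have nx : exist _ n nw <> mark (dotted u x v).
      by move=> /(congr1 sval) /= nx; rewrite nx (negbTE xuv) in nuv.
    by exists (exist _ (exist _ n nw) nx) => //; exact: mem_enum_perm.
  rewrite (mem_map inj); have := svalP (sval y); rewrite wE => /orP[/eqP yx|//].
  by case: (svalP y); apply: word_val_inj.
rewrite (measure_chain mnu sE tE) (@chain_set _ _ (cell_ofP mnu) s s _ [:: dot_pt w x]) //=.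
- by rewrite mulr1.
- by apply: gen_sub g => p; rewrite mem_cat !inE => /or3P[->|->|->]; rewrite ?orbT.
- by move=> p; rewrite !(mem_cat, inE); case: (p \in s); rewrite ?orbT ?orbF.
Qed.

Lemma ten_marked_cell (t : seq k) :
  (forall x s, gen (x :: s) -> cell_of nu x s = cell_value t x s) ->
  [seq mu_marked nu m | m <- ten_marked] = [seq eval t (dot_comb d) | d <- dot_words].
Proof.
move=> h; rewrite -[ten_marked]/[seq dotted d.1.1 d.1.2 d.2 | d <- dot_words] -map_comp.
apply/eq_in_map => -[[u x] v] dw /=.
have uw : all (fun d => uniq (d.1.1 ++ d.1.2 :: d.2)) dot_words by [].
have [g xs ->] := marked_cell (allP uw _ dw).
by rewrite h // /cell_value (negbTE xs).
Qed.

End Marked.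

Lemma valuesP (a : 'I_37) : values a \in value_table.
Proof. by rewrite mem_nth. Qed.

Definition mu (a : 'I_37) : forall Y X : permutation, embedding Y X -> int :=
  mu_of (cell_value (short_row (values a))).

Lemma mu_measure (a : 'I_37) : is_measure (mu a).
Proof. exact/mu_of_measure/row_cell_function/valuesP. Qed.

Lemma cell_of_mu (a : 'I_37) (x : pt) (s : seq pt) : gen (x :: s) ->
  cell_of (mu a) x s = cell_value (short_row (values a)) x s.
Proof. exact/mu_of_incl1/row_cell_function/valuesP. Qed.

Lemma mu_ten (a : 'I_37) : [seq mu_marked (mu a) m | m <- ten_marked] = values a.
Proof.
rewrite (ten_marked_cell (mu_measure a) (@cell_of_mu a)).
rewrite -[RHS](vec_eqbP (allP dot_table _ (valuesP a))).
by apply: eq_map => d; exact: eval_dot.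
Qed.

Lemma mu_unique (a : 'I_37) (nu : forall Y X : permutation, embedding Y X -> int) :
  is_measure nu -> [seq mu_marked nu m | m <- ten_marked] = values a ->
  forall (Y X : permutation) (i : embedding Y X), nu Y X i = mu a i.
Proof.
move=> mnu nuE; pose F := cell_of nu; have cF := cell_ofP mnu.
have FE : free_values F = [seq nth 0 (values a) i | i <- free_index].
  rewrite -nuE (ten_marked_cell mnu (cell_is_value cF)).
  apply: (@eq_from_nth _ 0); rewrite !size_map // => i i8.
  rewrite (nth_map 0%N) // (nth_map ([::], 0%N, [::])); last first.
    by have /allP := isT : all (fun j => j < 10)%N free_index; apply; rewrite mem_nth.
  have := vec_eqbP (allP dot_unit i _); rewrite mem_iota i8 => -> //.
  by rewrite eval_unit // size_map.
have tE : short_row (values a) = rcons (free_values F) 1 by rewrite FE.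
apply: mu_of_cell_of (mnu) (row_cell_function (valuesP a)) _ => x s g.
by rewrite tE; exact: cell_is_value.
Qed.

(** * The universal measure *)

Section SymbolPolynomials.
Variables (R : comNzRingType) (val : symbol -> R).

Definition monomial_value (m : {cmonom symbol}) : R := \prod_(i <- finsupp m) val i ^+ m i.

Lemma monomial_value_sub (m : {cmonom symbol}) (d : {fset symbol}) : (finsupp m `<=` d)%fset ->
  monomial_value m = \prod_(i <- d) val i ^+ m i.
Proof.
move=> md; rewrite /monomial_value; apply: big_fset_incl => // i _.
by rewrite -cmE_eq0 => /eqP ->.
Qed.

Lemma monomial_value_morph : mmorphism monomial_value.
Proof.
split=> [m n|]; last by rewrite /monomial_value mdom1 big_seq_fset0.
rewrite (monomial_value_sub (fsubsetUl (finsupp m) (finsupp n))).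
rewrite (monomial_value_sub (fsubsetUr (finsupp m) (finsupp n))).
rewrite /monomial_value mdomD -big_split /=; apply: eq_bigr => i _.
by rewrite cmM exprD.
Qed.

HB.instance Definition _ :=
  monalg.isMultiplicative.Build _ _ monomial_value monomial_value_morph.

Definition poly_value : symbol_poly -> R := mmap intr monomial_value.

HB.instance Definition _ := GRing.RMorphism.on poly_value.

Lemma poly_valueD : {morph poly_value : p q / p + q}.
Proof. exact: rmorphD. Qed.

Lemma poly_valueM : {morph poly_value : p q / p * q}.
Proof. exact: rmorphM. Qed.

Lemma poly_value_var (Y X : permutation) (i : embedding Y X) :
  poly_value (var i) = val (Symbol i).
Proof.
by rewrite /poly_value mmapU mul1r /= /monomial_value mdomU big_seq_fset1 cmUU.
Qed.

End SymbolPolynomials.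

(** Differences generate the integers from 1; monomials are handled by induction on the degree,
    splitting off one symbol at a time. *)
Lemma symbol_poly_ind (P : symbol_poly -> Prop) : P 1 ->
  (forall p q, P p -> P q -> P (p - q)) ->
  (forall Y X (i : embedding Y X) p, P p -> P (var i * p)) -> forall p, P p.
Proof.
move=> h1 hB hM p; rewrite [p]monalgE.
have h0 : P 0 by rewrite -(subrr 1); apply: hB.
have hN q : P q -> P (- q) by rewrite -sub0r; apply: hB.
have hD q r : P q -> P r -> P (q + r) by move=> hq /hN hr; rewrite -[r]opprK; apply: hB.
have hC (n : int) : P n%:~R.
  have hn m : P m%:R by elim: m => [|m IH] //; rewrite -natr1; apply: hD.
  by case: n => m; [exact: hn|rewrite NegzE mulrNz; apply/hN/hn].
have hU n c (m : {cmonom symbol}) : mdeg m = n -> P << c *g m >>.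
  elim: n m => [|n IH] m mn.
    rewrite (mdeg_eq0I mn) -[c]intz.
    by rewrite (rmorph_int (@malgC {cmonom symbol} int)); exact: hC.
  have [s ms] : exists s, (0 < m s)%N.
    apply: contrapT => h; have m1 : m = mone.
      apply/eqP/cmP => s; rewrite cm1; apply/eqP; rewrite -leqn0 leqNgt.
      by apply/negP => ?; apply: h; exists s.
    by rewrite m1 mdeg1 in mn.
  have mE : m = mmul (ucm s) (divcm m (ucm s)).
    apply/eqP/cmP => t; rewrite cmM divcmE subnKC // ucmE.
    by case: eqP => // <-.
  have -> : << c *g m >> = var (sym_emb s) * << c *g divcm m (ucm s) >>.
    by rewrite {1}mE; case: (s) => Y X i; rewrite /var malgM_def fgmulUU mul1r.
  apply/hM/IH; move: mn; rewrite {1}mE mdegM mdegU add1n; exact: succn_inj.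
elim: (X in \sum_(_ <- X) _) => [|m l IH]; first by rewrite big_nil; exact: h0.
by rewrite big_cons; exact: hD (hU _ _ _ erefl) IH.
Qed.

Definition theta_pi : symbol_poly -> Theta := gen_pi theta_relation.

Lemma theta_pi_eq (p q : symbol_poly) : theta_relation (p - q) -> theta_pi p = theta_pi q.
Proof.
move=> pq; apply/gen_piP/asboolP; exists [:: (1, p - q)]; split.
  by move=> r; rewrite inE => /eqP ->.
by rewrite big_seq1 mul1r.
Qed.

Lemma theta_piD : {morph theta_pi : p q / p + q}.
Proof. exact: gen_piD. Qed.

Lemma theta_piM : {morph theta_pi : p q / p * q}.
Proof. exact: gen_piM. Qed.

Lemma theta_ind (P : Theta -> Prop) : (forall p, P (theta_pi p)) -> forall x, P x.
Proof.
move=> h x.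
by have <- : theta_pi (generic_quotient.repr x) = x by exact: generic_quotient.reprK.
Qed.

Lemma theta_pi0 : theta_pi 0 = 0.
Proof. by apply: (@addrI _ (theta_pi 0)); rewrite -theta_piD !addr0. Qed.

Lemma theta_class_comp (Z Y X : permutation) (j : embedding Y X) (i : embedding Z Y) :
  theta_class (emb_comp j i) = theta_class j * theta_class i.
Proof. exact: etrans (theta_pi_eq (ThetaComp j i)) (theta_piM _ _). Qed.

Lemma theta_class_amalg (Y X Y' : permutation) (i : embedding Y X) (j : embedding Y Y')
    (n : nat) (A : 'I_n -> amalgamation i j) : all_amalgamations A ->
  theta_class i = \sum_(a < n) theta_class (amalg_i (A a)).
Proof.
move=> allA; apply: (etrans (theta_pi_eq (ThetaAmalg allA))).
exact: (big_morph _ theta_piD theta_pi0).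
Qed.

Lemma theta_measure : is_measure (fun Y X (i : embedding Y X) => theta_class i).
Proof.
split=> [Y X i ii|Z Y X j i|Y X Y' i j n A allA].
- exact: (theta_pi_eq (ThetaIso ii)).
- exact: theta_class_comp.
- exact: theta_class_amalg.
Qed.

(** * The ring homomorphism attached to a measure *)

Section ThetaMap.
Variables (R : comNzRingType) (nu : forall Y X : permutation, embedding Y X -> R).
Hypothesis mnu : is_measure nu.

Definition symbol_value (s : symbol) : R := nu (sym_emb s).

Lemma symbol_value_var (Y X : permutation) (i : embedding Y X) :
  poly_value symbol_value (var i) = nu i.
Proof. exact: poly_value_var. Qed.

Lemma theta_relation_value (p : symbol_poly) : theta_relation p ->
  poly_value symbol_value p = 0.
Proof.
have eq r q : poly_value symbol_value r = poly_value symbol_value q ->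
    poly_value symbol_value (r - q) = 0.
  by move=> rq; rewrite rmorphB; apply/eqP; rewrite subr_eq0; apply/eqP.
case=> [Y X i ii|Z Y X j i|Y X Y' i j n A allA]; apply: eq;
  apply: (etrans (symbol_value_var _)).
- exact: etrans (measure_iso mnu ii) (esym (rmorph1 _)).
- apply: (etrans (measure_comp mnu _ _)); apply: (etrans _ (esym (rmorphM _ _ _))).
  by apply: congr2; apply: (esym (symbol_value_var _)).
- apply: (etrans _ (esym (rmorph_sum _ _ _ _))).
  apply: (etrans _ (eq_bigr _ (fun a _ => esym (symbol_value_var (amalg_i (A a)))))).
  by case: (mnu) => _ _ h; apply: h.
Qed.

Definition theta_map (x : Theta) : R := poly_value symbol_value (generic_quotient.repr x).

(** Independence of the representative: two of them differ by a combination of the defining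
    relations, on which a measure takes the value 0. *)
Lemma theta_map_pi (p : symbol_poly) : theta_map (theta_pi p) = poly_value symbol_value p.
Proof.
have : gen_pi theta_relation (generic_quotient.repr (theta_pi p)) =
  gen_pi theta_relation p by exact: generic_quotient.reprK.
move=> /gen_piP/asboolP[s [srel /eqP]]; rewrite subr_eq => /eqP e.
rewrite /theta_map e poly_valueD -[RHS]add0r; congr (_ + _).
have -> : poly_value symbol_value (\sum_(q <- s) q.1 * q.2) =
    \sum_(q <- s) poly_value symbol_value (q.1 * q.2) by exact: rmorph_sum.
rewrite big_seq big1 // => q /srel rq.
by rewrite poly_valueM (theta_relation_value rq) mulr0.
Qed.

Lemma theta_mapD : {morph theta_map : x y / x + y}.
Proof.
apply: theta_ind => p; apply: theta_ind => q; rewrite -theta_piD.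
apply: (etrans (theta_map_pi _)); rewrite poly_valueD; congr (_ + _); exact/esym/theta_map_pi.
Qed.

Lemma theta_mapM : {morph theta_map : x y / x * y}.
Proof.
apply: theta_ind => p; apply: theta_ind => q; rewrite -theta_piM.
apply: (etrans (theta_map_pi _)); rewrite poly_valueM; congr (_ * _); exact/esym/theta_map_pi.
Qed.

Lemma theta_map1 : theta_map 1 = 1.
Proof. exact: etrans (theta_map_pi 1) (rmorph1 _). Qed.

Lemma theta_map_class (Y X : permutation) (i : embedding Y X) :
  theta_map (theta_class i) = nu i.
Proof. exact: etrans (theta_map_pi _) (symbol_value_var _). Qed.

End ThetaMap.

Lemma eval_acts (k : comPzRingType) (c : k) (t : seq k) (r : seq int) (v : lincomb) :
  size t = size r -> (forall i, (i < size t)%N -> nth 0 t i * c = c *~ nth 0 r i) ->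
  eval t v * c = c *~ eval r v.
Proof.
elim: t r v => [|a t IH] [|b r] [|n v] //=; rewrite ?mul0r ?mulr0z // => -[str] h.
rewrite mulrDl mulrzDr mulrzAl (h 0%N) // (IH r v) // => [|i it]; last exact: (h i.+1).
by rewrite mulrzz -mulrzA.
Qed.

Lemma value_table_uniq : uniq value_table.
Proof. by vm_cast_no_check (erefl true). Qed.

Lemma values_inj : injective values.
Proof.
move=> a b /eqP; rewrite nth_uniq ?value_table_uniq //; first by move/eqP/val_inj.
all: exact: ltn_ord.
Qed.

Definition theta_coord (a : 'I_37) : Theta -> int := theta_map (mu a).

Lemma theta_coord_zmod (a : 'I_37) : zmod_morphism (theta_coord a).
Proof.
move=> x y; apply/eqP; rewrite -subr_eq opprK.
by rewrite -(theta_mapD (mu_measure a)) subrK.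
Qed.

Lemma theta_coord_monoid (a : 'I_37) : monoid_morphism (theta_coord a).
Proof.
by split=> [|x y]; [exact: (theta_map1 (mu_measure a))|exact: (theta_mapM (mu_measure a))].
Qed.

HB.instance Definition _ (a : 'I_37) :=
  GRing.isZmodMorphism.Build Theta int (theta_coord a) (theta_coord_zmod a).
HB.instance Definition _ (a : 'I_37) :=
  GRing.isMonoidMorphism.Build Theta int (theta_coord a) (theta_coord_monoid a).

Definition theta_vec (x : Theta) : {ffun 'I_37 -> int} := [ffun a => theta_coord a x].

Lemma theta_vec_zmod : zmod_morphism theta_vec.
Proof. by move=> x y; apply/ffunP => a; rewrite !ffunE rmorphB. Qed.

Lemma theta_vec_monoid : monoid_morphism theta_vec.
Proof. by split=> [|x y]; apply/ffunP => a; rewrite !ffunE ?rmorph1 ?rmorphM. Qed.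

HB.instance Definition _ :=
  GRing.isZmodMorphism.Build Theta {ffun 'I_37 -> int} theta_vec theta_vec_zmod.
HB.instance Definition _ :=
  GRing.isMonoidMorphism.Build Theta {ffun 'I_37 -> int} theta_vec theta_vec_monoid.

Lemma theta_coord_class (a : 'I_37) (Y X : permutation) (i : embedding Y X) :
  theta_coord a (theta_class i) = mu a i.
Proof. exact: (theta_map_class (mu_measure a)). Qed.

Definition theta_cell : pt -> seq pt -> Theta :=
  cell_of (fun Y X (i : embedding Y X) => theta_class i).

Lemma theta_cellP : cell_function theta_cell.
Proof. exact: cell_ofP theta_measure. Qed.

(** * Eigenvectors in the universal ring and the isomorphism *)

Section Eigenvector.
Variables (a : 'I_37) (c : Theta).
Let r := short_row (values a).
Hypothesis hc : forall i, (i < 8)%N ->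
  nth 0 (rcons (free_values theta_cell) 1) i * c = c *~ nth 0 r i.

Lemma eigen_cell (x : pt) (s : seq pt) : gen (x :: s) ->
  theta_cell x s * c = c *~ cell_value r x s.
Proof.
move=> g; rewrite (cell_is_value theta_cellP g) /cell_value.
case: ifP => _; first by rewrite mul1r mulr1z.
apply: eval_acts; rewrite ?size_short_row ?size_rcons ?size_map // => i.
rewrite ltnS leq_eqVlt => /orP[/eqP->|]; last exact: hc.
by rewrite !nth_rcons !size_map /= mul1r mulr1z.
Qed.

Lemma eigen_class (Y X : permutation) (i : embedding Y X) : theta_class i * c = c *~ mu a i.
Proof.
have := measure_chain theta_measure (i := i) (f := std_coord X) (fun=> erefl) (fun=> erefl).
move=> e; apply: (etrans (congr1 ( *%R^~ c) e)); rewrite /mu /mu_of.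
rewrite -/theta_cell; set s := map _ _; set t := map _ _.
have : gen (s ++ t).
  apply: gen_sub (coord_gen (std_coord X) (enum_perm X)) => p; rewrite mem_cat.
  by move=> /orP[/mapP[y _ ->]|//]; apply/map_f/mem_enum_perm.
elim: t s {e} => [|x t IH] s g /=; first by rewrite mul1r mulr1z.
rewrite -mulrA (IH _ (gen_cons_cat g)) mulrzAr eigen_cell; last first.
  by apply: gen_sub g => p; rewrite mem_cat !inE => /orP[->|->]; rewrite ?orbT.
by rewrite -mulrzA.
Qed.

(** The classes of embeddings generate [Theta], and each of them is a chain of cell values, which
    are integral combinations of the eight unknowns and 1. *)
Lemma eigen (z : Theta) : z * c = c *~ theta_coord a z.
Proof.
elim/theta_ind: z => p; rewrite /theta_coord (theta_map_pi (mu_measure a)).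
elim/symbol_poly_ind: p => [|p q hp hq|Y X i p hp].
- apply: (etrans (mul1r c)); apply: (etrans (esym (mulr1z c))).
  by congr (_ *~ _); exact: (esym (rmorph1 _)).
- have vE : poly_value (symbol_value (mu a)) (p - q) =
      poly_value (symbol_value (mu a)) p - poly_value (symbol_value (mu a)) q.
    exact: rmorphB.
  have pE : theta_pi (p - q) = theta_pi p - theta_pi q.
    by apply/eqP; rewrite -subr_eq opprK -theta_piD subrK.
  by rewrite vE pE mulrBl hp hq mulrzBr.
- rewrite theta_piM -mulrA hp poly_valueM symbol_value_var mulrzAr.
  by rewrite -[theta_pi (var i)]/(theta_class i) eigen_class -mulrzA.
Qed.

End Eigenvector.

Lemma theta_vec_bij : bijective theta_vec.
Proof.
have [c [c1 hc]] := decomposed1 theta_cellP.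
have ceig a z : z * c a = c a *~ theta_coord a z by apply: eigen => i; apply: hc.
(* Applying mu_b to z c_a = mu_a(z) c_a gives (mu_b(z) - mu_a(z)) mu_b(c_a) = 0. If mu_b(c_a) were
   nonzero, it could be cancelled in Z and the rows of a and b would coincide. *)
have delta a b : a != b -> theta_coord b (c a) = 0.
  move=> ab; apply/eqP; apply: contraNT ab => m0; apply/eqP/values_inj.
  rewrite -[LHS]mu_ten -[RHS]mu_ten; apply: eq_map => m.
  pose z := mu_marked (fun Y X (i : embedding Y X) => theta_class i) m.
  have zE d : mu_marked (mu d) m = theta_coord d z by exact/esym/theta_coord_class.
  rewrite (zE a) (zE b); apply: (mulIf m0).
  have coordM x y : theta_coord b (x * y) = theta_coord b x * theta_coord b y.
    exact: rmorphM.
  apply: (etrans _ (coordM z (c a))); rewrite (ceig a z).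
  apply: (etrans _ (esym (raddfMz _ _ _))); apply: (etrans (mulrC _ _)).
  by apply: (etrans _ (mulrzr _ _)); rewrite intz.
have delta1 b : theta_coord b (c b) = 1.
  rewrite -(rmorph1 (theta_coord b)) c1 rmorph_sum (bigD1 b) //= big1 ?addr0 // => a ab.
  exact: delta.
(* One composite is the identity because the c_a are eigenvectors with sum 1, the other because
   mu_b(c_a) is 1 for a = b and 0 otherwise. *)
exists (fun f : {ffun 'I_37 -> int} => \sum_a c a *~ f a) => [z|f].
  rewrite -[RHS]mulr1 c1 mulr_sumr; apply: eq_bigr => a _.
  by rewrite ffunE ceig.
have coordMz a b n : theta_coord b (c a *~ n) = theta_coord b (c a) *~ n by exact: raddfMz.
apply/ffunP => b; rewrite ffunE rmorph_sum (bigD1 b) //= big1 ?addr0 => [|a ab].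
  by rewrite coordMz delta1 intz.
by rewrite coordMz delta // mul0rz.
Qed.

Theorem theorem1p1 :
  exists mu : 'I_37 -> forall Y X : permutation, embedding Y X -> int,
    [/\ forall a : 'I_37, is_measure (mu a),
        forall a : 'I_37, [seq mu_marked (mu a) m | m <- ten_marked] = values a,
        forall (a : 'I_37)
          (nu : forall Y X : permutation, embedding Y X -> int),
          is_measure nu ->
          [seq mu_marked nu m | m <- ten_marked] = values a ->
          forall (Y X : permutation) (i : embedding Y X), nu Y X i = mu a Y X i
      & exists Phi : {rmorphism Theta -> {ffun 'I_37 -> int}},
          (forall (Y X : permutation) (i : embedding Y X),
             Phi (theta_class i) = [ffun a : 'I_37 => mu a Y X i])
          /\ bijective Phi].
Proof.
exists mu; split; [exact: mu_measure|exact: mu_ten|exact: mu_unique|].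
exists theta_vec; split=> [Y X i|]; last exact: theta_vec_bij.
by apply/ffunP => a; rewrite !ffunE theta_coord_class.
Qed.
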